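(* Let $\{X_n, n\ge 1\}$ be a sequence of independent random variables, identically distributed as $X$, in a sublinear expectation space $(\Omega,\mathcal H,\mathbb E)$, where $\mathbb E$ is countably sub-additive, with $\mathbb E(X_i)=-\mathbb E(-X_i)=0$ for $i=1,2,\ldots$. Let $\beta>-1$ and $r>1$, and let $\{b_{ni}: 1\le i\le n,\ n\ge 1\}$ be real numbers with $b_{ni}\approx (i/n)^{\beta}(1/n)$ and $\sum_{i=1}^{n} b_{ni}=1$ for all $n\ge 1$. Consider the moment condition $$(\mathrm{M})\qquad \begin{cases} C_{\mathbb V}\left(|X|^{(r-1)/(1+\beta)}\right)<\infty, & \text{if } -1<\beta<-1/r;\\ C_{\mathbb V}\left(|X|^{r}\ln(1+|X|)\right)<\infty, & \text{if } \beta=-1/r;\\ C_{\mathbb V}\left(|X|^{r}\right)<\infty, & \text{if } \beta>-1/r.\end{cases}$$ (1) If (M) holds, then for all $\varepsilon>0$, $$\sum_{n=1}^{\infty} n^{r-2}\,\mathbb E\left\{\left(\max_{1\le j\le n}\left|\sum_{i=1}^{j} b_{ni}X_i\right|-\varepsilon\right)^{+}\right\}<\infty$$ and $$\sum_{n=1}^{\infty} n^{r-2}\,\mathbb V\left\{\max_{1\le j\le n}\left|\sum_{i=1}^{j} b_{ni}X_i\right|>\varepsilon\right\}<\infty .$$ (2) Conversely, if the first of these two series converges for all $\varepsilon>0$, then (M) holds.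
   Context: Setting. $(\Omega,\mathcal F)$ is a measurable space and $\mathcal H$ is a set of random variables on $(\Omega,\mathcal F)$ such that $I_A\in\mathcal H$ for all $A\in\mathcal F$ and such that $X_1,\dots,X_n\in\mathcal H$ implies $\varphi(X_1,\dots,X_n)\in\mathcal H$ for every $\varphi:\mathbb R^n\to\mathbb R$ satisfying $|\varphi(\mathbf x)-\varphi(\mathbf y)|\le C(1+|\mathbf x|^m+|\mathbf y|^m)|\mathbf x-\mathbf y|$ for all $\mathbf x,\mathbf y\in\mathbb R^n$, for some $C>0$, $m\in\mathbb N$ depending on $\varphi$. ''Random variable in the sublinear expectation space'' means an element of $\mathcal H$. Sublinear expectation: $\mathbb E:\mathcal H\to[-\infty,\infty]$ such that for all $X,Y\in\mathcal H$: (a) $X\ge Y$ implies $\mathbb E[X]\ge\mathbb E[Y]$; (b) $\mathbb E[c]=c$ for $c\in\mathbb R$; (c) $\mathbb E[\lambda X]=\lambda\mathbb E[X]$ for $\lambda\ge0$; (d) $\mathbb E[X+Y]\le\mathbb E[X]+\mathbb E[Y]$ whenever the right side is not of the form $\infty-\infty$ or $-\infty+\infty$. Countably sub-additive means: $\mathbb E(X)\le\sum_{n=1}^\infty\mathbb E(X_n)$ whenever $X\le\sum_{n=1}^\infty X_n$, $X,X_n\in\mathcal H$, $X\ge0$, $X_n\ge0$. Capacity and Choquet expectation: $\mathbb V(A):=\mathbb E[I_A]$ for $A\in\mathcal F$, and $C_{\mathbb V}(X):=\int_0^\infty \mathbb V(X>x)\,dx+\int_{-\infty}^0(\mathbb V(X>x)-1)\,dx$.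 Independence: a random vector $\mathbf Y=(Y_1,\dots,Y_n)$, $Y_i\in\mathcal H$, is independent of $\mathbf X=(X_1,\dots,X_m)$, $X_i\in\mathcal H$, if for each Borel-measurable $\psi$ on $\mathbb R^m\times\mathbb R^n$ with $\psi(\mathbf X,\mathbf Y),\psi(\mathbf x,\mathbf Y)\in\mathcal H$ for each $\mathbf x\in\mathbb R^m$, one has $\mathbb E[\psi(\mathbf X,\mathbf Y)]=\mathbb E\big[\mathbb E[\psi(\mathbf x,\mathbf Y)]|_{\mathbf x=\mathbf X}\big]$ whenever $\bar\psi(\mathbf x):=\mathbb E[|\psi(\mathbf x,\mathbf Y)|]<\infty$ for each $\mathbf x$ and $\mathbb E[|\bar\psi(\mathbf X)|]<\infty$. A sequence $\{X_n\}_{n\ge1}$ is a sequence of independent random variables if $X_{n+1}$ is independent of $(X_1,\dots,X_n)$ for each $n\ge1$. Identical distribution: $X_1$ and $X_2$ are identically distributed if $\mathbb E[\psi(X_1)]=\mathbb E[\psi(X_2)]$ for every Borel-measurable $\psi$ with $\psi(X_1),\psi(X_2)\in\mathcal H$, whenever the sublinear expectations are finite. Notation: $x^+=\max\{x,0\}$. $a_n\approx b_n$ means that there is a constant $C>0$ with $a_n\le Cb_n$ and $b_n\le Ca_n$ for $n$ large enough; for the array, $b_{ni}\approx (i/n)^\beta(1/n)$ means that this holds with one constant $C$ for all $1\le i\le n$ and all $n$ large enough. *)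

(* Defs.v *)
From HB Require Import structures.
From mathcomp Require Import all_boot all_order all_algebra.
From mathcomp Require Import all_classical all_reals all_analysis.

Set Implicit Arguments.
Unset Strict Implicit.
Unset Printing Implicit Defensive.

Import Order.TTheory GRing.Theory Num.Theory.
Import numFieldNormedType.Exports.

Local Open Scope classical_set_scope.
Local Open Scope ring_scope.

Section sublinear_expectation_space.
Context {d : measure_display} {Omega : measurableType d} {R : realType}.

Definition euclid_norm n (x : n.-tuple R) : R :=
  Num.sqrt (\sum_(i < n) tnth x i ^+ 2).

Definition euclid_dist n (x y : n.-tuple R) : R :=
  euclid_norm [tuple tnth x i - tnth y i | i < n].

Definition poly_locally_lipschitz n (phi : n.-tuple R -> R) : Prop :=
  exists (C : R) (m : nat), 0 < C /\
    forall x y : n.-tuple R,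
      `|phi x - phi y| <=
        C * (1 + euclid_norm x ^+ m + euclid_norm y ^+ m) * euclid_dist x y.

Record random_variable_space (H : set (Omega -> R)) : Prop := {
  rvs_measurable : forall X, H X -> measurable_fun [set: Omega] X ;
  rvs_indic : forall A : set Omega, measurable A -> H \1_A ;
  rvs_comp : forall n (X : 'I_n -> Omega -> R) (phi : n.-tuple R -> R),
    (0 < n)%N -> (forall i, H (X i)) -> poly_locally_lipschitz phi ->
    H (fun w => phi [tuple X i w | i < n]) }.

(* The expectation is a total function on [Omega -> R], but only its values on
   [H] are constrained: what it does outside [H] is irrelevant. *)
Record sublinear_expectation (H : set (Omega -> R))
    (E : (Omega -> R) -> \bar R) : Prop := {
  subexp_mono : forall X Y, H X -> H Y ->
    (forall w, Y w <= X w) -> (E Y <= E X)%E ;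
  subexp_cst : forall c : R, E (cst c) = c%:E ;
  subexp_scale : forall (l : R) X, 0 <= l -> H X ->
    E (fun w => l * X w) = (l%:E * E X)%E ;
  subexp_subadd : forall X Y, H X -> H Y -> adde_def (E X) (E Y) ->
    (E (fun w => (X w + Y w)%R) <= E X + E Y)%E }.

(* The pointwise sum of the [Y n] may be infinite, so it is taken in [\bar R];
   the sequence [Y] is indexed from 0. *)
Definition countably_subadditive (H : set (Omega -> R))
    (E : (Omega -> R) -> \bar R) : Prop :=
  forall (X : Omega -> R) (Y : nat -> Omega -> R),
    H X -> (forall n, H (Y n)) ->
    (forall w, 0 <= X w) -> (forall n w, 0 <= Y n w) ->
    (forall w, ((X w)%:E <= \sum_(n <oo) (Y n w)%:E)%E) ->
    (E X <= \sum_(n <oo) E (Y n))%E.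

Definition capacity (E : (Omega -> R) -> \bar R) (A : set Omega) : \bar R :=
  E \1_A.

Definition choquet (E : (Omega -> R) -> \bar R) (X : Omega -> R) : \bar R :=
  (\int[lebesgue_measure]_(x in `[0%R, +oo[%classic)
      capacity E [set w | (x < X w)%R] +
   \int[lebesgue_measure]_(x in `]-oo, 0%R]%classic)
      (capacity E [set w | (x < X w)%R] - 1))%E.

(* [Y] is independent of [X].  The product sigma-algebra on pairs of tuples is
   the Borel one on R^m x R^n.  Writing an iterated expectation presupposes that
   the functions [psibar (X)] and [E[psi (x, Y)]|_{x = X}] belong to [H]; both
   are required explicitly.  The uses of [fine] are lossless, since
   [psibar x < +oo] makes [psibar x] and [E[psi (x, Y)]] finite. *)
Definition independent_of (H : set (Omega -> R)) (E : (Omega -> R) -> \bar R)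
    m n (X : Omega -> m.-tuple R) (Y : Omega -> n.-tuple R) : Prop :=
  forall psi : m.-tuple R * n.-tuple R -> R,
    measurable_fun [set: m.-tuple R * n.-tuple R] psi ->
    H (fun w => psi (X w, Y w)) ->
    (forall x, H (fun w => psi (x, Y w))) ->
    let psibar x := E (fun w => `|psi (x, Y w)|) in
    let condexp x := E (fun w => psi (x, Y w)) in
    (forall x, (psibar x < +oo)%E) ->
    H (fun w => fine (psibar (X w))) ->
    (E (fun w => `|fine (psibar (X w))|%R) < +oo)%E ->
    H (fun w => fine (condexp (X w))) ->
    E (fun w => psi (X w, Y w)) = E (fun w => fine (condexp (X w))).

(* Sequences are indexed from 1, the term of index 0 is ignored; the tuple in
   the first argument is (X_1, ..., X_n). *)
Definition independent_seq (H : set (Omega -> R)) (E : (Omega -> R) -> \bar R)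
    (X : nat -> Omega -> R) : Prop :=
  forall n, (1 <= n)%N ->
    independent_of H E
      (fun w => [tuple X i.+1 w | i < n]) (fun w => [tuple X n.+1 w]).

Definition identically_distributed (H : set (Omega -> R))
    (E : (Omega -> R) -> \bar R) (X Y : Omega -> R) : Prop :=
  forall psi : R -> R, measurable_fun [set: R] psi ->
    H (psi \o X) -> H (psi \o Y) ->
    E (psi \o X) \is a fin_num -> E (psi \o Y) \is a fin_num ->
    E (psi \o X) = E (psi \o Y).

Definition array_approx (a b : nat -> nat -> R) : Prop :=
  exists2 C : R, 0 < C &
    \forall n \near \oo, forall i, (1 <= i <= n)%N ->
      a n i <= C * b n i /\ b n i <= C * a n i.

Definition max_partial_sum (b : nat -> nat -> R) (X : nat -> Omega -> R)
    (n : nat) (w : Omega) : R :=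
  \big[Num.max/0]_(1 <= j < n.+1) `|\sum_(1 <= i < j.+1) b n i * X i w|.

Definition moment_condition (E : (Omega -> R) -> \bar R) (X : Omega -> R)
    (beta r : R) : Prop :=
  [/\ beta < - r^-1 ->
        (choquet E (fun w => (`|X w| `^ ((r - 1) / (1 + beta)))%R) < +oo)%E,
      beta = - r^-1 ->
        (choquet E (fun w => (`|X w| `^ r * ln (1 + `|X w|))%R) < +oo)%E
    & - r^-1 < beta ->
        (choquet E (fun w => (`|X w| `^ r)%R) < +oo)%E].

End sublinear_expectation_space.

(* Main.v *)
Require Import Defs.
From HB Require Import structures.
From mathcomp Require Import all_boot all_order all_algebra.
From mathcomp Require Import all_classical all_reals all_analysis.
From mathcomp Require Import measurable_realfun ring lra zify.

Set Implicit Arguments.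
Unset Strict Implicit.
Unset Printing Implicit Defensive.

Import Order.TTheory GRing.Theory Num.Theory.
Import numFieldNormedType.Exports.

Local Open Scope classical_set_scope.
Local Open Scope ring_scope.

(* Proof idea.  Write f(t) = V(|X| > t), and let n, i run over the dyadic blocks
   2^a <= n < 2^(a+1), 2^c <= i < 2^(c+1); there 1/b_ni is comparable to
   2^(c + (a-c)(1+beta)), so that both the moment condition and the series
   sum_n n^(r-2) sum_i f(t/b_ni) become weighted sums of the values f(s 2^j), and
   the three regimes of (M) are the three regimes of a geometric series of ratio
   2^(-(1 + beta r)).
   Direct part: clip b_ni X_i at a level delta proportional to eps.  The excess
   (|b_ni X_i| - delta)^+ is summed by countable subadditivity over the levels
   delta 2^k.  For the clipped sums, the exponentials divided by their expectations
   form a supermartingale, and Doob's inequality bounds their maximum by a constant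
   times n^(-(r+1)), which beats the trivial bound n delta of the clipped sums.
   Converse: independence gives V(max_i |b_ni X_i| > 2 eps) >= q / (1 + q) with
   q = sum_i f(2 eps / b_ni).  On a whole dyadic block q is bounded below by some
   q_a, and 2^(a(r-1)) -> oo forces q_a -> 0, so q_a itself is summable with the
   weights 2^(a(r-1)). *)

(** * Random variables and the sublinear expectation *)

(** The expectation is only sublinear and may be infinite, and independence is one-sided: the new
    variable is independent of the past, not conversely. In the direct part (M) is used at two
    strengths. The excess needs the full weighted dyadic sum, while the exponential moments need
    only the weak bound V(|X| > t) <= K t^(-r). Taking lambda proportional to ln n turns all
    exponentials into powers of n: exp(lambda eps) = n^(r+1), while exp(lambda delta) is a power
    small enough to be absorbed by the decay of max_i b_ni, of order n^(-min(1, 1 + beta)). The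
    exponent r + 1 is what n^(r-2) times n delta requires in order to leave n^(-2). The array is
    controlled only for large n, so the first rows are always treated apart. *)

Section random_variables.
Context {d : measure_display} {Omega : measurableType d} {R : realType}.
Variable H : set (Omega -> R).
Hypothesis rvsH : random_variable_space H.

Lemma norm_le_euclid_norm n (x : n.-tuple R) i : `|tnth x i| <= euclid_norm x.
Proof.
rewrite -sqrtr_sqr /euclid_norm ler_wsqrtr// (bigD1 i)//= lerDl.
by apply: sumr_ge0 => j _; exact: sqr_ge0.
Qed.

Lemma norm_le_euclid_dist n (x y : n.-tuple R) i :
  `|tnth x i - tnth y i| <= euclid_dist x y.
Proof.
rewrite /euclid_dist.
have := norm_le_euclid_norm [tuple tnth x j - tnth y j | j < n] i.
by rewrite tnth_mktuple.
Qed.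

Lemma euclid_norm_ge0 n (x : n.-tuple R) : 0 <= euclid_norm x.
Proof. exact: sqrtr_ge0. Qed.

Lemma rv_lipschitz (phi : R -> R) (C : R) X :
  (forall x y, `|phi x - phi y| <= C * `|x - y|) -> H X ->
  H (fun w => phi (X w)).
Proof.
move=> Hphi HX.
have -> : (fun w => phi (X w)) =
    (fun w => (fun x : 1.-tuple R => phi (tnth x ord0)) [tuple X w | i < 1]).
  by apply/funext => w; rewrite tnth_mktuple.
apply: (@rvs_comp _ _ _ _ rvsH 1 (fun=> X) (fun x => phi (tnth x ord0))) => //.
exists (`|C| + 1), 0; split.
  by rewrite ltr_wpDl.
move=> x y; apply: le_trans (Hphi _ _) _; rewrite !expr0.
have := norm_le_euclid_dist x y ord0.
set D := euclid_dist x y; set N := `|_ - _| => ND.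
have N0 : 0 <= N by exact: normr_ge0.
have C0 := normr_ge0 C.
apply: (@le_trans _ _ (`|C| * D)); last by nra.
apply: (@le_trans _ _ (`|C| * N)); last by rewrite ler_wpM2l.
by rewrite ler_wpM2r// ler_norm.
Qed.

(** The linear growth factor is there for the product, which is not globally Lipschitz. *)
Lemma rv_binop (phi : R -> R -> R) (C : R) X Y :
  (forall x1 x2 y1 y2, `|phi x1 x2 - phi y1 y2| <=
     C * (1 + `|x1| + `|x2| + `|y1| + `|y2|) * (`|x1 - y1| + `|x2 - y2|)) ->
  H X -> H Y -> H (fun w => phi (X w) (Y w)).
Proof.
move=> Hphi HX HY.
pose Z (i : 'I_2) := if i == ord0 then X else Y.
have -> : (fun w => phi (X w) (Y w)) =
    (fun w => (fun x : 2.-tuple R => phi (tnth x ord0) (tnth x ord_max))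
       [tuple Z i w | i < 2]).
  by apply/funext => w; rewrite !tnth_mktuple.
apply: (@rvs_comp _ _ _ _ rvsH 2 Z
  (fun x => phi (tnth x ord0) (tnth x ord_max))) => //.
  by move=> i; rewrite /Z; case: ifP.
exists (4 * (`|C| + 1)), 1; split; first by rewrite mulr_gt0// ltr_wpDl.
move=> x y; apply: le_trans (Hphi _ _ _ _) _; rewrite !expr1.
have a1 := norm_le_euclid_dist x y ord0.
have a2 := norm_le_euclid_dist x y ord_max.
have b1 := norm_le_euclid_norm x ord0.
have b2 := norm_le_euclid_norm x ord_max.
have c1 := norm_le_euclid_norm y ord0.
have c2 := norm_le_euclid_norm y ord_max.
have := ler_norm C; have C0 := normr_ge0 C.
move=> CC.
have d0 : 0 <= euclid_dist x y by exact: euclid_norm_ge0.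
set S := 1 + _ + _ + _ + _; set D := _ + `|_ - _|.
have S1 : S <= 2 * (1 + euclid_norm x + euclid_norm y) by rewrite /S; lra.
have S0 : 0 <= S by rewrite /S !addr_ge0.
have D1 : D <= 2 * euclid_dist x y by rewrite /D; lra.
have D0 : 0 <= D by rewrite /D !addr_ge0.
rewrite (_ : 4 * _ * _ * _ = (`|C| + 1) * (2 * (1 + euclid_norm x + euclid_norm y)) * (2 * euclid_dist x y)); last by ring.
apply: (@le_trans _ _ ((`|C| + 1) * S * D)).
  by rewrite ler_wpM2r// ler_wpM2r//; lra.
apply: ler_pM => //; first by rewrite mulr_ge0//; lra.
by rewrite ler_wpM2l//; lra.
Qed.

Lemma rvD X Y : H X -> H Y -> H (fun w => X w + Y w).
Proof.
apply: (@rv_binop +%R 1) => x1 x2 y1 y2.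
rewrite mul1r (_ : _ - _ = (x1 - y1) + (x2 - y2)); last by ring.
apply: le_trans (ler_normD _ _) _.
by rewrite ler_peMl ?addr_ge0// -!addrA lerDl !addr_ge0.
Qed.

Lemma rvM X Y : H X -> H Y -> H (fun w => X w * Y w).
Proof.
apply: (@rv_binop *%R 1) => x1 x2 y1 y2.
rewrite mul1r (_ : _ - _ = (x1 - y1) * x2 + y1 * (x2 - y2)); last by ring.
apply: le_trans (ler_normD _ _) _; rewrite !normrM.
have := normr_ge0 x1; have := normr_ge0 x2.
have := normr_ge0 y1; have := normr_ge0 y2.
have := normr_ge0 (x1 - y1); have := normr_ge0 (x2 - y2).
nra.
Qed.

Lemma rv_cst (c : R) : H (cst c).
Proof.
have HT : H \1_[set: Omega] by apply: (rvs_indic rvsH).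
apply: (@rv_lipschitz (fun=> c) 0 _ _ HT) => x y.
by rewrite subrr normr0 mul0r.
Qed.

Lemma rvZ (c : R) X : H X -> H (fun w => c * X w).
Proof. by move=> HX; apply: rvM => //; exact: rv_cst. Qed.

Lemma rvN X : H X -> H (fun w => - X w).
Proof.
by move=> HX; under eq_fun do rewrite -mulN1r; exact: rvZ.
Qed.

Lemma rvB X Y : H X -> H Y -> H (fun w => X w - Y w).
Proof. by move=> HX HY; apply: rvD => //; exact: rvN. Qed.

Lemma rv_norm X : H X -> H (fun w => `|X w|).
Proof.
by apply: (@rv_lipschitz _ 1) => x y; rewrite mul1r ler_dist_dist.
Qed.

Lemma rv_max X Y : H X -> H Y -> H (fun w => Num.max (X w) (Y w)).
Proof.
move=> HX HY; under eq_fun do rewrite maxr_absE mulrC.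
by apply: rvZ; apply: rvD; [exact: rvD|apply: rv_norm; exact: rvB].
Qed.

Lemma rv_sum (I : eqType) (s : seq I) (X : I -> Omega -> R) :
  (forall i, i \in s -> H (X i)) -> H (fun w => \sum_(i <- s) X i w).
Proof.
elim: s => [|i s ih] HX.
  by under eq_fun do rewrite big_nil; exact: rv_cst.
under eq_fun do rewrite big_cons; apply: rvD.
  by apply: HX; rewrite mem_head.
by apply: ih => j js; apply: HX; rewrite in_cons js orbT.
Qed.

Lemma rv_bigmax (I : eqType) (s : seq I) (X : I -> Omega -> R) :
  (forall i, i \in s -> H (X i)) -> H (fun w => \big[Num.max/0]_(i <- s) X i w).
Proof.
elim: s => [|i s ih] HX.
  by under eq_fun do rewrite big_nil; exact: rv_cst.
under eq_fun do rewrite big_cons; apply: rv_max.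
  by apply: HX; rewrite mem_head.
by apply: ih => j js; apply: HX; rewrite in_cons js orbT.
Qed.

Lemma rv_measurable_gt X (a : R) : H X -> measurable [set w | a < X w].
Proof.
move=> HX; have := rvs_measurable rvsH HX.
move=> /(_ measurableT `]a, +oo[%classic (measurable_itv _)); rewrite setTI.
by congr (measurable _); apply/seteqP; split=> w /=; rewrite in_itv/= andbT.
Qed.

End random_variables.

Section expectation.
Context {d : measure_display} {Omega : measurableType d} {R : realType}.
Variables (H : set (Omega -> R)) (E : (Omega -> R) -> \bar R).
Hypothesis rvsH : random_variable_space H.
Hypothesis subE : sublinear_expectation H E.

Local Open Scope ereal_scope.

Lemma E_ge X (a : R) : H X -> (forall w, (a <= X w)%R) -> a%:E <= E X.
Proof.
by move=> HX h; rewrite -(subexp_cst subE); apply: (subexp_mono subE) => //;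
  exact: rv_cst.
Qed.

Lemma E_le X (a : R) : H X -> (forall w, (X w <= a)%R) -> E X <= a%:E.
Proof.
by move=> HX h; rewrite -(subexp_cst subE); apply: (subexp_mono subE) => //;
  exact: rv_cst.
Qed.

Lemma E_fin X (a b : R) : H X -> (forall w, (a <= X w <= b)%R) ->
  E X \is a fin_num.
Proof.
move=> HX h; rewrite fin_real//; apply/andP; split.
  by apply: (@lt_le_trans _ _ a%:E); rewrite ?ltNyr// E_ge// => w;
    have /andP[] := h w.
by apply: (@le_lt_trans _ _ b%:E); rewrite ?ltry// E_le// => w;
    have /andP[] := h w.
Qed.

(** Subadditivity is available only when the right-hand side is not of the form oo - oo: one finite
    term guarantees this here, nonnegativity of both terms in [E_subadd_ge0]. *)
Lemma E_subadd_fin X Y : H X -> H Y -> E X \is a fin_num ->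
  E (fun w => X w + Y w)%R <= E X + E Y.
Proof.
move=> HX HY fX; apply: (subexp_subadd subE) => //.
by rewrite fin_num_adde_defr.
Qed.

Lemma E_subadd_ge0 X Y : H X -> H Y -> 0 <= E X -> 0 <= E Y ->
  E (fun w => X w + Y w)%R <= E X + E Y.
Proof.
by move=> HX HY fX fY; apply: (subexp_subadd subE) => //; exact: ge0_adde_def.
Qed.

(** Subadditivity against the constants [c] and [- c] gives the two inequalities. *)
Lemma E_addcst X (c : R) : H X -> E (fun w => X w + c)%R = E X + c%:E.
Proof.
move=> HX.
have le1 Y k : H Y -> E (fun w => Y w + k)%R <= E Y + k%:E.
  move=> HY; rewrite addeC -(subexp_cst subE k); under eq_fun do rewrite addrC.
  apply: (@E_subadd_fin (cst k)) => //; first exact: rv_cst.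
  by rewrite (subexp_cst subE).
have HXc : H (fun w => X w + c)%R by apply: rvD => //; exact: rv_cst.
apply/eqP; rewrite eq_le le1//= -leeBrDr//.
have := le1 _ (- c)%R HXc; rewrite EFinN.
by under eq_fun do rewrite addrK.
Qed.

Lemma E_sum_le (I : eqType) (s : seq I) (X : I -> Omega -> R) :
  (forall i, i \in s -> H (X i)) -> (forall i w, (0 <= X i w)%R) ->
  E (fun w => \sum_(i <- s) X i w)%R <= \sum_(i <- s) E (X i).
Proof.
move=> HX X0; elim: s HX => [|i s ih] HX.
  by under eq_fun do rewrite big_nil; rewrite big_nil (subexp_cst subE 0).
have Hi : H (X i) by apply: HX; rewrite mem_head.
have Hs j : j \in s -> H (X j) by move=> js; apply: HX; rewrite in_cons js orbT.
under eq_fun do rewrite big_cons.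
rewrite big_cons; apply: (le_trans (E_subadd_ge0 _ _ _ _)) => //.
- exact: rv_sum.
- exact: E_ge.
- by apply: E_ge => [|w]; [exact: rv_sum|exact: sumr_ge0].
- by rewrite leeD2l// ih.
Qed.

Lemma capacity_ge0 A : measurable A -> 0 <= capacity E A.
Proof.
move=> mA; apply: E_ge; first exact: (rvs_indic rvsH).
by move=> w; rewrite indicE.
Qed.

Lemma capacity_le1 A : measurable A -> capacity E A <= 1.
Proof.
move=> mA; apply: E_le; first exact: (rvs_indic rvsH).
by move=> w; rewrite indicE; case: (_ \in _).
Qed.

Lemma capacity_fin A : measurable A -> capacity E A \is a fin_num.
Proof.
move=> mA; apply: (@E_fin _ 0 1); first exact: (rvs_indic rvsH).
by move=> w; rewrite indicE; case: (_ \in _); rewrite ?lexx ler01.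
Qed.

Lemma le_capacity A B : measurable A -> measurable B -> A `<=` B ->
  capacity E A <= capacity E B.
Proof.
move=> mA mB AB; apply: (subexp_mono subE); [exact: (rvs_indic rvsH)..|].
move=> w; rewrite !indicE; case: (boolP (w \in A)) => //= wA.
by rewrite mem_set//; apply: AB; exact: set_mem.
Qed.

End expectation.

(** * Independence *)

Section independence.
Context {d : measure_display} {Omega : measurableType d} {R : realType}.
Variables (H : set (Omega -> R)) (E : (Omega -> R) -> \bar R).
Hypothesis rvsH : random_variable_space H.
Hypothesis subE : sublinear_expectation H E.
Variable X : nat -> Omega -> R.
Hypothesis indepX : independent_seq H E X.

(** Boundedness keeps expectations finite, and nonnegativity makes the absolute value in
    [independent_of] harmless. A bounded measurable function of elements of [H] need not lie in [H],
    hence the last clause. *)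
Definition adapted n (Y : Omega -> R) : Prop :=
  exists phi : n.-tuple R -> R,
    [/\ measurable_fun [set: n.-tuple R] phi,
        exists M, forall x, 0 <= phi x <= M,
        Y = (fun w => phi [tuple X i.+1 w | i < n]) & H Y].

Lemma adapted_rv n Y : adapted n Y -> H Y.
Proof. by case=> phi []. Qed.

Lemma adapted_ge0 n Y : adapted n Y -> forall w, 0 <= Y w.
Proof. by case=> phi [_ [M phiM] -> _] w; case/andP: (phiM [tuple X i.+1 w | i < n]). Qed.

Lemma adapted_bounded n Y : adapted n Y ->
  exists M, forall w, 0 <= Y w <= M.
Proof. by case=> phi [_ [M phiM] -> _]; exists M. Qed.

Lemma adapted_fin n Y : adapted n Y -> E Y \is a fin_num.
Proof.
move=> aY; have [M YM] := adapted_bounded aY.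
exact: (E_fin rvsH subE (adapted_rv aY) YM).
Qed.

Lemma adapted_cst n c : 0 <= c -> adapted n (cst c).
Proof.
move=> c0; exists (cst c); split => //; last exact: rv_cst.
by exists c => x; rewrite /= c0 lexx.
Qed.

Lemma adaptedD n Y Z : adapted n Y -> adapted n Z ->
  adapted n (fun w => Y w + Z w).
Proof.
move=> [f [mf [Mf fM] -> HY]] [g [mg [Mg gM] -> HZ]].
exists (fun x => f x + g x); split => //; last exact: rvD.
  exact: measurable_funD.
exists (Mf + Mg) => x; case/andP: (fM x) => ? ?; case/andP: (gM x) => ? ?.
by rewrite addr_ge0//= lerD.
Qed.

Lemma adaptedM n Y Z : adapted n Y -> adapted n Z ->
  adapted n (fun w => Y w * Z w).
Proof.
move=> [f [mf [Mf fM] -> HY]] [g [mg [Mg gM] -> HZ]].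
exists (fun x => f x * g x); split => //; last exact: rvM.
  exact: measurable_funM.
exists (Mf * Mg) => x; case/andP: (fM x) => ? ?; case/andP: (gM x) => ? ?.
by rewrite mulr_ge0//= ler_pM.
Qed.

Lemma adapted_indic n Y (B : set R) : measurable B -> adapted n Y ->
  adapted n (fun w => \1_B (Y w)).
Proof.
move=> mB [f [mf [Mf fM] -> HY]].
exists (fun x => \1_B (f x)); split => //.
- by apply: measurableT_comp => //; exact: measurable_indic.
- by exists 1 => x; rewrite indicE; case: (_ \in _); rewrite ?lexx ler01.
- have := rvs_measurable rvsH HY; move=> /(_ measurableT B mB); rewrite setTI.
  by move=> /(rvs_indic rvsH).
Qed.

Lemma adapted_lift n Y : adapted n Y -> adapted n.+1 Y.
Proof.
move=> [f [mf [Mf fM] -> HY]].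
exists (fun x => f [tuple tnth x (widen_ord (leqnSn n) i) | i < n]); split => //.
- apply: measurableT_comp => //; apply/measurable_fun_tnthP => i.
  rewrite [X in measurable_fun _ X](_ : _ =
    (fun x : n.+1.-tuple R => tnth x (widen_ord (leqnSn n) i))).
    exact: measurable_tnth.
  by apply/funext => x /=; rewrite tnth_mktuple.
- by exists Mf.
- apply/funext => w; congr f; apply: eq_from_tnth => i.
  by rewrite !tnth_mktuple.
Qed.

Lemma adapted_last n (g : R -> R) (M : R) : measurable_fun [set: R] g ->
  (forall y, 0 <= g y <= M) -> H (fun w => g (X n.+1 w)) ->
  adapted n.+1 (fun w => g (X n.+1 w)).
Proof.
move=> mg gM Hg; exists (fun x => g (tnth x ord_max)); split => //.
- by apply: measurableT_comp => //; exact: measurable_tnth.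
- by exists M.
- by apply/funext => w; rewrite tnth_mktuple.
Qed.

(** For fixed x the test function is f x + h x g(y) with h x nonnegative, so translation and
    positive homogeneity compute its expectation exactly, as f x + h x m. Being nonnegative, it
    equals its absolute value, and the two inner expectations in the definition of independence
    coincide. *)
Lemma adapted_indep n (A B : Omega -> R) (g : R -> R) (M : R) :
  adapted n A -> adapted n B -> measurable_fun [set: R] g ->
  (forall y, 0 <= g y <= M) -> H (fun w => g (X n.+1 w)) ->
  E (fun w => A w + B w * g (X n.+1 w)) =
  E (fun w => A w + B w * fine (E (fun w => g (X n.+1 w)))).
Proof.
move=> aA aB mg gM Hg; set m := fine _.
have Eg : E (fun w => g (X n.+1 w)) = m%:E.
  by rewrite fineK//; exact: (E_fin rvsH subE Hg).
have m0 : 0 <= m.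
  by rewrite -lee_fin -Eg; apply: (E_ge rvsH subE) => // w; case/andP: (gM (X n.+1 w)).
have Eaff a b : 0 <= b -> E (fun w => a + b * g (X n.+1 w)) = (a + b * m)%:E.
  move=> b0; under eq_fun do rewrite addrC.
  rewrite (E_addcst rvsH subE); last exact: rvZ.
  by rewrite (subexp_scale subE)// Eg addrC.
(* Independence says nothing about the first variable; there [A] and [B] are functions of the empty
   tuple, hence constants, and the identity is direct. *)
case: n => [|n] in A B aA aB g gM mg Hg m Eg m0 Eaff *.
  have tuple0E w : [tuple X i.+1 w | i < 0] = [tuple] by exact: tuple0.
  case: aA aB => f [_ [Mf fM] -> _] [h [_ [Mh hM] -> _]].
  under eq_fun do rewrite !tuple0E.
  under [in RHS]eq_fun do rewrite !tuple0E.
  rewrite Eaff; last by case/andP: (hM [tuple]).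
  by rewrite (subexp_cst subE).
case: aA aB => f [mf [Mf fM] -> Hf] [h [mh [Mh hM] -> Hh]].
have f0 x : 0 <= f x by case/andP: (fM x).
have h0 x : 0 <= h x by case/andP: (hM x).
have g0 x : 0 <= g x by case/andP: (gM x).
pose psi (p : n.+1.-tuple R * 1.-tuple R) := f p.1 + h p.1 * g (tnth p.2 ord0).
have tE w : tnth [tuple X n.+2 w] ord0 = X n.+2 w by [].
have psiE x w : psi (x, [tuple X n.+2 w]) = f x + h x * g (X n.+2 w) by [].
have absE x w : `|psi (x, [tuple X n.+2 w])| = f x + h x * g (X n.+2 w).
  by rewrite psiE ger0_norm// addr_ge0// mulr_ge0.
have Hfhm : H (fun w => f [tuple X i.+1 w | i < n.+1] + h [tuple X i.+1 w | i < n.+1] * m).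
  by apply: rvD => //; apply: rvM => //; exact: rv_cst.
have pbE x : E (fun w => `|psi (x, [tuple X n.+2 w])|) = (f x + h x * m)%:E.
  by under eq_fun do rewrite absE; rewrite Eaff.
have ceE x : E (fun w => psi (x, [tuple X n.+2 w])) = (f x + h x * m)%:E.
  by under eq_fun do rewrite psiE; rewrite Eaff.
have mpsi : measurable_fun [set: n.+1.-tuple R * 1.-tuple R] psi.
  apply: measurable_funD.
    by apply: measurableT_comp => //.
  apply: measurable_funM; first by apply: measurableT_comp.
  apply: measurableT_comp => //.
  by apply: (measurableT_comp (measurable_tnth ord0)).
have Hpsi : H (fun w => psi ([tuple X i.+1 w | i < n.+1], [tuple X n.+2 w])).
  by apply: rvD => //; exact: rvM.
have Hpsix x : H (fun w => psi (x, [tuple X n.+2 w])).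
  under eq_fun do rewrite psiE.
  apply: (rvD rvsH); [exact: (rv_cst rvsH)|exact: (rvZ rvsH)].
have ind := @indepX n.+1 isT psi mpsi Hpsi Hpsix; cbv zeta in ind.
apply: etrans; first apply: ind.
- by move=> x; rewrite pbE ltry.
- by under eq_fun do rewrite pbE.
- under eq_fun do rewrite pbE.
  apply: (@le_lt_trans _ _ (Mf + Mh * m)%:E); last exact: ltry.
  apply: (E_le rvsH subE) => [|w]; first exact: rv_norm.
  rewrite ger0_norm; last by rewrite addr_ge0// mulr_ge0.
  by apply: lerD; [case/andP: (fM [tuple X i.+1 w | i < n.+1])|
    rewrite ler_wpM2r//; case/andP: (hM [tuple X i.+1 w | i < n.+1])].
- by under eq_fun do rewrite ceE.
- by under eq_fun do rewrite ceE.
Qed.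

End independence.

(** * Hitting events and a maximal inequality *)

Section independent_sequence.
Context {d : measure_display} {Omega : measurableType d} {R : realType}.
Variables (H : set (Omega -> R)) (E : (Omega -> R) -> \bar R).
Hypothesis rvsH : random_variable_space H.
Hypothesis subE : sublinear_expectation H E.
Variable X : nat -> Omega -> R.
Hypothesis HX : forall n, (1 <= n)%N -> H (X n).
Hypothesis indepX : independent_seq H E X.

Lemma measurable_preimage n (B : set R) : (1 <= n)%N -> measurable B ->
  measurable [set w | B (X n w)].
Proof.
move=> n1 mB; have := rvs_measurable rvsH (HX n1).
by move=> /(_ measurableT B mB); rewrite setTI.
Qed.

(** Indicator of the event that some [X i] with 1 <= i <= n falls into [B i], in the affine form
    required by [adapted_indep]. *)
Fixpoint hit (B : nat -> set R) n w : R :=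
  if n is m.+1 then hit B m w + (1 - hit B m w) * \1_(B n) (X n w) else 0.

(** [adapted] is not closed under subtraction, so the complement is carried through the induction as
    a product of indicators of complements. *)
Lemma hit_adapted (B : nat -> set R) n : (forall i, measurable (B i)) ->
  adapted H X n (hit B n) /\ adapted H X n (fun w => 1 - hit B n w).
Proof.
move=> mB.
have aB (C : set R) m : measurable C ->
    adapted H X m.+1 (fun w => \1_C (X m.+1 w)).
  move=> mC; apply: (@adapted_last _ _ _ _ _ _ _ 1).
  - exact: measurable_indic.
  - by move=> y; rewrite indicE; case: (_ \in _); rewrite ?lexx ler01.
  - exact: (rvs_indic rvsH (measurable_preimage _ mC)).
elim: n => [|n [ih1 ih2]].
  split; first exact: (adapted_cst rvsH).
  by rewrite /= subr0; exact: (adapted_cst rvsH).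
split.
  apply: (adaptedD rvsH); first exact: (adapted_lift ih1).
  by apply: (adaptedM rvsH); [exact: (adapted_lift ih2)|exact: aB].
have -> : (fun w => 1 - hit B n.+1 w) =
    (fun w => (1 - hit B n w) * \1_(~` (B n.+1)) (X n.+1 w)).
  apply/funext => w /=; rewrite !indicE in_setC.
  by case: (_ \in _) => /=; rewrite ?(mulr1, mulr0); ring.
apply: (adaptedM rvsH); first exact: (adapted_lift ih2).
by apply: aB; exact: measurableC.
Qed.

Lemma hit_le (B : nat -> set R) (A : set Omega) n :
  (forall i w, (1 <= i <= n)%N -> B i (X i w) -> A w) ->
  forall w, hit B n w <= \1_A w.
Proof.
move=> BA w.
suff : forall m, (m <= n)%N -> hit B m w = 0 \/ hit B m w = 1 /\ A w.
  move=> /(_ n (leqnn _)) [->|[-> Aw]]; rewrite indicE; first by case: (_ \in _).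
  by rewrite mem_set.
elim=> [|m ih] mn /=; first by left.
have [->|[-> Aw]] := ih (ltnW mn).
  rewrite indicE; case: (boolP (X m.+1 w \in _)) => XB /=; last by left; ring.
  right; split; first by ring.
  by apply: (BA m.+1); rewrite ?mn//; exact: set_mem.
by right; split => //; rewrite subrr mul0r addr0.
Qed.

(** The product form makes the bound inductive: a new index multiplies 1 - V by 1 - p and adds p to
    the sum Q, and (1 - p)(1 + Q + p) = 1 + Q - p(Q + p) <= 1 + Q. *)
Lemma E_hit (B : nat -> set R) n : (forall i, measurable (B i)) ->
  (1 - fine (E (hit B n))) *
  (1 + \sum_(1 <= i < n.+1) fine (capacity E [set w | B i (X i w)])) <= 1.
Proof.
move=> mB; elim: n => [|n ih].
  by rewrite big_geq// addr0 mulr1 lerBlDr lerDl (subexp_cst subE 0).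
set p := fun i => fine (capacity E [set w | B i (X i w)]).
have p01 i : (1 <= i)%N -> 0 <= p i <= 1.
  move=> i1; have mBi := measurable_preimage i1 (mB i).
  rewrite -!lee_fin fineK ?(capacity_fin rvsH subE)//.
  by rewrite (capacity_ge0 rvsH subE)//= (capacity_le1 rvsH subE).
have [a1 a2] := hit_adapted n mB.
have rec : E (hit B n.+1) = ((1 - p n.+1) * fine (E (hit B n)) + p n.+1)%:E.
  have g01 (y : R) : 0 <= (\1_(B n.+1) y : R) <= 1.
    by rewrite indicE; case: (_ \in _); rewrite ?lexx ler01.
  have Hgn := rvs_indic rvsH (measurable_preimage (isT : (1 <= n.+1)%N) (mB n.+1)).
  rewrite [LHS](adapted_indep rvsH subE indepX a1 a2
    (measurable_indic (mB n.+1)) g01 Hgn).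
  rewrite -/(p n.+1).
  have -> : (fun w => hit B n w + (1 - hit B n w) * p n.+1) =
      (fun w => (1 - p n.+1) * hit B n w + p n.+1).
    by apply/funext => w; ring.
  have Hh := adapted_rv a1.
  rewrite (E_addcst rvsH subE); last exact: rvZ.
  have /andP[p0 p1] := p01 n.+1 isT.
  rewrite (subexp_scale subE) ?subr_ge0//.
  by rewrite -[X in (_ * X)%E](fineK (adapted_fin rvsH subE a1)) -EFinM -EFinD.
rewrite rec big_nat_recr//= -/(p n.+1) -/p.
set V := fine _ in ih *; set Q := \sum_(_ <= _ < _) _ in ih *.
have Q0 : 0 <= Q.
  by rewrite /Q big_nat; apply: sumr_ge0 => i /andP[i1 _]; case/andP: (p01 i i1).
have V1 : V <= 1.
  rewrite -lee_fin fineK ?(adapted_fin rvsH subE a1)//.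
  apply: (E_le rvsH subE (adapted_rv a1)) => w.
  by have := adapted_ge0 a2 w; rewrite subr_ge0.
have /andP[p0 p1] := p01 n.+1 isT.
have -> : (1 - ((1 - p n.+1) * V + p n.+1)) * (1 + (Q + p n.+1)) =
  (1 - V) * (1 + Q) - (1 - V) * (p n.+1 * (Q + p n.+1)) by ring.
rewrite lerBlDr (le_trans ih)// lerDl mulr_ge0 ?subr_ge0// mulr_ge0//.
by rewrite addr_ge0.
Qed.

(* If p_i is the capacity of {X_i in B_i}, independence gives
   1 - V(some X_i in B_i) = prod (1 - p_i) <= 1 / (1 + sum p_i). *)
Lemma capacity_hit_ge (B : nat -> set R) (A : set Omega) n (q : R) :
  (forall i, measurable (B i)) -> measurable A ->
  (forall i w, (1 <= i <= n)%N -> B i (X i w) -> A w) ->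
  0 <= q ->
  q <= \sum_(1 <= i < n.+1) fine (capacity E [set w | B i (X i w)]) ->
  ((q / (1 + q))%:E <= capacity E A)%E.
Proof.
move=> mB mA BA q0 qQ; have [a1 a2] := hit_adapted n mB.
have fV := adapted_fin rvsH subE a1.
apply: (@le_trans _ _ (E (hit B n))); last first.
  apply: (subexp_mono subE); first exact: (rvs_indic rvsH).
    exact: adapted_rv a1.
  exact: hit_le.
rewrite -(fineK fV) lee_fin.
have V1 : fine (E (hit B n)) <= 1.
  rewrite -lee_fin fineK//.
  apply: (E_le rvsH subE (adapted_rv a1)) => w.
  by have := adapted_ge0 a2 w; rewrite subr_ge0.
have := E_hit n mB; set V := fine _ in V1 *; set Q := \sum_(_ <= _ < _) _ in qQ *.
move=> VQ; rewrite ler_pdivrMr; last by rewrite ltr_pwDl.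
have : (1 - V) * (1 + q) <= 1.
  by apply: le_trans VQ; rewrite ler_wpM2l ?subr_ge0// lerD2l.
lra.
Qed.

Section stopped_product.
Variables (g : nat -> R -> R) (M : nat -> R) (a : R).
Hypothesis mg : forall i, measurable_fun [set: R] (g i).
Hypothesis gM : forall i y, 0 <= g i y <= M i.
Hypothesis Hg : forall i, (1 <= i)%N -> H (fun w => g i (X i w)).
Hypothesis Eg : forall i, (1 <= i)%N -> (E (fun w => g i (X i w)) <= 1)%E.

Fixpoint stopped_product n w : R :=
  if n is m.+1 then
    stopped_product m w * \1_(`[a, +oo[%classic) (stopped_product m w) +
    (stopped_product m w * \1_(`]-oo, a[%classic) (stopped_product m w)) *
    g n (X n w)
  else 1.

Lemma stopped_product_adapted n : adapted H X n (stopped_product n).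
Proof.
elim: n => [|n ih] /=; first exact: (adapted_cst rvsH).
apply: (adaptedD rvsH).
  apply: (adaptedM rvsH); first exact: (adapted_lift ih).
  by apply: (adapted_indic rvsH); [exact: measurable_itv|exact: (adapted_lift ih)].
apply: (adaptedM rvsH).
  apply: (adaptedM rvsH); first exact: (adapted_lift ih).
  by apply: (adapted_indic rvsH); [exact: measurable_itv|exact: (adapted_lift ih)].
exact: (adapted_last (mg n.+1) (gM n.+1) (Hg _)).
Qed.

Lemma E_stopped_product n : (E (stopped_product n) <= 1)%E.
Proof.
elim: n => [|n ih]; first by rewrite (subexp_cst subE 1).
have aN := stopped_product_adapted n.
apply: le_trans ih.
have ind (B : set R) : measurable B ->
    adapted H X n (fun w => stopped_product n w * \1_B (stopped_product n w)).
  by move=> mB; apply: (adaptedM rvsH) => //; exact: (adapted_indic rvsH).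
rewrite [X in (X <= _)%E](adapted_indep rvsH subE indepX
  (ind _ (measurable_itv _)) (ind _ (measurable_itv _)) (mg n.+1) (gM n.+1)
  (Hg (isT : (1 <= n.+1)%N))).
have m1 : 0 <= fine (E (fun w => g n.+1 (X n.+1 w))) <= 1.
  have Hgn := Hg (isT : (1 <= n.+1)%N).
  rewrite -!lee_fin fineK ?(E_fin rvsH subE Hgn (fun w => gM n.+1 (X n.+1 w)))//.
  rewrite Eg// andbT; apply: (E_ge rvsH subE) => // w.
  by case/andP: (gM n.+1 (X n.+1 w)).
case/andP: m1; set m := fine _ => m0 m1.
apply: (subexp_mono subE); first exact: adapted_rv aN.
  apply: (rvD rvsH); first exact: adapted_rv (ind _ (measurable_itv _)).
  apply: (rvM rvsH); last exact: (rv_cst rvsH).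
  exact: adapted_rv (ind _ (measurable_itv _)).
move=> w; have N0 := adapted_ge0 aN w.
rewrite !indicE !mem_setE !in_itv/= andbT; case: leP => _ /=.
  by rewrite mulr1 mulr0 mul0r addr0.
by rewrite mulr1 mulr0 add0r ler_piMr.
Qed.

(** A final value below [a] means that freezing never occurred, so the stopped product was the true
    product at every earlier time. *)
Lemma stopped_product_lt n w : stopped_product n w < a ->
  forall j, (j <= n)%N -> \prod_(1 <= i < j.+1) g i (X i w) < a.
Proof.
suff : stopped_product n w < a ->
    stopped_product n w = \prod_(1 <= i < n.+1) g i (X i w) /\
    forall j, (j <= n)%N -> \prod_(1 <= i < j.+1) g i (X i w) < a.
  by move=> h /h[].
elim: n => [|n ih] /=.
  move=> a1; split; first by rewrite big_geq.
  by move=> j; rewrite leqn0 => /eqP ->; rewrite big_geq.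
rewrite !indicE !mem_setE !in_itv/= andbT.
case: (leP a (stopped_product n w)) => [aN|Na] /=.
  by rewrite mulr1 mulr0 mul0r addr0 ltNge aN.
have [-> ihj] := ih Na.
rewrite mulr0 add0r mulr1 -big_nat_recr//= => lta; split => // j.
by rewrite leq_eqVlt => /predU1P[->//|]; rewrite ltnS; exact: ihj.
Qed.

(* Doob's maximal inequality for the product, which is a supermartingale. *)
Lemma capacity_max_product n (A : set Omega) : 0 < a -> measurable A ->
  (forall w, A w -> exists2 j, (j <= n)%N &
     a <= \prod_(1 <= i < j.+1) g i (X i w)) ->
  (capacity E A <= (a^-1)%:E)%E.
Proof.
move=> a0 mA hA; have aN := stopped_product_adapted n.
have HN := adapted_rv aN.
have : (capacity E A <= a^-1%:E * E (stopped_product n))%E.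
  rewrite -(subexp_scale subE) ?invr_ge0 ?(ltW a0)//.
  apply: (subexp_mono subE); first exact: rvZ.
    exact: (rvs_indic rvsH).
  move=> w; have N0 := adapted_ge0 aN w.
  rewrite indicE; case: (boolP (w \in A)) => [/set_mem Aw|_] /=; last first.
    by rewrite mulr_ge0// invr_ge0 ltW.
  rewrite mulrC ler_pdivlMr// mul1r leNgt; apply/negP => /stopped_product_lt h.
  by have [j jn] := hA w Aw; rewrite leNgt h.
move=> /le_trans; apply.
by rewrite -[leRHS]mule1; apply: lee_wpmul2l => //;
  [rewrite lee_fin invr_ge0 ltW|exact: E_stopped_product].
Qed.

End stopped_product.

End independent_sequence.

(** * Choquet integrals and dyadic levels *)

Section choquet_dyadic.
Context {d : measure_display} {Omega : measurableType d} {R : realType}.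
Variables (H : set (Omega -> R)) (E : (Omega -> R) -> \bar R).
Hypothesis rvsH : random_variable_space H.
Hypothesis subE : sublinear_expectation H E.
Variable Z : Omega -> R.
Hypothesis mZ : forall x, measurable [set w | x < Z w].
Hypothesis Z0 : forall w, 0 <= Z w.

Let tail x := fine (capacity E [set w | x < Z w]).

Let tailE x : capacity E [set w | x < Z w] = (tail x)%:E.
Proof. by rewrite fineK// (capacity_fin rvsH subE). Qed.

Let tail_ge0 x : 0 <= tail x.
Proof. by rewrite -lee_fin -tailE (capacity_ge0 rvsH subE). Qed.

Let tail_le1 x : tail x <= 1.
Proof. by rewrite -lee_fin -tailE (capacity_le1 rvsH subE). Qed.

Let tail_anti x y : x <= y -> tail y <= tail x.
Proof.
move=> xy; rewrite -lee_fin -!tailE (le_capacity rvsH subE)// => w /=.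
exact: le_lt_trans.
Qed.

Let mtail (D : set R) : measurable D -> measurable_fun D (EFin \o tail).
Proof.
move=> mD; apply/measurable_EFinP.
by apply: nonincreasing_measurable => // x y; exact: tail_anti.
Qed.

Lemma choquet_ge0E :
  choquet E Z = (\int[lebesgue_measure]_(x in `[0%R, +oo[%classic) (tail x)%:E)%E.
Proof.
rewrite /choquet; under eq_integral do rewrite tailE.
rewrite [X in (_ + X)%E](_ : _ = 0%E) ?adde0//.
(* The integrand vanishes for x < 0, but at x = 0 the capacity may be less than 1; this null
   endpoint is removed first. *)
rewrite -(@integral_itv_bndo_bndc _ -oo%O).
  apply: integral0_eq => x; rewrite /= in_itv/= => x0.
  rewrite (_ : [set w | x < Z w] = setT).
    have -> : capacity E setT = 1%E.
      by rewrite /capacity (_ : \1_setT = cst 1) ?(subexp_cst subE 1)//;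
        apply/funext => w; rewrite indicT.
    by rewrite subee.
  by apply/seteqP; split => // w _ /=; exact: lt_le_trans (Z0 w).
rewrite [X in measurable_fun _ X](_ : _ = (fun x => (EFin \o tail) x - 1)%E).
  by apply: emeasurable_funB; [apply: mtail|exact: measurable_cst].
by apply/funext => x; rewrite tailE.
Qed.

Variable t : nat -> R.
Hypothesis t0 : 0 <= t 0%N.
Hypothesis t_ndecr : forall n, t n <= t n.+1.

Let t_ge0 n : 0 <= t n.
Proof. by elim: n => // n /le_trans; apply. Qed.

Let step (c : nat -> R) j x : \bar R := ((c j)%:E * (\1_(`[t j, t j.+1[%classic) x)%:E)%E.

Let integral_step (c : nat -> R) j : 0 <= c j ->
  (\int[lebesgue_measure]_(x in `[0%R, +oo[%classic) step c j x =
   ((t j.+1 - t j) * c j)%:E)%E.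
Proof.
move=> c0; rewrite /step ge0_integralZl//; last first.
  by apply/measurable_EFinP; apply: measurable_indic.
rewrite integral_indic//.
rewrite setIidl; last first.
  by move=> x /=; rewrite !in_itv/= andbT => /andP[+ _]; apply: le_trans; exact: t_ge0.
rewrite /= lebesgue_measure_itv/= lte_fin; case: ltP => h.
  by rewrite -EFinB -EFinM mulrC.
have -> : t j.+1 = t j by apply/eqP; rewrite eq_le h t_ndecr.
by rewrite subrr mul0r mule0.
Qed.

Let mstep c j (D : set R) : measurable D -> measurable_fun D (step c j).
Proof.
move=> mD; rewrite /step; under eq_fun do rewrite -EFinM.
by apply/measurable_EFinP; exact: measurable_funM.
Qed.

Let step_ge0 c j x : 0 <= c j -> (0 <= step c j x)%E.
Proof.
by move=> c0; rewrite /step -EFinM lee_fin mulr_ge0// indicE; case: (_ \in _).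
Qed.

(** Lower Darboux sum: on [t_j, t_(j+1)[ the nonincreasing tail is at least its value at the right
    end. *)
Lemma choquet_ge :
  (\sum_(j <oo) ((t j.+1 - t j) * fine (capacity E [set w | t j.+1 < Z w]))%:E
    <= choquet E Z)%E.
Proof.
rewrite choquet_ge0E; set c := fun j => tail (t j.+1).
have c0 j : 0 <= c j by exact: tail_ge0.
rewrite (eq_eseriesr (fun j _ => esym (integral_step (c0 j)))).
rewrite -integral_nneseries//; last 2 first.
  by move=> n; exact: mstep.
  by move=> n x _; exact: step_ge0.
apply: ge0_le_integral => //.
- by move=> x _; apply: nneseries_ge0 => n _ _; exact: step_ge0.
- by apply: ge0_emeasurable_sum => [n x _ _|n _]; [exact: step_ge0|exact: mstep].
- exact: mtail.
move=> x _; apply: lime_le; first by apply: is_cvg_nneseries => n _ _; exact: step_ge0.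
near=> n.
suff : (\sum_(0 <= j < n) step c j x <= (if x < t n then tail x else 0)%:E)%E.
  by move=> /le_trans; apply; rewrite lee_fin; case: ifP.
elim: (n) => [|m ih].
  by rewrite big_geq// lee_fin; case: ifP.
rewrite big_nat_recr//=; apply: (le_trans (leeD2r _ ih)).
rewrite /step -EFinM -EFinD lee_fin indicE mem_setE in_itv/=.
case: (ltP x (t m)) => xm /=.
  by rewrite mulr0 addr0 (lt_le_trans xm).
case: (ltP x (t m.+1)) => xm1 /=; last by rewrite mulr0 addr0.
by rewrite mulr1 add0r; apply: tail_anti; exact: ltW.
Unshelve. all: end_near. Qed.

(** Upper Darboux sum: below [t 0] the tail is at most 1, and every later point lies in a step
    because the levels are unbounded. The least index with x < t n selects that step even if some
    levels coincide. *)
Lemma choquet_le : (forall x, exists n, x < t n) ->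
  (choquet E Z <= (t 0)%:E +
  \sum_(j <oo) ((t j.+1 - t j) * fine (capacity E [set w | (t j < Z w)%R]))%:E)%E.
Proof.
move=> tlim; rewrite choquet_ge0E; set c := fun j => tail (t j).
have c0 j : 0 <= c j by exact: tail_ge0.
rewrite (eq_eseriesr (fun j _ => esym (integral_step (c0 j)))).
rewrite -integral_nneseries//; last 2 first.
  by move=> n; exact: mstep.
  by move=> n x _; exact: step_ge0.
have -> : (t 0)%:E = (\int[lebesgue_measure]_(x in `[0%R, +oo[%classic)
    (\1_(`[0%R, t 0[%classic : set R) x)%:E)%E.
  rewrite integral_indic// setIidl; last first.
    by move=> x /=; rewrite !in_itv/= andbT => /andP[].
  rewrite /= lebesgue_measure_itv/= lte_fin; case: ltP => h.
    by rewrite -EFinB subr0.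
  by congr EFin; apply/eqP; rewrite eq_le t0 h.
have ms : measurable_fun (`[0%R, +oo[%classic : set R) (fun x : R => \sum_(j <oo) step c j x)%E.
  by apply: ge0_emeasurable_sum => [n x _ _|n _]; [exact: step_ge0|exact: mstep].
pose D : set R := `[0%R, +oo[%classic.
have mi : measurable_fun D
    (fun x : R => (\1_(`[0%R, t 0[%classic : set R) x : R)%:E)%E.
  by apply/measurable_EFinP; apply: measurable_indic.
have s0 x : (0 <= \sum_(j <oo) step c j x)%E.
  by apply: nneseries_ge0 => n _ _; exact: step_ge0.
rewrite -ge0_integralD//.
apply: ge0_le_integral => //.
- by move=> x _; rewrite lee_fin.
- exact: mtail.
- exact: emeasurable_funD.
move=> x /=; rewrite in_itv/= andbT => x0.
rewrite indicE mem_setE in_itv/= x0/=; case: ltP => xt0 /=.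
  by rewrite (@le_trans _ _ 1%E) ?lee_fin// leeDl.
rewrite add0e; case: (ex_minnP (tlim x)) => -[|n]; first by rewrite ltNge xt0.
move=> xn nmin.
have nx : t n <= x by rewrite leNgt; apply/negP => /nmin; rewrite ltnn.
apply: (@le_trans _ _ (\sum_(0 <= j < n.+1) step c j x)%E); last first.
  by apply: nneseries_lim_ge => j _ _; exact: step_ge0.
rewrite big_nat_recr//= (@le_trans _ _ (step c n x))//; last first.
  by rewrite leeDr// sume_ge0// => j _; exact: step_ge0.
rewrite /step indicE mem_setE in_itv/= nx xn/= mule1 lee_fin.
exact: tail_anti.
Qed.

End choquet_dyadic.

(** * Dyadic sums *)

Section dyadic.
Context {R : realType}.
Implicit Types (x y r beta : R) (u v F : nat -> R).

Lemma pow2_gt0 x : 0 < 2 `^ x :> R.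
Proof. by rewrite powR_gt0. Qed.

Lemma pow2_ge0 x : 0 <= 2 `^ x :> R.
Proof. exact: powR_ge0. Qed.

Lemma pow2D x y : 2 `^ (x + y) = 2 `^ x * 2 `^ y :> R.
Proof. by rewrite powRD// pnatr_eq0 implybT. Qed.

Lemma ler_pow2 x y : x <= y -> 2 `^ x <= 2 `^ y :> R.
Proof. by apply: ler_powR; rewrite ler1n. Qed.

Lemma ltr_pow2 x y : x < y -> 2 `^ x < 2 `^ y :> R.
Proof.
move=> xy; rewrite /powR pnatr_eq0/= ltr_expR ltr_pM2r//.
by rewrite ln_gt0// ltr1n.
Qed.

Lemma pow2_lt1 x : x < 0 -> 2 `^ x < 1 :> R.
Proof. by move=> /ltr_pow2; rewrite powRr0. Qed.

Lemma pow2_gt1 x : 0 < x -> 1 < 2 `^ x :> R.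
Proof. by move=> /ltr_pow2; rewrite powRr0. Qed.

Lemma pow2Mn x n : 2 `^ (x * n%:R) = (2 `^ x) ^+ n :> R.
Proof. by rewrite powRrM powR_mulrn// pow2_ge0. Qed.

Lemma pow2n n : 2 `^ n%:R = 2 ^+ n :> R.
Proof. by rewrite powR_mulrn. Qed.

Lemma pow2Vl x : 2 `^ (- x) * 2 `^ x = 1 :> R.
Proof. by rewrite -pow2D addNr powRr0. Qed.

Lemma sum_geom_le x n : 0 <= x < 1 -> \sum_(i < n) x ^+ i <= (1 - x)^-1.
Proof.
move=> /andP[x0 x1]; rewrite -[leRHS]mul1r ler_pdivlMr ?subr_gt0// mulrC.
by rewrite -opprB mulNr -subrX1 opprB lerBlDr lerDl exprn_ge0.
Qed.

Lemma sum_geom_last_le y n : 1 < y ->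
  \sum_(i < n.+1) y ^+ i <= y * (y - 1)^-1 * y ^+ n.
Proof.
move=> y1; rewrite mulrAC ler_pdivlMr ?subr_gt0// mulrC -subrX1 exprS.
by rewrite lerBlDr lerDl.
Qed.

Lemma ler_sum_widen u m n : (forall i, 0 <= u i) -> (m <= n)%N ->
  \sum_(i < m) u i <= \sum_(i < n) u i.
Proof.
move=> u0 mn; rewrite -!(big_mkord xpredT) (@big_cat_nat _ _ _ m 0 n)//= lerDl.
exact: sumr_ge0.
Qed.

Lemma ler_sum_cond u (P : pred nat) m n : (forall i, 0 <= u i) ->
  (forall i, P i -> (i < n)%N) -> \sum_(i < m | P i) u i <= \sum_(i < n) u i.
Proof.
move=> u0 Pn; apply: (@le_trans _ _ (\sum_(i < minn m n) u i)); last first.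
  by apply: ler_sum_widen => //; exact: geq_minr.
elim: m => [|m ih]; first by rewrite min0n !big_ord0.
rewrite big_mkcond big_ord_recr/= -big_mkcond/=.
case: ifPn => [/Pn mn|_]; last first.
  by rewrite addr0 (le_trans ih)// ler_sum_widen//; lia.
by move: ih; rewrite (minn_idPl (ltnW mn)) (minn_idPl mn) big_ord_recr/= lerD2r.
Qed.

Lemma ler_sum_shift u k m n : (forall i, 0 <= u i) -> (k + m <= n)%N ->
  \sum_(i < m) u (k + i)%N <= \sum_(i < n | (k <= i)%N) u i.
Proof.
move=> u0 kmn; rewrite [leRHS]big_mkcond/=.
pose v i := if (k <= i)%N then u i else 0.
have v0 i : 0 <= v i by rewrite /v; case: ifP.
apply: (@le_trans _ _ (\sum_(i < k + m) v i)); last exact: (ler_sum_widen v0 kmn).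
elim: m {kmn} => [|m ih]; first by rewrite big_ord0 sumr_ge0.
rewrite addnS !big_ord_recr/= lerD// /v leq_addr.
exact: lexx.
Qed.

Lemma sum_shift u c n :
  \sum_(a < n | (c <= a)%N) u (a - c)%N = \sum_(l < n - c) u l.
Proof.
elim: n => [|n ih]; first by rewrite sub0n !big_ord0.
rewrite big_mkcond big_ord_recr/= -big_mkcond/= ih.
case: leqP => cn; first by rewrite subSn// big_ord_recr.
rewrite addr0 (_ : (n - c = n.+1 - c)%N)//; lia.
Qed.

Lemma sum_triangle (h : nat -> nat -> R) n :
  \sum_(a < n) \sum_(c < a.+1) h (a - c)%N c =
  \sum_(c < n) \sum_(l < n - c) h l c.
Proof.
have -> : \sum_(a < n) \sum_(c < a.+1) h (a - c)%N c =
    \sum_(a < n) \sum_(c < n | (c <= a)%N) h (a - c)%N c.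
  apply: eq_bigr => a _.
  by rewrite (big_ord_widen_cond n xpredT (fun c => h (a - c)%N c)).
rewrite (exchange_big_dep xpredT)//=; apply: eq_bigr => c _.
exact: (sum_shift (fun l => h l c)).
Qed.

(** With e = k + c the exponent is e r + k(1 - r), so for each e the sum over k is geometric with
    ratio 2^(1-r) < 1. *)
Lemma dyadic_convolution r F K D : 1 < r -> (forall j, 0 <= F j) ->
  \sum_(k < K) \sum_(c < D) 2 `^ (k%:R + c%:R * r) * F (k + c)%N <=
  (1 - 2 `^ (1 - r))^-1 * \sum_(e < K + D) 2 `^ (e%:R * r) * F e.
Proof.
move=> r1 F0.
set S := \sum_(e < K + D) _.
apply: (@le_trans _ _ (\sum_(k < K) (2 `^ (1 - r)) ^+ k * S)).
  apply: ler_sum => k _.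
  pose G e := 2 `^ (e%:R * r) * F e.
  have G0 e : 0 <= G e by rewrite mulr_ge0// pow2_ge0.
  under eq_bigr => c _.
    rewrite (_ : 2 `^ _ * _ = 2 `^ (1 - r) ^+ k * G (k + c)%N); first over.
    rewrite /G mulrA -pow2Mn -pow2D; congr (_ `^ _ * _); rewrite natrD; ring.
  rewrite -mulr_sumr ler_wpM2l ?exprn_ge0 ?pow2_ge0//.
  apply: le_trans (ler_sum_shift (n := K + D) G0 _) _.
    by rewrite leq_add2r ltnW.
  rewrite [leLHS]big_mkcond/=; apply: ler_sum => i _; case: ifP => // _; exact: G0.
rewrite -mulr_suml ler_wpM2r//.
  by apply: sumr_ge0 => e _; rewrite mulr_ge0// pow2_ge0.
by apply: sum_geom_le; rewrite pow2_ge0/= pow2_lt1// subr_lt0.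
Qed.

(* The weights with which the capacities of dyadic levels enter the moment
   condition, in the three regimes of beta. *)
Definition dyadic_weight beta r j : R :=
  if beta < - r^-1 then 2 `^ (j%:R * ((r - 1) / (1 + beta)))
  else if beta == - r^-1 then j.+1%:R * 2 `^ (j%:R * r)
  else 2 `^ (j%:R * r).

Lemma dyadic_weight_ge0 beta r j : 0 <= dyadic_weight beta r j.
Proof.
rewrite /dyadic_weight; case: ifP => _; first exact: pow2_ge0.
by case: ifP => _; rewrite ?mulr_ge0// pow2_ge0.
Qed.

(** Each regime is at least as strong as the r-th moment: beta < -1/r means r(1 + beta) < r - 1. *)
Lemma le_dyadic_weight beta r j : -1 < beta -> 1 < r ->
  2 `^ (j%:R * r) <= dyadic_weight beta r j.
Proof.
move=> b1 r1; rewrite /dyadic_weight; case: ifPn => [br|_].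
  apply: ler_pow2; rewrite ler_wpM2l// ler_pdivlMr; last lra.
  have : beta * r < -1 by rewrite -ltr_pdivlMr ?mulN1r//; lra.
  nra.
case: ifP => _ //; rewrite ler_peMl ?pow2_ge0//.
by rewrite ler1n.
Qed.

(** For n in block a, i in block c and l = a - c, the size of 1/b_ni is 2^(c + l(1 + beta));
    rounding l(1 + beta) down gives the index of a dyadic level. *)
Definition level beta l : nat := Num.truncn (l%:R * (1 + beta)).

Lemma level_le beta l : -1 < beta -> (level beta l)%:R <= l%:R * (1 + beta).
Proof.
by move=> b1; rewrite truncn_le mulr_ge0//; lra.
Qed.

Lemma level_gt beta l : l%:R * (1 + beta) < (level beta l).+1%:R.
Proof. exact: truncnS_gt. Qed.

Lemma sum_level_weight beta r : -1 < beta -> 1 < r ->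
  exists2 C : R, 0 < C & forall j L,
  2 `^ (j%:R * r) * \sum_(l < L | (level beta l <= j)%N)
     2 `^ (l%:R * (r - 1) - (level beta l)%:R * r) <= C * dyadic_weight beta r j.
Proof.
move=> b1 r1.
(* The integer part exceeds l(1 + beta) - 1, which costs the factor 2^r; what remains of the
   exponent is l(r - 1) - l(1 + beta) r = -l(1 + beta r). *)
have term l : 2 `^ (l%:R * (r - 1) - (level beta l)%:R * r) <=
    2 `^ r * (2 `^ (- (1 + beta * r))) ^+ l.
  rewrite -pow2Mn -pow2D; apply: ler_pow2.
  have := level_gt beta l; rewrite -natr1 => h.
  have := ler_wpM2r (ltW (lt_trans ltr01 r1)) (ltW h).
  lra.
set y := 2 `^ (- _) in term.
have y0 : 0 <= y by exact: pow2_ge0.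
have r0 : 0 < r by lra.
have termsum (P : pred nat) L : \sum_(l < L | P l)
     2 `^ (l%:R * (r - 1) - (level beta l)%:R * r) <=
     2 `^ r * \sum_(l < L | P l) y ^+ l.
  by rewrite mulr_sumr; apply: ler_sum => l _; exact: term.
(* [level beta l <= j] forces l(1 + beta) < j + 1; this cut is the length of the geometric sum. *)
pose N j := (Num.truncn (j.+1%:R / (1 + beta)) : nat).
have lN j l : (level beta l <= j)%N -> (l < (N j).+1)%N.
  move=> lj; rewrite ltnS /N.
  have h := level_gt beta l.
  have : l%:R <= j.+1%:R / (1 + beta).
    rewrite ler_pdivlMr; last lra.
    by apply: ltW (lt_le_trans h _); rewrite ler_nat.
  by move=> /le_truncn; rewrite natrK.
have Nle j : (N j)%:R <= j.+1%:R / (1 + beta).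
  by rewrite truncn_le divr_ge0//; lra.
have termsumN j L : \sum_(l < L | (level beta l <= j)%N)
     2 `^ (l%:R * (r - 1) - (level beta l)%:R * r) <=
     2 `^ r * \sum_(l < (N j).+1) y ^+ l.
  apply: le_trans (termsum (fun l => (level beta l <= j)%N) L) _.
  rewrite ler_wpM2l ?pow2_ge0//.
  apply: (@ler_sum_cond (fun l => y ^+ l) (fun l => (level beta l <= j)%N)).
    by move=> i; exact: exprn_ge0.
  exact: lN.
rewrite /dyadic_weight; case: ltgtP => [br|br|br].
- have y1 : 1 < y.
    apply: pow2_gt1; have : beta * r < -1 by rewrite -ltr_pdivlMr ?mulN1r.
    lra.
  (* For y > 1 the last term dominates. At the cut it is at most 2^(-(1 + beta r)(j + 1)/(1 +
     beta)); as r - (1 + beta r)/(1 + beta) = (r - 1)/(1 + beta), the part in j yields the weight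
     and the added 1 yields the last factor of [C]. *)
  pose C := 2 `^ r * (y * (y - 1)^-1) * 2 `^ (- (1 + beta * r) / (1 + beta)).
  have C0 : 0 < C.
    by rewrite !mulr_gt0 ?pow2_gt0// ?invr_gt0 ?subr_gt0// (lt_trans _ y1).
  exists C => // j L.
  apply: (@le_trans _ _ (2 `^ (j%:R * r) * (2 `^ r * (y * (y - 1)^-1 * y ^+ N j)))).
    rewrite ler_wpM2l ?pow2_ge0//; apply: le_trans (termsumN j L) _.
    by rewrite ler_wpM2l ?pow2_ge0// sum_geom_last_le.
  rewrite [leLHS](_ : _ =
    2 `^ r * (y * (y - 1)^-1) * (2 `^ (j%:R * r) * y ^+ N j)); last by ring.
  rewrite /C -[leRHS]mulrA ler_wpM2l//.
    by rewrite !mulr_ge0 ?pow2_ge0// invr_ge0 subr_ge0 ltW.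
  rewrite -pow2Mn -!pow2D; apply: ler_pow2.
  have tau0 : 0 <= - (1 + beta * r).
    have br1 : beta * r < -1 by rewrite -ltr_pdivlMr ?mulN1r.
    lra.
  have := ler_wpM2l tau0 (Nle j); rewrite -natr1 => h.
  rewrite -lerBrDl (le_trans h)// le_eqVlt; apply/orP; left; apply/eqP.
  by field; lra.
- have br1 : -1 < beta * r by rewrite -ltr_pdivrMr ?mulN1r.
  have y1 : y < 1 by apply: pow2_lt1; lra.
  exists (2 `^ r * (1 - y)^-1) => [|j L].
    by rewrite mulr_gt0 ?pow2_gt0// invr_gt0 subr_gt0.
  rewrite mulrC ler_wpM2r ?pow2_ge0//; apply: le_trans (termsumN j L) _.
  by rewrite ler_wpM2l ?pow2_ge0// sum_geom_le// y0.
- have ye : y = 1.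
    by rewrite /y br mulNr mulVf ?gt_eqF// subrr oppr0 powRr0.
  have b0 : 0 < (1 + beta)^-1 by rewrite invr_gt0; lra.
  exists (2 `^ r * (1 + (1 + beta)^-1)) => [|j L].
    by rewrite mulr_gt0 ?pow2_gt0//; lra.
  rewrite mulrA [in leRHS]mulrC ler_wpM2l ?pow2_ge0//.
  apply: le_trans (termsumN j L) _; rewrite -mulrA ler_wpM2l ?pow2_ge0//.
  under eq_bigr do rewrite ye expr1n.
  rewrite sumr_const card_ord mulrS mulrDl mul1r lerD//.
    by rewrite ler1n.
  by rewrite mulrC.
Qed.

(** Here k is the layer of the excess, c the block of i, and l the distance from there to the block
    of n. For fixed l, [dyadic_convolution] merges k and c into one index; shifting it by
    [level beta l] and summing over l first leaves [sum_level_weight]. *)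
Lemma dyadic_upper beta r F (B : R) : -1 < beta -> 1 < r ->
  (forall j, 0 <= F j) ->
  (forall J, \sum_(j < J) dyadic_weight beta r j * F j <= B) ->
  exists C : R, forall K N,
    \sum_(l < N) \sum_(c < N) \sum_(k < K)
      2 `^ (k%:R + c%:R * r + l%:R * (r - 1)) * F (k + (c + level beta l))%N <= C.
Proof.
move=> b1 r1 F0 FB; have [C C0 HC] := sum_level_weight b1 r1.
pose D := (1 - 2 `^ (1 - r))^-1 : R.
have D0 : 0 <= D by rewrite invr_ge0 subr_ge0 ltW// pow2_lt1// subr_lt0.
exists (D * (C * B)) => K N.
pose G j := 2 `^ (j%:R * r) * F j.
have G0 j : 0 <= G j by rewrite mulr_ge0// pow2_ge0.
pose w l : R := 2 `^ (l%:R * (r - 1) - (level beta l)%:R * r).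
have w0 l : 0 <= w l by exact: pow2_ge0.
(* One range valid for every l, so that the sums over l and j can be exchanged; the final constant
   does not depend on it. *)
pose J := (K + N + \max_(l < N) level beta l)%N.
have lJ (l : 'I_N) : (level beta l + (K + N) <= J)%N.
  by rewrite addnC leq_add2l (leq_bigmax l).
apply: (@le_trans _ _ (\sum_(l < N) D * (w l * \sum_(j < J | (level beta l <= j)%N) G j))).
  apply: ler_sum => l _; rewrite exchange_big/=.
  have h := ler_wpM2l (pow2_ge0 (l%:R * (r - 1)))
    (@dyadic_convolution r (fun e => F (e + level beta l)%N) K N r1 (fun e => F0 _)).
  rewrite (le_trans (le_trans _ h))//.
    rewrite le_eqVlt; apply/orP; left; apply/eqP.
    rewrite mulr_sumr; apply: eq_bigr => k _.
    rewrite mulr_sumr; apply: eq_bigr => c _.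
    rewrite addnA mulrA -pow2D; congr (_ `^ _ * _); ring.
  rewrite mulrCA ler_wpM2l//.
  apply: le_trans (ler_wpM2l (w0 l) (ler_sum_shift G0 (lJ l))).
  rewrite !mulr_sumr; apply: ler_sum => e _.
  rewrite /w /G !mulrA -!pow2D (addnC (level _ _)) natrD le_eqVlt; apply/orP; left.
  by apply/eqP; congr (_ `^ _ * _); ring.
rewrite -mulr_sumr ler_wpM2l//.
under eq_bigr do rewrite mulr_sumr.
rewrite (exchange_big_dep xpredT)//=.
apply: (@le_trans _ _ (\sum_(j < J) C * (dyadic_weight beta r j * F j))); last first.
  by rewrite -mulr_sumr ler_wpM2l// ltW.
apply: ler_sum => j _; rewrite -mulr_suml /G mulrCA mulrA [in leRHS]mulrA.
by rewrite ler_wpM2r//; exact: HC.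
Qed.

Lemma pow2_unbounded x (M : R) : 0 < x ->
  exists n, forall m, (n <= m)%N -> M < 2 `^ (m%:R * x).
Proof.
move=> x0; pose k := (Num.truncn `|M|).+1.
exists (Num.truncn (k%:R / x)).+1 => m nm.
have Mk : M < k%:R by apply: le_lt_trans (ler_norm _) (truncnS_gt _).
apply: (lt_le_trans Mk); apply: (@le_trans _ _ (2 `^ k%:R)).
  by rewrite pow2n -natrX ler_nat ltnW// ltn_expl.
apply: ler_pow2; rewrite -ler_pdivrMr//.
by apply: ltW (lt_le_trans (truncnS_gt _) _); rewrite ler_nat.
Qed.

(** Each term of the hypothesis is at most B, so once the weight exceeds 2B the ratio q/(1 + q) is
    below 1/2. Then q <= 1, and q <= 2 q/(1 + q). The remaining indices are finitely many. *)
Lemma bounded_sum_ratio s (q : nat -> R) (B : R) a0 : 0 < s ->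
  (forall a, 0 <= q a) ->
  (forall A, \sum_(a < A | (a0 <= a)%N) 2 `^ (a%:R * s) * (q a / (1 + q a)) <= B) ->
  exists C : R, forall A, \sum_(a < A) 2 `^ (a%:R * s) * q a <= C.
Proof.
move=> s0 q0 qB; have [a1 Ha1] := pow2_unbounded (2 * B) s0.
pose u a := 2 `^ (a%:R * s) * q a; pose v a := 2 `^ (a%:R * s) * (q a / (1 + q a)).
have q1 a : 0 < 1 + q a by rewrite ltr_pwDl.
have v0 a : 0 <= v a by rewrite mulr_ge0 ?pow2_ge0// divr_ge0// ltW.
have u0 a : 0 <= u a by rewrite mulr_ge0 ?pow2_ge0.
have uv a : (maxn a0 a1 <= a)%N -> u a <= 2 * v a.
  rewrite geq_max => /andP[a0a a1a].
  have vB : v a <= B.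
    apply: le_trans (qB a.+1).
    rewrite big_mkcond big_ord_recr/= a0a lerDr; apply: sumr_ge0 => i _.
    by case: ifP => // _; exact: v0.
  have := Ha1 a a1a; rewrite /u /v => wB.
  rewrite mulrCA ler_wpM2l ?pow2_ge0// mulrA ler_pdivlMr// mulrC.
  rewrite ler_wpM2r// -lerBrDl (_ : 2 - 1 = 1 :> R); last by ring.
  rewrite leNgt; apply/negP => qgt1.
  have : 1 < 2 * (q a / (1 + q a)) by rewrite mulrA ltr_pdivlMr//; lra.
  move: vB wB (pow2_ge0 (a%:R * s)); rewrite /v.
  by move: (2 `^ _) (q a / _) => W t; nra.
exists (\sum_(a < maxn a0 a1) u a + 2 * B) => A.
rewrite (bigID (fun a : 'I_A => (a < maxn a0 a1)%N))/=; apply: lerD.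
  exact: (ler_sum_cond (u := u) (P := fun a => (a < maxn a0 a1)%N)).
apply: (@le_trans _ _ (2 * \sum_(a < A | (a0 <= a)%N) v a)); last first.
  by rewrite ler_wpM2l.
rewrite mulr_sumr big_mkcond [leRHS]big_mkcond/=; apply: ler_sum => a _.
rewrite -leqNgt geq_max; case: (boolP (a0 <= a)%N) => //= a0a.
case: ifPn => a1a; first by apply: uv; rewrite geq_max a0a.
by rewrite mulr_ge0.
Qed.

(** At the critical value (1 + beta) r = r - 1. For a fixed j, every l with 1 <= l <= j, paired with
    c = j - (level l + 1), gives a term of weight at least 2^(jr - r) whose argument is at most j.
    These j terms, each at least 2^(-r) 2^(jr) Phi(j), produce the factor j behind the logarithm. *)
Lemma dyadic_lower_critical beta r (Phi : R -> R) (B : R) :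
  1 < r -> beta = - r^-1 -> (forall x, 0 <= Phi x) ->
  (forall x y, x <= y -> Phi y <= Phi x) ->
  (forall A, \sum_(a < A) 2 `^ (a%:R * (r - 1)) *
     \sum_(c < a) 2 ^+ c * Phi (c%:R + (a - c)%N%:R * (1 + beta)) <= B) ->
  exists C : R, forall J, \sum_(j < J) j.+1%:R * 2 `^ (j%:R * r) * Phi j%:R <= C.
Proof.
move=> r1 br Phi0 Phianti PhiB.
have r0 : 0 < r by lra.
have rho : (1 + beta) * r = r - 1 by rewrite br; field; lra.
have b1 : -1 < beta by rewrite br ltrN2 invf_lt1.
have bneg : beta < 0 by rewrite br oppr_lt0 invr_gt0.
(* The hypothesis sums only over c < a, that is l > 0; the value 0 at l = 0 completes the
   triangle. *)
pose h l c := if (0 < l)%N then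
  2 `^ (c%:R * r + l%:R * (r - 1)) * Phi (c%:R + l%:R * (1 + beta)) else 0.
have h0 l c : 0 <= h l c by rewrite /h; case: ifP => // _; rewrite mulr_ge0// pow2_ge0.
have key J : \sum_(j < J) j%:R * (2 `^ (j%:R * r) * Phi j%:R) <= 2 `^ r * B.
  apply: (@le_trans _ _ (\sum_(j < J) \sum_(l < J | (0 < l <= j)%N)
      2 `^ r * h l (j - (level beta l).+1)%N)).
    apply: ler_sum => j _.
    apply: (@le_trans _ _ (\sum_(l < J | (0 < l <= j)%N) 2 `^ (j%:R * r) * Phi j%:R)).
      set Y := 2 `^ _ * _; pose u i := if (i <= j)%N then Y else 0.
      have u0 i : 0 <= u i by rewrite /u; case: ifP => // _; rewrite mulr_ge0 ?pow2_ge0.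
      apply: le_trans (le_trans (ler_sum_shift u0 (ltn_ord j : (1 + j <= J)%N)) _).
        rewrite (eq_bigr (fun=> Y)) => [|i _]; last by rewrite /u add1n ltn_ord.
        by rewrite sumr_const card_ord mulr_natl.
      by rewrite big_mkcond [leRHS]big_mkcond; apply: ler_sum => i _; rewrite /u;
        case: (ltnP 0 i); case: (leqP i j).
    apply: ler_sum => l /andP[l0 lj]; rewrite /h l0.
    (* As beta < 0, the level stays strictly below l, hence below j, and the natural subtraction j -
       (level l + 1) is not truncated. *)
    have ml : ((level beta l).+1 <= l)%N.
      rewrite -(ltr_nat R); apply: le_lt_trans (level_le l b1) _.
      by rewrite gtr_pMr ?ltr0n//; lra.
    have lev1 := level_le l b1; have lev2 := level_gt beta l.
    have cE : (j - (level beta l).+1)%N%:R = j%:R - (level beta l).+1%:R :> R.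
      by rewrite natrB// (leq_trans ml).
    rewrite mulrA -pow2D; apply: ler_pM => //.
      apply: ler_pow2; rewrite cE.
      have := ler_wpM2r (ltW r0) lev1; rewrite -mulrA rho -natr1.
      lra.
    by apply: Phianti; rewrite cE; lra.
  rewrite (exchange_big_dep xpredT)//=.
  (* The box l, c < J lies in the triangle c + l < 2J, which is what the hypothesis controls. *)
  have boxB : \sum_(l < J) \sum_(c < J) h l c <= B.
    apply: le_trans (PhiB (J + J)%N).
    have -> : \sum_(a < J + J) 2 `^ (a%:R * (r - 1)) *
        (\sum_(c < a) 2 ^+ c * Phi (c%:R + (a - c)%N%:R * (1 + beta))) =
      \sum_(a < J + J) \sum_(c < a.+1) h (a - c)%N c.
      apply: eq_bigr => a _; rewrite big_ord_recr/= {2}/h subnn/= addr0.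
      rewrite mulr_sumr; apply: eq_bigr => c _.
      rewrite /h subn_gt0 ltn_ord mulrA -pow2n -pow2D natrB; last exact: ltnW.
      by congr (_ `^ _ * _); ring.
    rewrite sum_triangle exchange_big/=.
    apply: (@le_trans _ _ (\sum_(c < J) \sum_(l < J + J - c) h l c)).
      apply: ler_sum => c _; apply: (ler_sum_widen (u := h^~ c)) => //.
      by rewrite -addnBA ?leq_addr// ltnW.
    apply: (ler_sum_widen (u := fun c => \sum_(l < J + J - c) h l c)) => //.
      by move=> c; apply: sumr_ge0.
    exact: leq_addr.
  apply: le_trans (ler_wpM2l (pow2_ge0 r) boxB).
  rewrite mulr_sumr; apply: ler_sum => l _; rewrite mulr_sumr.
  pose u c := 2 `^ r * h l c.
  have u0 c : 0 <= u c by rewrite mulr_ge0// pow2_ge0.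
  apply: (@le_trans _ _ (\sum_(c < J - (level beta l).+1) u c)); last first.
    by apply: ler_sum_widen => //; exact: leq_subr.
  rewrite -(sum_shift u) big_mkcond [leRHS]big_mkcond; apply: ler_sum => j _.
  case: ifPn => [/andP[l0 lj]|_]; last by case: ifP.
  suff -> : ((level beta l).+1 <= j)%N by [].
  apply: leq_trans lj; rewrite -(ltr_nat R); apply: le_lt_trans (level_le l b1) _.
  by rewrite gtr_pMr ?ltr0n//; lra.
(* The index 0, invisible to the factor j, contributes Phi 0; for j >= 1 one has j + 1 <= 2j. *)
exists (2 * (2 `^ r * B) + Phi 0) => -[|J].
  by rewrite big_ord0 addr_ge0// mulr_ge0// (le_trans _ (key 0%N))// big_ord0.
have := key J.+1; rewrite !big_ord_recl/= !mul0r add0r powRr0 !mul1r addrC => h1.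
rewrite lerD2r; apply: le_trans (ler_wpM2l (ler0n _ 2) h1).
rewrite mulr_sumr; apply: ler_sum => j _.
rewrite [leRHS]mulrA -[leLHS]mulrA ler_wpM2r ?mulr_ge0 ?pow2_ge0//.
by rewrite -natrM ler_nat /bump/=; lia.
Qed.

End dyadic.

(** * Tails and the moment condition *)

Lemma nneseries_lt_bounded {R : realType} (u : nat -> R) (B : R) m :
  (forall n, 0 <= u n) -> (forall n, \sum_(m <= i < n) u i <= B) ->
  (\sum_(m <= i <oo) (u i)%:E < +oo)%E.
Proof.
move=> u0 uB; apply: (@le_lt_trans _ _ B%:E); last exact: ltry.
apply: lime_le; first by apply: is_cvg_nneseries => n _ _; rewrite lee_fin.
by apply: nearW => n; rewrite sumEFin lee_fin.
Qed.

Lemma bounded_nneseries_lt {R : realType} (u : nat -> R) m :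
  (forall n, 0 <= u n) -> (\sum_(m <= i <oo) (u i)%:E < +oo)%E ->
  exists B : R, forall n, \sum_(m <= i < n) u i <= B.
Proof.
move=> u0 ult; exists (fine (\sum_(m <= i <oo) (u i)%:E)%E) => n.
rewrite -lee_fin fineK; last first.
  by rewrite ge0_fin_numE// nneseries_ge0// => i _ _; rewrite lee_fin.
by rewrite -sumEFin; apply: nneseries_lim_ge => i _ _; rewrite lee_fin.
Qed.

Section tail.
Context {d : measure_display} {Omega : measurableType d} {R : realType}.
Variables (H : set (Omega -> R)) (E : (Omega -> R) -> \bar R).
Hypothesis rvsH : random_variable_space H.
Hypothesis subE : sublinear_expectation H E.

Definition tail (X : Omega -> R) (t : R) : R :=
  fine (capacity E [set w | t < `|X w|]).

Lemma measurable_tail X t : H X -> measurable [set w | t < `|X w|].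
Proof. by move=> HX; apply: (rv_measurable_gt rvsH); exact: (rv_norm rvsH). Qed.

Lemma tailE X t : H X -> capacity E [set w | t < `|X w|] = (tail X t)%:E.
Proof.
by move=> HX; rewrite fineK// (capacity_fin rvsH subE)//; exact: measurable_tail.
Qed.

Lemma tail_ge0 X t : H X -> 0 <= tail X t.
Proof.
move=> HX; rewrite -lee_fin -tailE// (capacity_ge0 rvsH subE)//.
exact: measurable_tail.
Qed.

Lemma tail_le1 X t : H X -> tail X t <= 1.
Proof.
move=> HX; rewrite -lee_fin -tailE// (capacity_le1 rvsH subE)//.
exact: measurable_tail.
Qed.

Lemma tail_anti X s t : H X -> s <= t -> tail X t <= tail X s.
Proof.
move=> HX st; rewrite -lee_fin -!tailE//.
apply: (le_capacity rvsH subE); [exact: measurable_tail..|] => w /=.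
exact: le_lt_trans.
Qed.

Lemma tail_identically_distributed X Y t : H X -> H Y ->
  identically_distributed H E X Y -> tail X t = tail Y t.
Proof.
move=> HX HY XY; rewrite /tail; congr fine.
pose psi : R -> R := \1_[set y | t < `|y|].
have mB : measurable [set y : R | t < `|y|].
  rewrite -[X in measurable X]setTI.
  have := @normr_measurable R setT => /(_ measurableT `]t, +oo[%classic (measurable_itv _)).
  by congr (measurable (_ `&` _)); apply/seteqP; split=> y /=; rewrite in_itv/= andbT.
apply: (XY psi).
- exact: measurable_indic.
- exact: (rvs_indic rvsH (measurable_tail t HX)).
- exact: (rvs_indic rvsH (measurable_tail t HY)).
- exact: (capacity_fin rvsH subE (measurable_tail t HX)).
- exact: (capacity_fin rvsH subE (measurable_tail t HY)).
Qed.

Section choquet_tail.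
Variables (X : Omega -> R) (g : R -> R).
Hypothesis HX : H X.
Hypothesis mg : measurable_fun [set: R] g.
Hypothesis g0 : forall y, 0 <= y -> 0 <= g y.
Hypothesis g_incr : forall x y, 0 <= x -> x < y -> g x < g y.

Let g_ltE x y : 0 <= x -> 0 <= y -> (g x < g y) = (x < y).
Proof.
move=> x0 y0; apply/idP/idP; last exact: g_incr.
rewrite !ltNge; apply: contra; rewrite le_eqVlt => /predU1P[->//|yx].
by rewrite ltW// g_incr.
Qed.

Let g_le x y : 0 <= x -> x <= y -> g x <= g y.
Proof. by move=> x0; rewrite le_eqVlt => /predU1P[->//|xy]; rewrite ltW// g_incr. Qed.

Let mgX x : measurable [set w | x < g `|X w|].
Proof.
have mX : measurable_fun [set: Omega] (fun w => g `|X w|).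
  apply: measurableT_comp => //; apply: measurableT_comp => //.
  exact: rvs_measurable HX.
have := mX measurableT `]x, +oo[%classic (measurable_itv _); rewrite setTI.
by congr (measurable _); apply/seteqP; split=> w /=; rewrite in_itv/= andbT.
Qed.

Let gtailE t : 0 <= t ->
  fine (capacity E [set w | g t < g `|X w|]) = tail X t.
Proof.
move=> t0; congr (fine (capacity E _)); apply/seteqP.
by split=> w /=; rewrite g_ltE.
Qed.

(** Lower Darboux sum at the levels g(s 2^(j-1)): the increment of [g] pays for the weight [W j].
    The comparison may start at [j0], because finitely many terms only change the bound; the
    logarithmic case uses this. *)
Lemma choquet_lt_dyadic (W : nat -> R) (s C : R) (j0 : nat) : 0 < s -> 0 <= C ->
  (forall j, 0 <= W j) ->
  (forall j, (j0 <= j)%N ->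
    W j <= C * (g (s * 2 `^ j%:R) - g (s * 2 `^ (j%:R - 1)))) ->
  (choquet E (fun w => g `|X w|) < +oo)%E ->
  exists B : R, forall J, \sum_(j < J) W j * tail X (s * 2 `^ j%:R) <= B.
Proof.
move=> s0 C0 W0 WC chlt.
pose t j := g (s * 2 `^ (j%:R - 1)).
have sp j : 0 <= s * 2 `^ j by rewrite mulr_ge0 ?pow2_ge0 ?ltW.
have t0 : 0 <= t 0%N by exact: g0.
have tn n : t n <= t n.+1.
  apply: g_le => //; rewrite ler_pM2l//; apply: ler_pow2.
  by rewrite lerD2r ler_nat.
have tS j : t j.+1 = g (s * 2 `^ j%:R) by rewrite /t; congr (g (_ * _ `^ _)); rewrite -natr1 addrK.
have := choquet_ge rvsH subE mgX (fun w => g0 (normr_ge0 (X w))) t0 tn.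
move=> /le_lt_trans => /(_ _ chlt).
pose u j := (t j.+1 - t j) * tail X (s * 2 `^ j%:R).
rewrite (@eq_eseriesr _ _ (fun j => (u j)%:E)); last first.
  by move=> j _; rewrite /u tS -gtailE.
have u0 j : 0 <= u j by rewrite mulr_ge0 ?tail_ge0// subr_ge0.
move=> /(bounded_nneseries_lt u0)[B uB].
exists (\sum_(j < j0) W j * tail X (s * 2 `^ j%:R) + C * B) => J.
rewrite (bigID (fun j : 'I_J => (j < j0)%N))/=; apply: lerD.
  apply: (@ler_sum_cond _ (fun j => W j * tail X (s * 2 `^ j%:R))
    (fun j => (j < j0)%N)) => // j; by rewrite mulr_ge0 ?tail_ge0.
have := ler_wpM2l C0 (uB J); rewrite big_mkord; apply: le_trans.
rewrite mulr_sumr big_mkcond; apply: ler_sum => j _.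
case: ifPn => [|_]; last by rewrite mulr_ge0.
rewrite -leqNgt => jj; rewrite /u mulrA ler_wpM2r ?tail_ge0//.
by rewrite tS; exact: WC.
Qed.

Lemma dyadic_choquet_lt (tau : nat -> R) (B : R) : 0 <= tau 0%N ->
  (forall n, tau n <= tau n.+1) -> (forall x, exists n, x < g (tau n)) ->
  (forall J, \sum_(j < J) g (tau j.+1) * tail X (tau j) <= B) ->
  (choquet E (fun w => g `|X w|) < +oo)%E.
Proof.
move=> tau0 taun taulim tauB.
have tau_ge0 n : 0 <= tau n by elim: n => // n /le_trans; apply.
have gn n : g (tau n) <= g (tau n.+1) by exact: g_le.
apply: le_lt_trans (choquet_le rvsH subE mgX (fun w => g0 (normr_ge0 (X w)))
  (t := g \o tau) (g0 tau0) gn taulim) _.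
rewrite lte_add_pinfty ?ltry//.
pose u j := (g (tau j.+1) - g (tau j)) * tail X (tau j).
rewrite (@eq_eseriesr _ _ (fun j => (u j)%:E)); last first.
  by move=> j _; rewrite /u -gtailE.
apply: (@nneseries_lt_bounded _ _ B) => [n|n].
  by rewrite mulr_ge0 ?tail_ge0// subr_ge0.
rewrite big_mkord; apply: le_trans (tauB n); apply: ler_sum => j _.
by rewrite ler_wpM2r ?tail_ge0// lerBlDr lerDl g0.
Qed.

End choquet_tail.

End tail.

(** * The moment condition on dyadic levels *)

Section moment_tail.
Context {d : measure_display} {Omega : measurableType d} {R : realType}.
Variables (H : set (Omega -> R)) (E : (Omega -> R) -> \bar R).
Hypothesis rvsH : random_variable_space H.
Hypothesis subE : sublinear_expectation H E.
Variables (X : Omega -> R) (beta r : R).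
Hypothesis HX : H X.
Hypothesis beta_gt : -1 < beta.
Hypothesis r_gt : 1 < r.

Lemma powR_incr (p : R) : 0 < p ->
  forall x y, 0 <= x -> x < y -> x `^ p < y `^ p.
Proof.
move=> p0 x y x0 xy; apply: gt0_ltr_powR => //; rewrite nnegrE//.
exact: le_trans (ltW xy).
Qed.

Definition powR_mul_ln (y : R) : R := y `^ r * ln (1 + y).

Lemma powR_mul_ln_ge0 y : 0 <= y -> 0 <= powR_mul_ln y.
Proof. by move=> y0; rewrite mulr_ge0 ?powR_ge0// ln_ge0// lerDl. Qed.

Lemma powR_mul_ln_incr x y : 0 <= x -> x < y -> powR_mul_ln x < powR_mul_ln y.
Proof.
move=> x0 xy; apply: ltr_pM; rewrite ?powR_ge0 ?ln_ge0 ?lerDl//.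
  by apply: powR_incr => //; exact: lt_trans r_gt.
by rewrite ltr_ln ?posrE; lra.
Qed.

Lemma measurable_powR_mul_ln : measurable_fun [set: R] powR_mul_ln.
Proof.
apply: measurable_funM; first exact: measurable_powR.
apply: measurableT_comp; first exact: measurable_ln.
exact: measurable_funD.
Qed.

Lemma powR_scaled_pow2 (s p x : R) : 0 <= s ->
  (s * 2 `^ x) `^ p = s `^ p * 2 `^ (x * p).
Proof. by move=> s0; rewrite powRM ?pow2_ge0// powRrM. Qed.

Lemma choquet_powR_dyadic (p s : R) : 0 < p -> 0 < s ->
  (choquet E (fun w => `|X w| `^ p)%R < +oo)%E ->
  exists B : R, forall J, \sum_(j < J) 2 `^ (j%:R * p) * tail E X (s * 2 `^ j%:R) <= B.
Proof.
move=> p0 s0.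
have c0 : 0 < s `^ p * (1 - 2 `^ (- p)).
  by rewrite mulr_gt0 ?powR_gt0// subr_gt0 pow2_lt1// oppr_lt0.
apply: (choquet_lt_dyadic (g := fun y => y `^ p) rvsH subE HX _ _ _
  (W := fun j => 2 `^ (j%:R * p)) (C := (s `^ p * (1 - 2 `^ (- p)))^-1) (j0 := 0) s0).
- exact: measurable_powR.
- by move=> y _; exact: powR_ge0.
- exact: powR_incr.
- by rewrite invr_ge0 ltW.
- by move=> j; exact: pow2_ge0.
have s0' := ltW s0.
move=> j _; rewrite !powR_scaled_pow2// [leRHS]mulrC ler_pdivlMr//.
by rewrite mulrBl mul1r pow2D le_eqVlt; apply/orP; left; apply/eqP; ring.
Qed.

Lemma choquet_ln_dyadic (s : R) : 0 < s ->
  (choquet E (fun w => `|X w| `^ r * ln (1 + `|X w|))%R < +oo)%E ->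
  exists B : R, forall J,
    \sum_(j < J) (j.+1%:R * 2 `^ (j%:R * r)) * tail E X (s * 2 `^ j%:R) <= B.
Proof.
move=> s0; have r1 := r_gt; have r0 : 0 < r by lra.
have c0 : 0 < s `^ r * (1 - 2 `^ (- r)).
  by rewrite mulr_gt0 ?powR_gt0// subr_gt0 pow2_lt1// oppr_lt0.
have ln20 : 0 < ln 2 :> R by rewrite ln_gt0// ltr1n.
(* Since s > 2^(-K), ln(1 + s 2^j) is at least (j - K) ln 2, and j >= 2K + 1 gives j - K >= (j +
   1)/2; this explains both [j0] and the factor 2 / ln 2. *)
have [K HK] := pow2_unbounded s^-1 (@ltr01 R).
pose C := (s `^ r * (1 - 2 `^ (- r)))^-1 * (2 / ln 2).
apply: (choquet_lt_dyadic (g := powR_mul_ln) rvsH subE HX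
  measurable_powR_mul_ln powR_mul_ln_ge0 powR_mul_ln_incr
  (W := fun j => j.+1%:R * 2 `^ (j%:R * r)) (C := C) (j0 := (2 * K).+1) s0).
- by rewrite mulr_ge0 ?invr_ge0 ?divr_ge0 ?ltW.
- by move=> j; rewrite mulr_ge0 ?pow2_ge0.
move=> j jK; set y := s * 2 `^ j%:R; set y' := s * _.
have y'0 : 0 <= y' by rewrite mulr_ge0 ?pow2_ge0// ltW.
have y'y : y' <= y by rewrite ler_pM2l// ler_pow2//; lra.
have h1 : (y `^ r - y' `^ r) * ln (1 + y) <= powR_mul_ln y - powR_mul_ln y'.
  rewrite mulrBl lerD2l lerN2 ler_wpM2l ?powR_ge0//.
  by rewrite ler_ln ?posrE; lra.
have h2 : y `^ r - y' `^ r = s `^ r * (1 - 2 `^ (- r)) * 2 `^ (j%:R * r).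
  by rewrite !powR_scaled_pow2 ?ltW// mulrBl mul1r pow2D; ring.
have h3 : j.+1%:R <= 2 / ln 2 * ln (1 + y).
  have Kj : (K <= j)%N by lia.
  have jh : (j - K)%:R * ln 2 <= ln (1 + y).
    rewrite -ln_powR ler_ln ?posrE ?pow2_gt0//; last by rewrite ltr_pwDl//; exact: le_trans y'y.
    apply: (@le_trans _ _ y); last by rewrite lerDr.
    rewrite natrB// pow2D mulrC ler_wpM2r ?pow2_ge0//.
    have sK := HK K (leqnn _); rewrite mulr1 in sK.
    rewrite -(ler_pM2r (pow2_gt0 K%:R)) pow2Vl.
    by rewrite -ler_pdivrMl// mulr1 ltW.
  rewrite mulrAC ler_pdivlMr//; apply: le_trans (ler_wpM2l (ler0n _ 2) jh).
  by rewrite mulrA -natrM (ler_wpM2r (ltW ln20))// ler_nat; lia.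
rewrite /C -mulrA ler_pdivlMl//.
apply: le_trans (ler_wpM2l _ h1); last by rewrite divr_ge0 ?ltW.
rewrite h2 [leLHS](_ : _ =
  (s `^ r * (1 - 2 `^ (- r)) * 2 `^ (j%:R * r)) * j.+1%:R); last by ring.
rewrite [leRHS]mulrCA ler_wpM2l// mulr_ge0 ?pow2_ge0// ltW//.
Qed.

Lemma moment_condition_dyadic (s : R) : 0 < s ->
  moment_condition E X beta r ->
  exists B : R, forall J,
    \sum_(j < J) dyadic_weight beta r j * tail E X (s * 2 `^ j%:R) <= B.
Proof.
move=> s0 [M1 M2 M3]; have b1 := beta_gt; have r1 := r_gt.
 rewrite /dyadic_weight; case: ltgtP => br.
- by apply: choquet_powR_dyadic => //; [rewrite divr_gt0//; lra|exact: M1].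
- by apply: choquet_powR_dyadic => //; [lra|exact: M3].
- by apply: choquet_ln_dyadic => //; exact: M2.
Qed.

Lemma exists_dyadic (t : R) : 1 <= t ->
  exists j, 2 `^ j%:R <= t < 2 `^ j.+1%:R.
Proof.
move=> t1; have [n0 /(_ n0 (leqnn _))] := pow2_unbounded t (@ltr01 R).
rewrite mulr1 => tn0.
have ex : exists n, t < 2 `^ n%:R by exists n0.
case: (ex_minnP ex) => -[|j]; first by rewrite powRr0 ltNge t1.
move=> tj jmin; exists j; rewrite tj andbT leNgt; apply/negP => /jmin.
by rewrite ltnn.
Qed.

(** A single term of the bounded dyadic sum is bounded, and in every regime its weight is at least
    2^(jr). This weak moment is all that the exponential estimates take from (M). *)
Lemma tail_le_powR : moment_condition E X beta r ->
  exists2 K : R, 0 < K & forall t, 0 < t -> tail E X t <= K * t `^ (- r).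
Proof.
move=> /(moment_condition_dyadic ltr01)[B HB]; have r1 := r_gt.
(* The factor 2^r passes from t to the dyadic level below it; the added 1 makes K >= 1, which
   settles t < 1, where the tail is at most 1. *)
pose K := (`|B| + 1) * 2 `^ r.
have K1 : 1 <= K.
  rewrite -[1]mul1r ler_pM// ?lerDr//.
  by rewrite ltW// pow2_gt1//; lra.
exists K => [|t t0]; first by lra.
have [t1|t1] := leP 1 t; last first.
  apply: (@le_trans _ _ 1); first exact: (tail_le1 rvsH subE).
  rewrite -[1]mul1r ler_pM// -[leLHS](powRr0 t).
  by apply: ger_powR; lra.
have [j /andP[jt tj]] := exists_dyadic t1.
apply: (@le_trans _ _ (tail E X (2 `^ j%:R))); first exact: (tail_anti rvsH subE).
have h : 2 `^ (j%:R * r) * tail E X (2 `^ j%:R) <= B.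
  have := HB j.+1; rewrite big_ord_recr/= mul1r; apply: le_trans.
  apply: (@le_trans _ _ (dyadic_weight beta r j * tail E X (2 `^ j%:R))).
    by rewrite ler_wpM2r ?(tail_ge0 rvsH subE)// le_dyadic_weight.
  rewrite lerDr sumr_ge0// => i _.
  by rewrite mulr_ge0 ?dyadic_weight_ge0 ?(tail_ge0 rvsH subE).
have tr : 2 `^ (- (j.+1%:R * r)) <= t `^ (- r).
  rewrite !powRN lef_pV2 ?posrE ?powR_gt0// powRrM ltW//.
  by apply: powR_incr; lra.
apply: (@le_trans _ _ (K * 2 `^ (- (j.+1%:R * r)))); last first.
  by rewrite ler_wpM2l//; lra.
rewrite /K -mulrA -pow2D.
have -> : r - j.+1%:R * r = - (j%:R * r) by rewrite -natr1; ring.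
rewrite -(ler_pM2l (pow2_gt0 (j%:R * r))) (le_trans h)//.
rewrite mulrCA -pow2D subrr powRr0 mulr1.
by apply: le_trans (ler_norm B) _; rewrite lerDl.
Qed.

End moment_tail.

(** * Excess over a level *)

Section excess.
Context {d : measure_display} {Omega : measurableType d} {R : realType}.
Variables (H : set (Omega -> R)) (E : (Omega -> R) -> \bar R).
Hypothesis rvsH : random_variable_space H.
Hypothesis subE : sublinear_expectation H E.
Hypothesis csubE : countably_subadditive H E.

Definition excess (delta y : R) : R := Num.max (`|y| - delta) 0.

Lemma excess_ge0 delta y : 0 <= excess delta y.
Proof. by rewrite /excess le_max lexx orbT. Qed.

Lemma rv_excess delta (c : R) Y : H Y -> H (fun w => excess delta (c * Y w)).
Proof.
move=> HY; apply: (rv_max rvsH); last exact: (rv_cst rvsH).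
apply: (rvB rvsH); last exact: (rv_cst rvsH).
by apply: (rv_norm rvsH); exact: (rvZ rvsH).
Qed.

(** The minimum makes the statement inductive: raising the cap from delta 2^n to delta 2^(n+1) adds
    a layer of height delta 2^n, present only if |y| exceeds its base. *)
Lemma excess_layers (delta y : R) n : 0 < delta ->
  Num.min `|y| (delta * 2 ^+ n) - delta <=
  \sum_(k < n) delta * 2 ^+ k * (delta * 2 ^+ k < `|y|)%R%:R.
Proof.
move=> d0; elim: n => [|n ih].
  by rewrite big_ord0 expr0 mulr1 subr_le0 ge_min lexx orbT.
rewrite big_ord_recr/=; set S := \sum_(_ < n) _ in ih *.
have p0 : 0 < delta * 2 ^+ n by rewrite mulr_gt0// exprn_gt0.
case: (ltP (delta * 2 ^+ n) `|y|) => yn; rewrite ?mulr1 ?mulr0 ?addr0.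
  rewrite (min_idPr (ltW yn)) in ih.
  have : Num.min `|y| (delta * 2 ^+ n.+1) <= delta * 2 ^+ n + delta * 2 ^+ n.
    by rewrite ge_min; apply/orP; right; rewrite exprS; lra.
  lra.
rewrite (min_idPl yn) in ih; apply: le_trans ih.
by rewrite lerD2r ge_min lexx.
Qed.

Lemma capacity_scaled (c : R) (A : set Omega) : 0 <= c -> measurable A ->
  E (fun w => c * \1_A w) = (c%:E * capacity E A)%E.
Proof. by move=> c0 mA; rewrite (subexp_scale subE)//; exact: (rvs_indic rvsH). Qed.

Lemma tail_scaled (Y : Omega -> R) (c t : R) : c != 0 ->
  [set w | t < `|c * Y w|] = [set w | t / `|c| < `|Y w|].
Proof.
move=> c0; apply/seteqP; split => w /=;
  by rewrite normrM ltr_pdivrMr ?normr_gt0// mulrC.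
Qed.

Lemma E_excess_le Y (c delta : R) : H Y -> c != 0 -> 0 < delta ->
  (E (fun w => excess delta (c * Y w)) <=
   \sum_(k <oo) (delta * 2 ^+ k * tail E Y (delta * 2 ^+ k / `|c|))%:E)%E.
Proof.
move=> HY c0 d0.
have p0 k : 0 < delta * 2 ^+ k by rewrite mulr_gt0// exprn_gt0.
pose A k := [set w | delta * 2 ^+ k < `|c * Y w|].
have mA k : measurable (A k).
  by apply: (rv_measurable_gt rvsH); apply: (rv_norm rvsH); exact: (rvZ rvsH).
have -> : (\sum_(k <oo) (delta * 2 ^+ k * tail E Y (delta * 2 ^+ k / `|c|))%:E =
    \sum_(k <oo) E (fun w => delta * 2 ^+ k * \1_(A k) w)%R)%E.
  apply: eq_eseriesr => k _; rewrite capacity_scaled// ?ltW//.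
  by rewrite /A tail_scaled// (tailE rvsH subE)// -EFinM.
apply: csubE.
- exact: rv_excess.
- by move=> k; apply: (rvZ rvsH); exact: (rvs_indic rvsH).
- by move=> w; exact: excess_ge0.
- by move=> k w; rewrite (mulr_ge0 (ltW (p0 k)))// indicE; case: (_ \in _).
move=> w; set y := c * Y w.
have u0 k : 0 <= delta * 2 ^+ k * (\1_(A k) w : R).
  by rewrite (mulr_ge0 (ltW (p0 k)))// indicE; case: (_ \in _).
(* Pointwise only finitely many layers are needed to cover |y|; the series is nonnegative, so a
   partial sum suffices. *)
have [n yn] : exists n, `|y| <= delta * 2 ^+ n.
  have [n /(_ n (leqnn _))] := pow2_unbounded (`|y| / delta) (@ltr01 R).
  rewrite mulr1 pow2n ltr_pdivrMr// => yn; exists n.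
  by rewrite mulrC ltW.
apply: (@le_trans _ _ (\sum_(0 <= k < n) (delta * 2 ^+ k * (\1_(A k) w : R))%:E)%E); last first.
  by apply: nneseries_lim_ge => k _ _; rewrite lee_fin.
rewrite sumEFin lee_fin /excess ge_max; apply/andP; split; last by rewrite sumr_ge0.
have := excess_layers y n d0; rewrite (min_idPl yn) big_mkord => /le_trans; apply.
apply: ler_sum => k _; rewrite indicE (ler_wpM2l (ltW (p0 k)))//.
by case: ltP => //= yk; rewrite mem_set.
Qed.

Lemma E_excess_powR Y (c delta r K : R) : H Y -> c != 0 -> 0 < delta -> 1 < r ->
  (forall t, 0 < t -> tail E Y t <= K * t `^ (- r)) ->
  (E (fun w => excess delta (c * Y w)) <=
   (K * delta `^ (1 - r) * (1 - 2 `^ (1 - r))^-1 * `|c| `^ r)%:E)%E.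
Proof.
move=> HY c0 d0 r1 HK; apply: le_trans (E_excess_le HY c0 d0) _.
have K0 : 0 <= K.
  by have := HK 1 ltr01; rewrite powR1 mulr1; apply: le_trans; exact: (tail_ge0 rvsH subE).
have c0' : 0 < `|c| by rewrite normr_gt0.
apply: lime_le.
  apply: is_cvg_nneseries => k _ _.
  rewrite lee_fin mulr_ge0 ?(tail_ge0 rvsH subE)//.
  by rewrite (mulr_ge0 (ltW d0))// exprn_ge0.
apply: nearW => n; rewrite sumEFin lee_fin big_mkord.
apply: (@le_trans _ _ (\sum_(k < n) K * delta `^ (1 - r) * `|c| `^ r * (2 `^ (1 - r)) ^+ k)).
  apply: ler_sum => k _.
  have dk : 0 < delta * 2 ^+ k by rewrite mulr_gt0// exprn_gt0.
  apply: (@le_trans _ _ (delta * 2 ^+ k * (K * (delta * 2 ^+ k / `|c|) `^ (- r)))).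
    by rewrite ler_wpM2l ?HK ?divr_gt0// ltW.
  have d0' := ltW d0; have dk' := ltW dk; have c0'' := ltW c0'.
  rewrite powRM ?invr_ge0// -(powR_inv1 c0'') -powRrM mulN1r opprK.
  rewrite powRM ?exprn_ge0// -pow2Mn.
  rewrite -[in leLHS]pow2n -[2 `^ _ `^ _]powRrM.
  have -> : 2 `^ ((1 - r) * k%:R) = 2 `^ k%:R * 2 `^ (k%:R * - r).
    by rewrite -pow2D; congr (_ `^ _); ring.
  have -> : delta `^ (1 - r) = delta * delta `^ (- r).
    by rewrite powRD ?powRr1// (gt_eqF d0) implybT.
  by rewrite le_eqVlt; apply/orP; left; apply/eqP; ring.
rewrite -mulr_sumr [leRHS]mulrAC ler_wpM2l//.
  by rewrite !mulr_ge0 ?powR_ge0.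
by apply: sum_geom_le; rewrite pow2_ge0/= pow2_lt1// subr_lt0.
Qed.

(** |y| <= 1 + [excess 1 y] reduces the first absolute moment to [E_excess_powR] with c = delta =
    1. *)
Lemma E_norm_le Y (r K : R) : H Y -> 1 < r ->
  (forall t, 0 < t -> tail E Y t <= K * t `^ (- r)) ->
  (E (fun w => `|Y w|%R) <= (1 + K * (1 - 2 `^ (1 - r))^-1)%:E)%E.
Proof.
move=> HY r1 HK.
have h := E_excess_powR HY (oner_neq0 R) ltr01 r1 HK.
rewrite normr1 !powR1 !mulr1 in h.
rewrite EFinD addeC; apply: le_trans (leeD2r _ h).
have He := rv_excess 1 1 HY.
rewrite -(E_addcst rvsH subE) //.
apply: (subexp_mono subE).
- by apply: (rvD rvsH) => //; exact: (rv_cst rvsH).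
- exact: (rv_norm rvsH).
by move=> w; rewrite /excess mul1r -lerBlDr le_max lexx.
Qed.

End excess.

(** * Sums over dyadic blocks *)

Section blocks.
Context {R : realType}.
Variables (beta r : R).
Hypothesis beta_gt : -1 < beta.
Hypothesis r_gt : 1 < r.

Lemma sum_blocks (u : nat -> R) A :
  \sum_(1 <= n < 2 ^ A) u n = \sum_(a < A) \sum_(2 ^ a <= n < 2 ^ a.+1) u n.
Proof.
elim: A => [|A ih]; first by rewrite big_geq// big_ord0.
rewrite big_ord_recr/= -ih -big_cat_nat//= ?expn_gt0//.
by rewrite leq_exp2l.
Qed.

Lemma natr_exp2 a : (2 ^ a)%N%:R = 2 `^ a%:R :> R.
Proof. by rewrite natrX pow2n. Qed.

Lemma block_natr_ge a n : (2 ^ a <= n)%N -> 2 `^ a%:R <= n%:R :> R.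
Proof. by rewrite -natr_exp2 ler_nat. Qed.

Lemma block_natr_le a n : (n < 2 ^ a)%N -> n%:R <= 2 `^ a%:R :> R.
Proof. by rewrite -natr_exp2 ler_nat => /ltnW. Qed.

Lemma block_gt0 a n : (2 ^ a <= n)%N -> (0 < n)%N.
Proof. by apply: leq_trans; rewrite expn_gt0. Qed.

(** The sign of r - 2 is not fixed, so the power is split into exponents r and -2, each monotone;
    the lower bound below uses r - 1 and -1 in the same way. *)
Lemma block_powR_le a n : (2 ^ a <= n < 2 ^ a.+1)%N ->
  n%:R `^ (r - 2) <= 2 `^ r * 2 `^ (a%:R * (r - 2)).
Proof.
move=> /andP[an na]; have n0 : 0 < n%:R :> R by rewrite ltr0n (block_gt0 an).
have r1 := r_gt.
rewrite [leLHS]powRD; last by rewrite (gt_eqF n0) implybT.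
have -> : 2 `^ r * 2 `^ (a%:R * (r - 2%:R)) = 2 `^ (a.+1%:R * r) * 2 `^ (a%:R * - 2%:R) :> R.
  by rewrite -!pow2D -natr1; congr (_ `^ _); ring.
apply: ler_pM; rewrite ?powR_ge0//.
  rewrite powRrM; apply: ge0_ler_powR; rewrite ?nnegrE ?pow2_ge0//; first lra.
  exact: block_natr_le.
rewrite powRrM !powRN lef_pV2 ?posrE ?powR_gt0//.
by apply: ge0_ler_powR; rewrite ?nnegrE ?pow2_ge0//; exact: block_natr_ge.
Qed.

Lemma block_powR_ge a n : (2 ^ a <= n < 2 ^ a.+1)%N ->
  2 `^ (a%:R * (r - 2) - 1) <= n%:R `^ (r - 2).
Proof.
move=> /andP[an na]; have n0 : 0 < n%:R :> R by rewrite ltr0n (block_gt0 an).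
have r1 := r_gt.
have -> : r - 2 = (r - 1) + - 1 by ring.
rewrite [leRHS]powRD; last by rewrite (gt_eqF n0) implybT.
have -> : 2 `^ (a%:R * (r - 1 + - 1) - 1) = 2 `^ (a%:R * (r - 1)) * 2 `^ (a.+1%:R * - 1) :> R.
  by rewrite -!pow2D -natr1; congr (_ `^ _); ring.
apply: ler_pM; rewrite ?powR_ge0//.
  rewrite powRrM; apply: ge0_ler_powR; rewrite ?nnegrE ?pow2_ge0//; first lra.
  exact: block_natr_ge.
rewrite powRrM !powRN lef_pV2 ?posrE ?powR_gt0//.
by apply: ge0_ler_powR; rewrite ?nnegrE ?pow2_ge0//; exact: block_natr_le.
Qed.

(** This form replaces beta, of either sign, by the positive exponent 1 + beta, so that the block
    estimates are monotone in i/n. *)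
Lemma cesaro_weightE i n : (0 < i)%N -> (0 < n)%N ->
  (i%:R / n%:R) `^ beta * n%:R^-1 = i%:R^-1 * (i%:R / n%:R) `^ (1 + beta) :> R.
Proof.
move=> i0 n0; have i0' : i%:R != 0 :> R by rewrite pnatr_eq0 -lt0n.
have n0' : n%:R != 0 :> R by rewrite pnatr_eq0 -lt0n.
rewrite powRD; last by rewrite mulf_neq0 ?invr_neq0// implybT.
rewrite powRr1 ?divr_ge0//; field; exact/andP.
Qed.

Lemma cesaro_weight_le i n c a : (2 ^ c <= i < 2 ^ c.+1)%N ->
  (2 ^ a <= n < 2 ^ a.+1)%N -> (c <= a)%N ->
  (i%:R / n%:R) `^ beta * n%:R^-1 <=
  2 `^ (1 + beta) * 2 `^ (- (c%:R + (a - c)%N%:R * (1 + beta))) :> R.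
Proof.
move=> /andP[ci ic] /andP[an na] ca; have b1 := beta_gt.
have i0 := block_gt0 ci; have n0 := block_gt0 an.
rewrite cesaro_weightE// natrB//.
have -> : 2 `^ (1 + beta) * 2 `^ (- (c%:R + (a%:R - c%:R) * (1 + beta))) =
   2 `^ (c%:R * - 1) * (2 `^ (c.+1%:R - a%:R)) `^ (1 + beta) :> R.
  by rewrite -powRrM -!pow2D -natr1; congr (_ `^ _); ring.
apply: ler_pM; rewrite ?powR_ge0 ?invr_ge0//.
  rewrite powRrM powR_inv1 ?pow2_ge0// lef_pV2 ?posrE ?pow2_gt0 ?ltr0n//.
  exact: block_natr_ge.
apply: ge0_ler_powR; rewrite ?nnegrE ?pow2_ge0 ?divr_ge0//; first lra.
rewrite pow2D ler_pM ?invr_ge0//; first exact: block_natr_le.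
by rewrite powRN lef_pV2 ?posrE ?pow2_gt0 ?ltr0n//; exact: block_natr_ge.
Qed.

Lemma cesaro_weight_ge i n c a : (2 ^ c <= i < 2 ^ c.+1)%N ->
  (2 ^ a <= n < 2 ^ a.+1)%N -> (c <= a)%N ->
  2 `^ (- (2 + beta)) * 2 `^ (- (c%:R + (a - c)%N%:R * (1 + beta))) <=
  (i%:R / n%:R) `^ beta * n%:R^-1 :> R.
Proof.
move=> /andP[ci ic] /andP[an na] ca; have b1 := beta_gt.
have i0 := block_gt0 ci; have n0 := block_gt0 an.
rewrite cesaro_weightE// natrB//.
have -> : 2 `^ (- (2 + beta)) * 2 `^ (- (c%:R + (a%:R - c%:R) * (1 + beta))) =
   2 `^ (c.+1%:R * - 1) * (2 `^ (c%:R - a.+1%:R)) `^ (1 + beta) :> R.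
  by rewrite -powRrM -!pow2D -!natr1; congr (_ `^ _); ring.
apply: ler_pM; rewrite ?powR_ge0 ?invr_ge0//.
  rewrite powRrM powR_inv1 ?pow2_ge0// lef_pV2 ?posrE ?pow2_gt0 ?ltr0n//.
  exact: block_natr_le.
apply: ge0_ler_powR; rewrite ?nnegrE ?pow2_ge0 ?divr_ge0//; first lra.
rewrite pow2D ler_pM ?pow2_ge0//; first exact: block_natr_ge.
by rewrite powRN lef_pV2 ?posrE ?pow2_gt0 ?ltr0n//; exact: block_natr_le.
Qed.

Lemma cesaro_weight_gt0 i n : (0 < i)%N -> (0 < n)%N ->
  0 < (i%:R / n%:R) `^ beta * n%:R^-1 :> R.
Proof. by move=> i0 n0; rewrite mulr_gt0 ?powR_gt0 ?divr_gt0 ?invr_gt0 ?ltr0n. Qed.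

(** The largest weight of row n is at i = n when beta >= 0 and at i = 1 otherwise. Its polynomial
    decay drives the exponential bound. *)
Lemma cesaro_weight_sup i n : (0 < i <= n)%N ->
  (i%:R / n%:R) `^ beta * n%:R^-1 <= n%:R `^ (- Num.min 1 (1 + beta)) :> R.
Proof.
move=> /andP[i0 iN]; have n0 := leq_trans i0 iN.
have b1 := beta_gt.
have n1 : 1 <= n%:R :> R by rewrite ler1n.
have i1 : 1 <= i%:R :> R by rewrite ler1n.
have n0' : 0 < n%:R :> R by rewrite ltr0n.
have q0 : 0 < i%:R / n%:R :> R by rewrite divr_gt0// ltr0n.
have q1 : i%:R / n%:R <= 1 :> R by rewrite ler_pdivrMr// mul1r ler_nat.
have [b0|b0] := leP 0 beta.
  rewrite (min_idPl _); last by rewrite lerDl.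
  rewrite powR_inv1 ?ler0n// ler_piMl ?invr_ge0//.
  rewrite -[leRHS](powRr0 (i%:R / n%:R)); apply: ger_powR => //.
  by rewrite q0.
rewrite (min_idPr _); last by rewrite gerDl ltW.
have -> : - (1 + beta) = - beta + - 1 by ring.
rewrite [leRHS]powRD; last by rewrite (gt_eqF n0') implybT.
rewrite powR_inv1 ?ler0n// ler_wpM2r ?invr_ge0//.
rewrite -[in leLHS](opprK beta) [leLHS]powRN -[leLHS]mul1r ler_pdivrMr ?powR_gt0//.
rewrite -powRM ?divr_ge0// mulrCA divff ?gt_eqF// mulr1.
apply: (@le_trans _ _ (1 `^ (- beta))); first by rewrite powR1.
by apply: ge0_ler_powR; rewrite ?nnegrE// oppr_ge0 ltW.
Qed.

(** Block c has 2^c indices i, block a has 2^a indices n, and n^(r-2) is of order 2^(a(r-2)). With l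
    = a - c the total exponent k + c + a(r - 1) equals k + c r + l(r - 1), the one of
    [dyadic_upper]. *)
Lemma sum_cesaro_blocks (t : nat -> nat -> nat -> R) (G : nat -> R) (D B : R) N :
  0 <= D -> (forall j, 0 <= G j) ->
  (forall J, \sum_(j < J) dyadic_weight beta r j * G j <= B) ->
  (forall n i k a c, (N <= n)%N -> (i <= n)%N -> (c <= a)%N ->
     (2 ^ a <= n < 2 ^ a.+1)%N -> (2 ^ c <= i < 2 ^ c.+1)%N ->
     t n i k <= D * (2 ^+ k * G (k + (c + level beta (a - c)))%N)) ->
  exists C : R, forall K M,
    \sum_(1 <= n < M | (N <= n)%N) n%:R `^ (r - 2) *
      \sum_(1 <= i < n.+1) \sum_(k < K) t n i k <= C.
Proof.
move=> D0 G0 GB Ht; have [C HC] := dyadic_upper beta_gt r_gt G0 GB.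
exists (2 `^ r * D * C) => K M.
pose g a c := \sum_(k < K) D * (2 ^+ k * G (k + (c + level beta (a - c)))%N).
have g0 a c : 0 <= g a c.
  by apply: sumr_ge0 => k _; rewrite mulr_ge0// mulr_ge0// exprn_ge0.
pose v n := n%:R `^ (r - 2) * \sum_(c < (trunc_log 2 n).+1) 2 ^+ c * g (trunc_log 2 n) c.
have v0 n : 0 <= v n.
  by rewrite mulr_ge0 ?powR_ge0// sumr_ge0// => c _; rewrite mulr_ge0// exprn_ge0.
have uv n : (1 <= n)%N -> (N <= n)%N ->
    n%:R `^ (r - 2) * \sum_(1 <= i < n.+1) \sum_(k < K) t n i k <= v n.
  move=> n1 Nn; rewrite ler_wpM2l ?powR_ge0//.
  set a := trunc_log 2 n.
  have an : (2 ^ a <= n < 2 ^ a.+1)%N by exact: trunc_log_bounds.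
  have blk c i : (2 ^ c <= i < 2 ^ c.+1)%N -> trunc_log 2 i = c.
    by exact: trunc_log_eq.
  apply: (@le_trans _ _ (\sum_(1 <= i < n.+1) g a (trunc_log 2 i))).
    rewrite big_nat [leRHS]big_nat; apply: ler_sum => i /andP[i1 iN].
    apply: ler_sum => k _; apply: Ht => //.
      by apply: leq_trunc_log.
    exact: trunc_log_bounds.
  apply: (@le_trans _ _ (\sum_(1 <= i < 2 ^ a.+1) g a (trunc_log 2 i))).
    case/andP: an => _ an; rewrite [leRHS](@big_cat_nat _ _ _ n.+1)//= lerDl.
    exact: sumr_ge0.
  rewrite sum_blocks; apply: ler_sum => c _.
  rewrite big_nat (eq_bigr (fun=> g a c)) => [|i /blk -> //].
  rewrite -big_nat sumr_const_nat expnS mul2n -addnn addnK.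
  by rewrite -[leLHS]mulr_natl natrX.
apply: (@le_trans _ _ (\sum_(1 <= n < 2 ^ M) v n)).
  rewrite (@big_cat_nat _ _ _ M.+1 1 (2 ^ M))//=; last exact: ltn_expl.
  apply: (@le_trans _ _ (\sum_(1 <= n < M.+1) v n)); last first.
    by rewrite lerDl sumr_ge0.
  case: M => [|M]; first by rewrite !big_geq.
  rewrite [leRHS]big_nat_recr//= -[leLHS]addr0 lerD//.
  rewrite big_nat_cond [leRHS]big_nat_cond [leLHS]big_mkcond [leRHS]big_mkcond.
  apply: ler_sum => n _; case: andP => [[/andP[n1 nM] Nn]|_].
    by rewrite n1 nM/= uv.
  by case: ifP.
rewrite sum_blocks.
have blk a n : (2 ^ a <= n < 2 ^ a.+1)%N -> trunc_log 2 n = a.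
  by exact: trunc_log_eq.
pose h l c := 2 `^ r * D * \sum_(k < K)
  2 `^ (k%:R + c%:R * r + l%:R * (r - 1)) * G (k + (c + level beta l))%N.
have h0 l c : 0 <= h l c.
  rewrite mulr_ge0 ?mulr_ge0 ?pow2_ge0// sumr_ge0// => k _.
  by rewrite mulr_ge0 ?pow2_ge0.
apply: (@le_trans _ _ (\sum_(a < M) \sum_(c < a.+1) h (a - c)%N c)).
  apply: ler_sum => a _; rewrite big_nat.
  apply: (@le_trans _ _ (\sum_(2 ^ a <= n < 2 ^ a.+1)
     2 `^ r * 2 `^ (a%:R * (r - 2)) * \sum_(c < a.+1) 2 ^+ c * g a c)).
    rewrite [leRHS]big_nat; apply: ler_sum => n an; rewrite /v (blk _ _ an).
    rewrite ler_wpM2r ?block_powR_le// sumr_ge0// => c _.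
    by rewrite mulr_ge0// exprn_ge0.
  rewrite sumr_const_nat expnS mul2n -addnn addnK -[leLHS]mulr_natl natr_exp2.
  rewrite mulr_sumr mulr_sumr; apply: ler_sum => c _.
  rewrite /h /g !mulr_sumr; apply: ler_sum => k _.
  have -> : k%:R + c%:R * r + (a - c)%N%:R * (r - 1) =
      a%:R + a%:R * (r - 2) + c%:R + k%:R :> R.
    by rewrite natrB; [ring|rewrite -ltnS].
  by rewrite !pow2D -!pow2n le_eqVlt; apply/orP; left; apply/eqP; ring.
rewrite sum_triangle.
apply: (@le_trans _ _ (\sum_(c < M) \sum_(l < M) h l c)).
  apply: ler_sum => c _; apply: (ler_sum_widen (u := h^~ c)) => //.
  exact: leq_subr.
rewrite exchange_big/=.
apply: le_trans (ler_wpM2l _ (HC K M)); last by rewrite mulr_ge0 ?pow2_ge0.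
rewrite mulr_sumr; apply: ler_sum => l _; rewrite mulr_sumr.
by apply: ler_sum => c _.
Qed.

End blocks.

(** * Exponential moments of clipped variables *)

Section clip.
Context {R : realType}.
Implicit Types (x y u delta eta : R).

(** The inequality exp v - 1 <= v exp v gives exp u <= 1 + u + u(exp u - 1); the last product is
    then bounded separately for each sign of u. *)
Lemma expR_le_quadratic u : expR u <= 1 + u + u ^+ 2 * expR `|u|.
Proof.
have key (v : R) : expR v - 1 <= v * expR v.
  have := expR_ge1Dx (- v); rewrite expRN => h.
  have := ler_wpM2l (ltW (expR_gt0 v)) h; rewrite mulfV ?gt_eqF ?expR_gt0//.
  lra.
have ku := key u; have := expR_ge1Dx u => hu.
have [u0|u0] := leP 0 u.
  rewrite ger0_norm//; have := ler_wpM2l u0 ku; lra.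
have : 1 <= expR `|u| by rewrite -expR0 ler_expR.
have u2 : 0 <= u ^+ 2 by exact: sqr_ge0.
move=> e1; have := ler_wpM2l u2 e1; rewrite mulr1.
have : u * (expR u - 1) <= u * u by rewrite ler_wnM2l ?(ltW u0)//; lra.
rewrite -expr2; lra.
Qed.

Definition clip delta y := Num.max (- delta) (Num.min y delta).

Lemma clip_cases delta y : 0 <= delta ->
  [\/ y < - delta /\ clip delta y = - delta,
      - delta <= y <= delta /\ clip delta y = y |
      delta < y /\ clip delta y = delta].
Proof.
move=> d0; rewrite /clip; have [yd|yd] := leP y delta.
  by have [dy|dy] := leP (- delta) y; [constructor 2|constructor 1].
by constructor 3; split => //; apply/max_idPr; lra.
Qed.

Lemma clip_le delta y : 0 <= delta -> `|clip delta y| <= delta.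
Proof.
move=> d0; rewrite ler_norml.
by case: (clip_cases y d0) => -[h ->]; lra.
Qed.

Lemma clipN delta y : 0 <= delta -> clip delta (- y) = - clip delta y.
Proof.
move=> d0.
by case: (clip_cases y d0) => -[h ->]; case: (clip_cases (- y) d0) => -[h' ->]; lra.
Qed.

Lemma clip_lipschitz delta x y : 0 <= delta ->
  `|clip delta x - clip delta y| <= `|x - y|.
Proof.
move=> d0; have := ler_norm (x - y); have := ler_norm (- (x - y)).
rewrite normrN => h1 h2; rewrite ler_norml.
by case: (clip_cases x d0) => -[hx ->]; case: (clip_cases y d0) => -[hy ->]; lra.
Qed.

Lemma dist_clip_le delta y : 0 <= delta -> `|y - clip delta y| <= excess delta y.
Proof.
move=> d0; rewrite /excess le_max ler_norml.
have := ler_norm y; have := ler_norm (- y); rewrite normrN => h1 h2.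
case: (clip_cases y d0) => -[h ->]; apply/orP; [left|right|left]; try lra.
by rewrite subrr normr0.
Qed.

(** For r < 2 no second moment is available. A second level [eta] splits the square into a first
    moment with a small factor and a tail. *)
Lemma sqr_clip_le delta eta y : 0 <= delta -> 0 <= eta ->
  clip delta y ^+ 2 <= eta * `|y| + delta ^+ 2 * (eta < `|y|)%R%:R.
Proof.
move=> d0 e0; have cd := clip_le y d0; have y0 := normr_ge0 y.
have cy : `|clip delta y| <= `|y|.
  have := clip_lipschitz y 0 d0; rewrite subr0 (_ : clip delta 0 = 0) ?subr0//.
  by case: (clip_cases 0 d0) => -[h ->]; lra.
rewrite -real_normK ?num_real//; have c0 := normr_ge0 (clip delta y).
case: (ltP eta `|y|) => ye /=.
  rewrite mulr1; apply: (@le_trans _ _ (delta ^+ 2)).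
    by rewrite lerXn2r ?nnegrE.
  by rewrite lerDr mulr_ge0.
rewrite mulr0 addr0 expr2; apply: ler_pM => //; exact: le_trans ye.
Qed.

Lemma measurable_clip delta : measurable_fun [set: R] (clip delta).
Proof.
apply: measurable_maxr; first exact: measurable_cst.
by apply: measurable_minr => //; exact: measurable_cst.
Qed.

End clip.

Section exponential_moment.
Context {d : measure_display} {Omega : measurableType d} {R : realType}.
Variables (H : set (Omega -> R)) (E : (Omega -> R) -> \bar R).
Hypothesis rvsH : random_variable_space H.
Hypothesis subE : sublinear_expectation H E.

Lemma rv_clip delta c Y : 0 <= delta -> H Y -> H (fun w => clip delta (c * Y w)).
Proof.
move=> d0 HY; apply: (@rv_lipschitz _ _ _ _ rvsH (clip delta) 1 (fun w => c * Y w)).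
  by move=> x y; rewrite mul1r; exact: clip_lipschitz.
exact: (rvZ rvsH).
Qed.

(** The bare exponential violates the polynomial growth condition of [H]; clipping bounds the
    exponent and makes the composite globally Lipschitz. *)
Lemma rv_exp_clip lam delta c Y : 0 <= lam -> 0 <= delta -> H Y ->
  H (fun w => expR (lam * clip delta (c * Y w))).
Proof.
move=> l0 d0 HY.
apply: (@rv_lipschitz _ _ _ _ rvsH (fun y => expR (lam * clip delta y))
  (expR (lam * delta) * lam) (fun w => c * Y w)); last exact: (rvZ rvsH).
have dl x : lam * clip delta x <= lam * delta.
  by rewrite ler_wpM2l// (le_trans (ler_norm _))// clip_le.
have key x y : expR (lam * clip delta x) - expR (lam * clip delta y) <=
    expR (lam * delta) * lam * `|x - y|.
  apply: (@le_trans _ _ (expR (lam * delta) * `|lam * (clip delta x - clip delta y)|)); last first.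
    rewrite normrM (ger0_norm l0) mulrA ler_wpM2l ?mulr_ge0 ?expR_ge0//.
    exact: clip_lipschitz.
  apply: (@le_trans _ _ (expR (lam * clip delta x) * `|lam * (clip delta x - clip delta y)|)); last first.
    by rewrite ler_wpM2r// ler_expR.
  have := expR_ge1Dx (lam * clip delta y - lam * clip delta x).
  rewrite expRD expRN => h.
  have := ler_wpM2l (expR_ge0 (lam * clip delta x)) h.
  rewrite mulrCA mulfV ?gt_eqF ?expR_gt0// mulr1 => h'.
  have := ler_wpM2l (expR_ge0 (lam * clip delta x))
    (ler_norm (lam * (clip delta x - clip delta y))).
  lra.
move=> x y; rewrite ler_norml key andbT lerNl opprB.
by have := key y x; rewrite (distrC y).
Qed.

(** Clipping destroys the zero mean, so the linear term is returned to c Y at the price of the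
    excess, and the quadratic term is split by [sqr_clip_le]. The expectation of lam c Y is 0, hence
    finite, and subadditivity removes it. *)
Lemma E_exp_clip_le lam delta eta c Y (z e : R) : H Y -> c != 0 ->
  0 <= lam -> 0 < delta -> 0 < eta ->
  E (fun w => c * Y w) = 0%E ->
  (E (fun w => excess delta (c * Y w)) <= z%:E)%E ->
  (E (fun w => `|Y w|%R) <= e%:E)%E ->
  (E (fun w => expR (lam * clip delta (c * Y w))) <=
   (1 + (lam * z + lam ^+ 2 * expR (lam * delta) *
      (eta * `|c| * e + delta ^+ 2 * tail E Y (eta / `|c|))))%:E)%E.
Proof.
move=> HY c0 l0 d0 e0 EcY Ez Ee.
pose L := lam ^+ 2 * expR (lam * delta).
have L0 : 0 <= L by rewrite mulr_ge0 ?expR_ge0// sqr_ge0.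
pose A := [set w | eta < `|c * Y w|].
have HcY : H (fun w => c * Y w) by exact: (rvZ rvsH).
have mA : measurable A by apply: (rv_measurable_gt rvsH); exact: (rv_norm rvsH).
have HA : H \1_A by exact: (rvs_indic rvsH).
have He := rv_excess rvsH delta c HY.
pose V2 w := L * (eta * `|c|) * `|Y w| + L * delta ^+ 2 * \1_A w.
pose V w := lam * excess delta (c * Y w) + V2 w.
have HV2 : H V2.
  by apply: (rvD rvsH); apply: (rvZ rvsH) => //; exact: (rv_norm rvsH).
have HV : H V by apply: (rvD rvsH) => //; exact: (rvZ rvsH).
have i01 w : 0 <= \1_A w :> R by rewrite indicE; case: (_ \in _).
have V20 w : 0 <= V2 w.
  rewrite addr_ge0// mulr_ge0 ?mulr_ge0 ?sqr_ge0//; exact: ltW.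
have EV2 : (E V2 <= (L * (eta * `|c| * e + delta ^+ 2 * tail E Y (eta / `|c|)))%:E)%E.
  have k1 : 0 <= L * (eta * `|c|) by rewrite mulr_ge0// mulr_ge0// ltW.
  have k2 : 0 <= L * delta ^+ 2 by rewrite mulr_ge0// sqr_ge0.
  apply: (le_trans (E_subadd_ge0 subE _ _ _ _)).
  - by apply: (rvZ rvsH); exact: (rv_norm rvsH).
  - exact: (rvZ rvsH).
  - apply: (E_ge rvsH subE) => [|w]; last by rewrite mulr_ge0.
    by apply: (rvZ rvsH); exact: (rv_norm rvsH).
  - by apply: (E_ge rvsH subE) => [|w]; [exact: (rvZ rvsH)|rewrite mulr_ge0].
  rewrite mulrDr EFinD; apply: leeD.
    rewrite (subexp_scale subE)//; last exact: (rv_norm rvsH).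
    by rewrite [in leRHS]mulrA [in leRHS]EFinM; apply: lee_wpmul2l.
  rewrite (subexp_scale subE)// [in leRHS]mulrA [in leRHS]EFinM; apply: lee_wpmul2l => //.
  by rewrite -(tailE rvsH subE)// -tail_scaled.
have EV : (E V <= (lam * z + L * (eta * `|c| * e + delta ^+ 2 * tail E Y (eta / `|c|)))%:E)%E.
  apply: (le_trans (E_subadd_ge0 subE _ _ _ _)) => //.
  - exact: (rvZ rvsH).
  - apply: (E_ge rvsH subE) => [|w]; first exact: (rvZ rvsH).
    by rewrite mulr_ge0// excess_ge0.
  - exact: (E_ge rvsH subE).
  rewrite EFinD; apply: leeD => //.
  by rewrite (subexp_scale subE)// EFinM; apply: lee_wpmul2l.
have ElcY : E (fun w => lam * (c * Y w)) = 0%E.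
  by rewrite (subexp_scale subE)// EcY mule0.
apply: (@le_trans _ _ (E (fun w => lam * (c * Y w) + V w + 1))).
  apply: (subexp_mono subE).
  - apply: (rvD rvsH); last exact: (rv_cst rvsH).
    by apply: (rvD rvsH) => //; exact: (rvZ rvsH).
  - by apply: rv_exp_clip => //; exact: ltW.
  move=> w; set y := c * Y w; set u := lam * clip delta y.
  apply: le_trans (expR_le_quadratic u) _.
  have d0' := ltW d0; have e0' := ltW e0.
  have h1 : u <= lam * y + lam * excess delta y.
    rewrite -mulrDr ler_wpM2l//.
    have := dist_clip_le y d0'; have := ler_norm (- (y - clip delta y)).
    by rewrite normrN; lra.
  have h2 : u ^+ 2 * expR `|u| <= L * (eta * `|y| + delta ^+ 2 * (eta < `|y|)%R%:R).
    apply: (@le_trans _ _ (L * clip delta y ^+ 2)).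
      rewrite /u /L exprMn mulrAC ler_wpM2r ?sqr_ge0// ler_wpM2l ?sqr_ge0//.
      by rewrite ler_expR normrM (ger0_norm l0) ler_wpM2l// clip_le.
    by rewrite ler_wpM2l// sqr_clip_le.
  have h3 : L * (eta * `|y| + delta ^+ 2 * (eta < `|y|)%R%:R) = V2 w.
    have -> : (eta < `|y|)%R%:R = \1_A w :> R.
      rewrite indicE; case: ltP => h; first by rewrite mem_set.
      by rewrite memNset// /A/= ltNge h.
    rewrite /V2 /y normrM; ring.
  rewrite /V -/y; move: h2; rewrite h3; lra.
rewrite (E_addcst rvsH subE); last first.
  by apply: (rvD rvsH) => //; exact: (rvZ rvsH).
rewrite addeC EFinD leeD2l//; apply: le_trans EV.
apply: le_trans (E_subadd_fin subE _ HV _) _.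
- exact: (rvZ rvsH).
- by rewrite ElcY.
by rewrite ElcY add0e.
Qed.

Variable X : nat -> Omega -> R.
Hypothesis HX : forall n, (1 <= n)%N -> H (X n).
Hypothesis indepX : independent_seq H E X.

(** The exponentials divided by 1 + m_i have expectation at most 1, so [capacity_max_product]
    applies to their products; 1 + m_i <= exp(m_i) then turns the product into the exponential of
    the sum. *)
Lemma capacity_max_clip_le n (c m : nat -> R) lam delta eps (A : set Omega) :
  0 <= lam -> 0 <= delta ->
  (forall i, (1 <= i <= n)%N -> 0 <= m i /\
    (E (fun w => expR (lam * clip delta (c i * X i w))) <= (1 + m i)%:E)%E) ->
  measurable A ->
  (forall w, A w -> exists2 j, (j <= n)%N &
     eps <= \sum_(1 <= i < j.+1) clip delta (c i * X i w)) ->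
  (capacity E A <= (expR (\sum_(1 <= i < n.+1) m i - lam * eps))%:E)%E.
Proof.
move=> l0 d0 Hm mA hA.
(* Outside 1..n the factor is set to 1, because [capacity_max_product] constrains all indices. *)
pose g i y := if (1 <= i <= n)%N then
  (1 + m i)^-1 * expR (lam * clip delta (c i * y)) else 1.
pose M i := if (1 <= i <= n)%N then (1 + m i)^-1 * expR (lam * delta) else 1.
have m1 i : (1 <= i <= n)%N -> 0 < 1 + m i.
  by move=> /Hm[m0 _]; rewrite ltr_pwDl.
have m1' i : (1 <= i <= n)%N -> 0 <= (1 + m i)^-1.
  by move=> h; rewrite invr_ge0 ltW// m1.
pose P := \prod_(1 <= i < n.+1) (1 + m i).
have P0 : 0 < P by rewrite /P big_nat; apply: prodr_gt0.
(* One threshold serves every j: as m_i >= 0, each partial product of the 1 + m_i is at most the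
   full product [P]. *)
pose a := expR (lam * eps) / P.
have a0 : 0 < a by rewrite divr_gt0// expR_gt0.
apply: (@le_trans _ _ (a^-1)%:E).
  apply: (@capacity_max_product _ _ _ _ _ rvsH subE X indepX g M a _ _ _ _ n) => //.
  - move=> i; rewrite /g; case: (1 <= i <= n)%N; last exact: measurable_cst.
    apply: measurable_funM; first exact: measurable_cst.
    apply: measurableT_comp; first exact: measurable_expR.
    apply: measurable_funM; first exact: measurable_cst.
    apply: measurableT_comp; first exact: measurable_clip.
    by apply: measurable_funM => //; exact: measurable_cst.
  - move=> i y; rewrite /g /M; case: ifP => h; last by rewrite ler01 lexx.
    rewrite mulr_ge0 ?m1' ?expR_ge0//= ler_wpM2l ?m1'// ler_expR ler_wpM2l//.
    by rewrite (le_trans (ler_norm _))// clip_le.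
  - move=> i i1; rewrite /g; case: (1 <= i <= n)%N; last exact: (rv_cst rvsH).
    by apply: (rvZ rvsH); apply: rv_exp_clip => //; exact: HX.
  - move=> i i1; rewrite /g; case h: (1 <= i <= n)%N; last by rewrite (subexp_cst subE 1).
    rewrite (subexp_scale subE) ?m1'//; last by apply: rv_exp_clip => //; exact: HX.
    have [_ /(lee_wpmul2l (m1' i h : 0 <= _%:E)%E)] := Hm i h.
    by move=> /le_trans; apply; rewrite -EFinM mulVf ?gt_eqF ?m1.
  move=> w /hA[j jn epsj]; exists j => //.
  have -> : \prod_(1 <= i < j.+1) g i (X i w) =
     expR (lam * \sum_(1 <= i < j.+1) clip delta (c i * X i w)) /
     \prod_(1 <= i < j.+1) (1 + m i).
    rewrite mulr_sumr expR_sum -prodfV -big_split/=.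
    rewrite big_nat [RHS]big_nat; apply: eq_bigr => i /andP[i1 ij].
    by rewrite /g i1 (leq_trans _ jn)//= mulrC.
  have Pj0 : 0 < \prod_(1 <= i < j.+1) (1 + m i).
    by rewrite big_nat; apply: prodr_gt0 => i /andP[i1 ij]; rewrite m1// i1 (leq_trans _ jn).
  apply: ler_pM; rewrite ?expR_ge0 ?invr_ge0 ?(ltW P0)//.
    by rewrite ler_expR ler_wpM2l.
  rewrite lef_pV2 ?posrE// /P [leRHS](@big_cat_nat _ _ _ j.+1)//=.
  rewrite ler_peMr ?(ltW Pj0)//.
  rewrite big_nat; apply: (big_ind (fun x => 1 <= x)) => //.
    by move=> x y x1 y1; rewrite -[1]mul1r ler_pM.
  move=> i /andP[i1 ij]; rewrite lerDl.
  have hi : (1 <= i <= n)%N by rewrite (leq_trans _ i1).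
  by case: (Hm i hi).
rewrite lee_fin /a invf_div expRB ler_wpM2r ?invr_ge0 ?expR_ge0//.
rewrite expR_sum /P big_nat [leRHS]big_nat; apply: ler_prod => i h.
by rewrite ltW ?m1//= expR_ge1Dx.
Qed.

End exponential_moment.

(** * The direct part *)

Section max_partial_sum.
Context {R : realType}.

Lemma bigmax_nat_le (F : nat -> R) n (M : R) : 0 <= M ->
  (forall j, (1 <= j <= n)%N -> F j <= M) ->
  \big[Num.max/0]_(1 <= j < n.+1) F j <= M.
Proof. by move=> M0 FM; rewrite big_nat; apply: bigmax_le. Qed.

Lemma le_bigmax_nat_term (F : nat -> R) n j : (1 <= j <= n)%N ->
  F j <= \big[Num.max/0]_(1 <= i < n.+1) F i.
Proof. by move=> jn; apply: le_bigmax_seq => //; rewrite mem_index_iota. Qed.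

(** [A1] and [A2] stand for large upper and lower deviations of the clipped sums; since clipping is
    odd, the lower ones are upper ones for [- b]. On either event the trivial bound n delta is used,
    outside both the clipped sums stay within eps. *)
Lemma max_partial_sum_excess_le (d : measure_display) (Omega : measurableType d)
    (b : nat -> nat -> R)
    (X : nat -> Omega -> R) n w (delta eps : R) (A1 A2 : Prop) :
  0 <= delta -> 0 <= eps ->
  (~ A1 -> forall j, (1 <= j <= n)%N ->
     \sum_(1 <= i < j.+1) clip delta (b n i * X i w) <= eps) ->
  (~ A2 -> forall j, (1 <= j <= n)%N ->
     \sum_(1 <= i < j.+1) clip delta (- b n i * X i w) <= eps) ->
  Num.max (max_partial_sum b X n w - eps) 0 <=
  n%:R * delta * (`[< A1 >]%:R + `[< A2 >]%:R) +
  \sum_(1 <= i < n.+1) excess delta (b n i * X i w).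
Proof.
move=> d0 e0 hA1 hA2; set Z := \sum_(_ <= _ < _) _.
pose T j := \sum_(1 <= i < j.+1) clip delta (b n i * X i w).
have Z0 : 0 <= Z by apply: sumr_ge0 => i _; exact: excess_ge0.
have nd0 : 0 <= n%:R * delta by rewrite mulr_ge0.
have ST j : (1 <= j <= n)%N ->
    `|\sum_(1 <= i < j.+1) b n i * X i w| <= `|T j| + Z.
  move=> /andP[j1 jn].
  have -> : \sum_(1 <= i < j.+1) b n i * X i w =
      T j + \sum_(1 <= i < j.+1) (b n i * X i w - clip delta (b n i * X i w)).
    by rewrite /T -big_split/=; apply: eq_bigr => i _; ring.
  apply: le_trans (ler_normD _ _) _; rewrite lerD2l.
  apply: le_trans (ler_norm_sum _ _ _) _.
  apply: (@le_trans _ _ (\sum_(1 <= i < j.+1) excess delta (b n i * X i w))).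
    by apply: ler_sum => i _; exact: dist_clip_le.
  rewrite /Z [leRHS](@big_cat_nat _ _ _ j.+1)//= lerDl.
  by apply: sumr_ge0 => i _; exact: excess_ge0.
have TN j : \sum_(1 <= i < j.+1) clip delta (- b n i * X i w) = - T j.
  by rewrite /T -sumrN; apply: eq_bigr => i _; rewrite mulNr clipN.
have Td j : (1 <= j <= n)%N -> `|T j| <= n%:R * delta.
  move=> /andP[j1 jn]; apply: le_trans (ler_norm_sum _ _ _) _.
  apply: (@le_trans _ _ (\sum_(1 <= i < j.+1) delta)).
    by apply: ler_sum => i _; exact: clip_le.
  rewrite sumr_const_nat subn1 -[leLHS]mulr_natl ler_wpM2r// ler_nat.
  exact: jn.
rewrite ge_max; apply/andP; split; last first.
  by rewrite addr_ge0// mulr_ge0// addr_ge0.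
rewrite lerBlDr /max_partial_sum.
apply: bigmax_nat_le => [|j jn].
  by rewrite addr_ge0// addr_ge0// mulr_ge0// addr_ge0.
apply: le_trans (ST j jn) _; rewrite addrAC lerD2r.
have [/asboolP a1|/asboolP a1] := boolP `[< A1 >]; last first.
  have [/asboolP a2|/asboolP a2] := boolP `[< A2 >]; last first.
    rewrite addr0 mulr0 add0r ler_norml (hA1 a1)//.
    by have := hA2 a2 j jn; rewrite TN; lra.
  by rewrite add0r mulr1 (le_trans (Td j jn))// lerDl.
apply: le_trans (Td j jn) _; rewrite mulrDr mulr1 -addrA lerDl.
by rewrite addr_ge0// mulr_ge0.
Qed.

End max_partial_sum.

Section series.
Context {R : realType}.

Lemma sum_le_nneseries (s : seq nat) (P : pred nat) (w z : nat -> R)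
    (t : nat -> nat -> R) (C : R) :
  (forall n, 0 <= w n) -> (forall n k, 0 <= t n k) ->
  (forall n, P n -> n \in s -> ((z n)%:E <= \sum_(k <oo) (t n k)%:E)%E) ->
  (forall K, \sum_(n <- s | P n) w n * \sum_(k < K) t n k <= C) ->
  \sum_(n <- s | P n) w n * z n <= C.
Proof.
move=> w0 t0 zt tC; rewrite -lee_fin -sumEFin.
apply: (@le_trans _ _ (\sum_(n <- s | P n) \sum_(k <oo) (w n * t n k)%:E)%E).
  rewrite big_seq_cond [leRHS]big_seq_cond; apply: lee_sum => n /andP[ns Pn].
  under eq_eseriesr do rewrite EFinM.
  rewrite nneseriesZl; last by move=> k _; rewrite lee_fin.
  by rewrite EFinM; apply: lee_wpmul2l; [rewrite lee_fin|exact: zt].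
rewrite -nneseries_sum; last by move=> n k _; rewrite lee_fin mulr_ge0 ?w0 ?t0.
apply: lime_le.
  apply: is_cvg_nneseries => k _ _; apply: sume_ge0 => n _.
  by rewrite lee_fin mulr_ge0.
apply: nearW => K; under eq_bigr do rewrite sumEFin.
rewrite sumEFin lee_fin big_mkord exchange_big/=; apply: le_trans (tC K).
by apply: ler_sum => n _; rewrite mulr_sumr.
Qed.

Lemma sum_inv_sqr_le n : \sum_(1 <= i < n.+1) i%:R `^ (- 2) <= 2 :> R.
Proof.
case: n => [|n]; first by rewrite big_geq.
(* The sharper bound 2 - 1/n is inductive, since 1/n - 1/(n + 1) = 1/(n(n + 1)) dominates 1/(n +
   1)^2. *)
suff : \sum_(1 <= i < n.+2) i%:R `^ (- 2) <= 2 - n.+1%:R^-1 :> R.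
  by move=> /le_trans; apply; rewrite gerBl invr_ge0.
elim: n => [|n ih]; first by rewrite big_nat1 powR1 invr1; lra.
rewrite big_nat_recr//= (le_trans (lerD ih (lexx _)))//.
rewrite powRN (powR_mulrn 2)//.
have n0 : 0 < n.+1%:R :> R by rewrite ltr0n.
have n1 : n.+2%:R = n.+1%:R + 1 :> R by rewrite natr1.
rewrite n1; move: (n.+1%:R : R) n0 {ih n1} => x x0.
rewrite -lerBrDl (_ : _ - _ = (x * (x + 1))^-1); last by field; lra.
by rewrite lef_pV2 ?posrE ?exprn_gt0 ?mulr_gt0//; nra.
Qed.

End series.

Lemma rv_max_partial_sum (d : measure_display) (Omega : measurableType d)
    (R : realType) (H : set (Omega -> R)) (b : nat -> nat -> R)
    (X : nat -> Omega -> R) n :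
  random_variable_space H -> (forall n, (1 <= n)%N -> H (X n)) ->
  H (max_partial_sum b X n).
Proof.
move=> rvsH HX; apply: (rv_bigmax rvsH) => j _; apply: (rv_norm rvsH).
apply: (rv_sum rvsH) => i; rewrite mem_index_iota => /andP[i1 _].
by apply: (rvZ rvsH); exact: HX.
Qed.

Section forward.
Context {d : measure_display} {Omega : measurableType d} {R : realType}.
Variables (H : set (Omega -> R)) (E : (Omega -> R) -> \bar R).
Variables (X : Omega -> R) (Xn : nat -> Omega -> R) (beta r : R).
Variable b : nat -> nat -> R.
Hypothesis rvsH : random_variable_space H.
Hypothesis subE : sublinear_expectation H E.
Hypothesis csubE : countably_subadditive H E.
Hypothesis HX : H X.
Hypothesis HXn : forall n, (1 <= n)%N -> H (Xn n).
Hypothesis indepXn : independent_seq H E Xn.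
Hypothesis idXn : forall n, (1 <= n)%N -> identically_distributed H E (Xn n) X.
Hypothesis EXn : forall n, (1 <= n)%N ->
  E (Xn n) = 0%E /\ (- E (fun w => (- Xn n w)%R))%E = 0%E.
Hypothesis beta_gt : -1 < beta.
Hypothesis r_gt : 1 < r.
Hypothesis b_sum : forall n, (1 <= n)%N -> \sum_(1 <= i < n.+1) b n i = 1.

(** Homogeneity covers only nonnegative factors; a negative [c] is moved onto - X_n, whose
    expectation also vanishes. *)
Lemma E_scaled_eq0 n (c : R) : (1 <= n)%N -> E (fun w => c * Xn n w) = 0%E.
Proof.
move=> n1; have [E0 EN0] := EXn n1; have Hn := HXn n1.
have [c0|c0] := leP 0 c; first by rewrite (subexp_scale subE)// E0 mule0.
have -> : (fun w => c * Xn n w) = (fun w => - c * - Xn n w).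
  by apply/funext => w; ring.
rewrite (subexp_scale subE) ?oppr_ge0 ?(ltW c0)//; last exact: (rvN rvsH).
by move: EN0 => /eqP; rewrite oppe_eq0 => /eqP ->; rewrite mule0.
Qed.

Lemma tail_Xn n t : (1 <= n)%N -> tail E (Xn n) t = tail E X t.
Proof.
move=> n1.
exact: (tail_identically_distributed rvsH subE t (HXn n1) HX (idXn n1)).
Qed.

(** * The exponential bound for large n *)

Section large_n.
Variables (K C0 : R) (N0 : nat) (eps : R).
Hypothesis K_gt0 : 0 < K.
Hypothesis tailK : forall t, 0 < t -> tail E X t <= K * t `^ (- r).
Hypothesis C0_gt0 : 0 < C0.
Hypothesis b_pos : forall n i, (N0 <= n)%N -> (1 <= i <= n)%N -> 0 < b n i.
Hypothesis b_le : forall n i, (N0 <= n)%N -> (1 <= i <= n)%N ->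
  b n i <= C0 * ((i%:R / n%:R) `^ beta * n%:R^-1).
Hypothesis eps_gt0 : 0 < eps.

(** [k0] is the decay exponent of the largest coefficient, and [kap] is normalised so that the sum
    of the b_ni^r is of order n^(-2 r kap). With lam = (kap / (4 delta)) ln n, the choice of
    [truncation] gives exp(lam delta) = n^(kap/4) and exp(-lam eps) = n^(-(r+1)). *)
Let k0 : R := Num.min 1 (1 + beta).
Let kap : R := k0 * (r - 1) / (2 * r).
Definition truncation : R := kap * eps / (4 * (r + 1)).
Let delta := truncation.

Let k0_gt0 : 0 < k0.
Proof. by have b1 := beta_gt; rewrite lt_min ltr01/=; lra. Qed.

Let kap_gt0 : 0 < kap.
Proof.
have r1 := r_gt.
by rewrite /kap divr_gt0// mulr_gt0 ?k0_gt0 ?subr_gt0//; exact: lt_trans r1.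
Qed.

Lemma truncation_gt0 : 0 < truncation.
Proof.
have r1 := r_gt; have r10 : 0 < r + 1 by lra.
by rewrite /truncation divr_gt0// mulr_gt0// kap_gt0.
Qed.

(** One factor b_ni is kept for the row sum, which is 1; the remaining power r - 1 is bounded by its
    supremum. *)
Lemma sum_b_powR_le n : (1 <= n)%N -> (N0 <= n)%N ->
  \sum_(1 <= i < n.+1) b n i `^ r <= C0 `^ (r - 1) * n%:R `^ (- (2 * r * kap)).
Proof.
move=> n1 Nn; have r1 := r_gt; have n0 : 0 < n%:R :> R by rewrite ltr0n.
have -> : - (2 * r * kap) = - k0 * (r - 1) by rewrite /kap; field; lra.
rewrite powRrM -powRM ?powR_ge0//; last exact: ltW.
set M' := _ * _; set M := M' `^ _; rewrite -[leRHS]mulr1 -(b_sum n1) mulr_sumr.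
rewrite big_nat [leRHS]big_nat; apply: ler_sum => i iN.
have bp := b_pos Nn iN.
have bM : b n i <= M'.
  apply: le_trans (b_le Nn iN) _; rewrite ler_pM2l//.
  exact: cesaro_weight_sup.
rewrite -[leLHS](mulr_powRB1 (ltW bp)); last lra.
rewrite mulrC ler_wpM2r ?(ltW bp)// /M; apply: ge0_ler_powR => //.
- by rewrite subr_ge0 ltW.
- by rewrite nnegrE ltW.
- by rewrite nnegrE mulr_ge0 ?powR_ge0// ltW.
Qed.

(** With q = n^(kap/4), the three contributions to the sum of the m_i are, up to constants, at most
    q n^(-2 r kap), q^3 n^(-kap) and q^3 n^(-r kap), all bounded. Only exp(-lam eps) then remains.
    The coefficients [c] have prescribed modulus so that both signs of b_ni are covered. *)
Lemma exponential_bound : exists2 K0 : R, 0 <= K0 &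
  forall n (c : nat -> R) (A : set Omega), (1 <= n)%N -> (N0 <= n)%N ->
  (forall i, (1 <= i <= n)%N -> `|c i| = b n i) ->
  measurable A ->
  (forall w, A w -> exists2 j, (j <= n)%N &
     eps <= \sum_(1 <= i < j.+1) clip delta (c i * Xn i w)) ->
  (capacity E A <= (K0 * n%:R `^ (- (r + 1)))%:E)%E.
Proof.
have r1 := r_gt; have d0 := truncation_gt0.
pose G := (1 - 2 `^ (1 - r))^-1 : R.
pose zc := K * delta `^ (1 - r) * G.
pose e1 := 1 + K * G.
have G0 : 0 <= G by rewrite invr_ge0 subr_ge0 ltW// pow2_lt1//; lra.
have zc0 : 0 <= zc by rewrite !mulr_ge0 ?powR_ge0// ltW.
have e10 : 0 <= e1 by rewrite addr_ge0// mulr_ge0// ltW.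
pose C1 := C0 `^ (r - 1).
have C10 : 0 <= C1 by exact: powR_ge0.
pose B0 := zc * C1 / delta + (e1 + delta ^+ 2 * K * C1) / delta ^+ 2.
exists (expR B0) => [|n c A n1 Nn cb mA hA]; first exact: expR_ge0.
have n0 : 0 < n%:R :> R by rewrite ltr0n.
have nge1 : 1 <= n%:R :> R by rewrite ler1n.
pose P x := n%:R `^ x : R.
have P0 x : 0 < P x by exact: powR_gt0.
have PD x y : P (x + y) = P x * P y by rewrite /P powRD// (gt_eqF n0) implybT.
have P1 x : x <= 0 -> P x <= 1.
  by move=> x0; rewrite -[leRHS](powRr0 n%:R); exact: ler_powR.
have Ple x y : x <= y -> P x <= P y by move=> xy; exact: ler_powR.
pose lam := kap / (4 * delta) * ln n%:R.
have lnn0 : 0 <= ln n%:R :> R by exact: ln_ge0.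
have lam0 : 0 <= lam by rewrite mulr_ge0// divr_ge0 ?(ltW kap_gt0)// mulr_ge0// ltW.
pose q := P (kap / 4).
have lamd : expR (lam * delta) = q.
  rewrite /q /P /powR (gt_eqF n0); congr expR; rewrite /lam; field.
  by rewrite gt_eqF.
(* The logarithm in [lam] is given away as a factor q, which leaves only powers of n to compare. *)
have lamq : lam <= q / delta.
  rewrite ler_pdivlMr// -lamd; have := expR_ge1Dx (lam * delta); lra.
(* With this level the tail term carries eta^(-r) = n^(r kap), half of the decay 2 r kap available
   from the sum of the b_ni^r. *)
pose eta := P (- kap).
have eta0 : 0 < eta by exact: P0.
pose S := \sum_(1 <= i < n.+1) b n i `^ r.
have SC : S <= C1 * P (- (2 * r * kap)) by exact: sum_b_powR_le.
have S0 : 0 <= S by apply: sumr_ge0 => i _; exact: powR_ge0.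
pose L := lam ^+ 2 * q.
have L0 : 0 <= L by rewrite mulr_ge0 ?sqr_ge0// ltW// P0.
pose m i := lam * (zc * b n i `^ r) +
  L * (eta * b n i * e1 + delta ^+ 2 * (K * eta `^ (- r) * b n i `^ r)).
have summ : \sum_(1 <= i < n.+1) m i =
    lam * (zc * S) + L * (eta * e1 + delta ^+ 2 * (K * eta `^ (- r) * S)).
  rewrite /m big_split/= -!mulr_sumr big_split/= -!mulr_sumr.
  by rewrite -mulr_suml -mulr_sumr b_sum// mulr1.
have etar : eta `^ (- r) = P (kap * r).
  by rewrite /eta /P -powRrM; congr (_ `^ _); ring.
have mB : \sum_(1 <= i < n.+1) m i <= B0.
  rewrite summ /B0; apply: lerD.
    rewrite (_ : zc * C1 / delta = delta^-1 * (zc * C1)); last by ring.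
    apply: (@le_trans _ _ ((q / delta) * (zc * (C1 * P (- (2 * r * kap)))))).
      by apply: ler_pM => //; [rewrite mulr_ge0|rewrite ler_wpM2l].
    rewrite [leLHS](_ : _ = delta^-1 * (zc * C1) * (q * P (- (2 * r * kap)))); last by ring.
    have zcd : 0 <= delta^-1 * (zc * C1).
      by apply: mulr_ge0; [rewrite invr_ge0 ltW|exact: mulr_ge0].
    rewrite ler_piMr// /q -PD P1//.
    by have kg := kap_gt0; nra.
  rewrite [leRHS]mulrC; apply: (@le_trans _ _ ((q / delta) ^+ 2 * q *
    (P (- kap) * (e1 + delta ^+ 2 * K * C1)))).
    apply: ler_pM => //.
    - apply: addr_ge0; first by rewrite mulr_ge0// ltW.
      rewrite mulr_ge0 ?sqr_ge0// mulr_ge0// mulr_ge0 ?powR_ge0//.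
      exact: ltW.
    - rewrite ler_wpM2r ?(ltW (P0 _))//.
      by rewrite lerXn2r ?nnegrE// divr_ge0 ?(ltW d0)// ltW// P0.
    rewrite [leRHS]mulrDr lerD//.
    rewrite (_ : P _ * _ = delta ^+ 2 * (K * (C1 * P (- kap)))); last by ring.
    rewrite ler_wpM2l ?sqr_ge0// -mulrA ler_wpM2l ?(ltW K_gt0)// etar.
    apply: (@le_trans _ _ (P (kap * r) * (C1 * P (- (2 * r * kap))))).
      by rewrite ler_wpM2l ?(ltW (P0 _)).
    rewrite mulrCA ler_wpM2l// -PD Ple//.
    by have kg := kap_gt0; nra.
  rewrite [leLHS](_ : _ = (delta ^+ 2)^-1 * (e1 + delta ^+ 2 * K * C1) *
    (q * q * q * P (- kap))); last first.
    by field; rewrite gt_eqF.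
  rewrite ler_piMr//.
    rewrite mulr_ge0 ?invr_ge0 ?sqr_ge0// addr_ge0// mulr_ge0//.
    by rewrite mulr_ge0 ?sqr_ge0// ltW.
  by rewrite /q -!PD P1//; have kg := kap_gt0; lra.
have cap := @capacity_max_clip_le _ _ _ _ _ rvsH subE Xn HXn indepXn n c m lam delta eps A
  lam0 (ltW d0) _ mA hA.
apply: le_trans (cap _) _.
  move=> i iN; have i1 : (1 <= i)%N by case/andP: iN.
  have bp := b_pos Nn iN; have cE := cb i iN.
  have c0 : c i != 0 by rewrite -normr_gt0 cE.
  have tK t : 0 < t -> tail E (Xn i) t <= K * t `^ (- r).
    by move=> t0; rewrite tail_Xn// tailK.
  have bp' := ltW bp.
  split.
    apply: addr_ge0; first by rewrite mulr_ge0// mulr_ge0// powR_ge0.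
    rewrite mulr_ge0// addr_ge0//.
      by rewrite mulr_ge0// mulr_ge0// ltW.
    by rewrite mulr_ge0 ?sqr_ge0// mulr_ge0 ?powR_ge0// mulr_ge0 ?powR_ge0// ltW.
  have := E_exp_clip_le rvsH subE (HXn i1) c0 lam0 d0 eta0 (E_scaled_eq0 _ i1)
    (E_excess_powR rvsH subE csubE (HXn i1) c0 d0 r1 tK)
    (E_norm_le rvsH subE csubE (HXn i1) r1 tK).
  move=> /le_trans; apply; rewrite lee_fin lerD2l /m lamd cE lerD2l.
  rewrite -/L ler_wpM2l// lerD2l ler_wpM2l ?sqr_ge0//.
  apply: le_trans (tK _ _) _; first by rewrite divr_gt0.
  rewrite powRM ?invr_ge0// ?(ltW eta0)// -(powR_inv1 bp') -powRrM mulN1r opprK.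
  by rewrite mulrA.
rewrite lee_fin; apply: (@le_trans _ _ (expR (B0 - lam * eps))).
  by rewrite ler_expR lerD2r.
rewrite expRD ler_wpM2l ?expR_ge0// /powR (gt_eqF n0) ler_expR.
rewrite /lam /delta /truncation le_eqVlt; apply/orP; left; apply/eqP; field.
have kg := kap_gt0; have e0 := eps_gt0.
rewrite !gt_eqF//; lra.
Qed.

End large_n.

(** Positivity of b_ni is known only for large n, so a zero coefficient, excluded from
    [E_excess_powR], is treated apart. *)
Lemma excess_fin n i (delta : R) : (1 <= i)%N -> 0 < delta ->
  moment_condition E X beta r ->
  E (fun w => excess delta (b n i * Xn i w)) \is a fin_num.
Proof.
move=> i1 d0 M; have Hi := HXn i1.
have He := rv_excess rvsH delta (b n i) Hi.
have E0 : (0 <= E (fun w => excess delta (b n i * Xn i w))%R)%E.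
  by apply: (E_ge rvsH subE) => // w; exact: excess_ge0.
have [b0|b0] := eqVneq (b n i) 0.
  apply: (E_fin rvsH subE (a := 0) (b := 0) He) => w.
  by rewrite b0 mul0r /excess normr0 sub0r (max_idPr _) ?lexx// oppr_le0 ltW.
have [K _ tailK] := tail_le_powR rvsH subE HX beta_gt r_gt M.
rewrite ge0_fin_numE//; apply: le_lt_trans
  (E_excess_powR (K := K) rvsH subE csubE Hi b0 d0 r_gt _) (ltry _).
by move=> t t0; rewrite tail_Xn// tailK.
Qed.

Lemma forward_series (eps : R) : 0 < eps ->
  array_approx b (fun n i => (i%:R / n%:R) `^ beta * n%:R^-1) ->
  moment_condition E X beta r ->
  (\sum_(1 <= n <oo) ((n%:R `^ (r - 2))%R%:E *
     E (fun w => Num.max (max_partial_sum b Xn n w - eps)%R 0%R)) < +oo)%E.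
Proof.
move=> eps0 [C0 C00 [N0 _ HN0]] M.
have [K K0 tailK] := tail_le_powR rvsH subE HX beta_gt r_gt M.
have b_pos n i : (N0 <= n)%N -> (1 <= i <= n)%N -> 0 < b n i.
  move=> Nn iN; have [_ +] := HN0 n Nn i iN.
  case/andP: iN => i1 iN; have w0 := cesaro_weight_gt0 beta i1 (leq_trans i1 iN).
  by move=> /(lt_le_trans w0); rewrite pmulr_rgt0.
have b_le n i : (N0 <= n)%N -> (1 <= i <= n)%N ->
    b n i <= C0 * ((i%:R / n%:R) `^ beta * n%:R^-1).
  by move=> Nn iN; have [] := HN0 n Nn i iN.
have [K1 K10 expb] := exponential_bound K0 tailK C00 b_pos b_le eps0.
set delta := truncation eps in expb.
have d0 : 0 < delta by exact: truncation_gt0.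
have d0' := ltW d0; have r1 := r_gt.
pose Z n w := Num.max (max_partial_sum b Xn n w - eps) 0.
pose T (c : nat -> R) j w := \sum_(1 <= i < j.+1) clip delta (c i * Xn i w).
pose A (c : nat -> R) n := [set w | eps < \big[Num.max/0]_(1 <= j < n.+1) T c j w].
have HT c j : H (T c j).
  apply: (rv_sum rvsH) => i; rewrite mem_index_iota => /andP[i1 _].
  by apply: (rv_clip rvsH) => //; exact: HXn.
have mA c n : measurable (A c n).
  by apply: (rv_measurable_gt rvsH); apply: (rv_bigmax rvsH) => j _; exact: HT.
have HZ n : H (Z n).
  apply: (rv_max rvsH); last exact: (rv_cst rvsH).
  by apply: (rvB rvsH); [exact: rv_max_partial_sum|exact: (rv_cst rvsH)].
have AT c n w : A c n w -> exists2 j, (j <= n)%N & eps <= T c j w.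
  move=> Aw; apply: contrapT => nex; move: Aw; apply/negP; rewrite -leNgt.
  apply: bigmax_nat_le => [|j /andP[_ jn]]; first exact: ltW.
  by rewrite leNgt; apply/negP => epsT; apply: nex; exists j => //; exact: ltW.
have nAT c n w : ~ A c n w -> forall j, (1 <= j <= n)%N -> T c j w <= eps.
  move=> nA j jn; apply: le_trans (le_bigmax_nat_term (T c ^~ w) jn) _.
  by rewrite leNgt; apply/negP.
have asb c n w : `[< A c n w >]%:R = \1_(A c n) w :> R.
  by rewrite indicE; case: asboolP => h; [rewrite mem_set|rewrite memNset].
pose S n w := \sum_(1 <= i < n.+1) excess delta (b n i * Xn i w).
pose z n i := fine (E (fun w => excess delta (b n i * Xn i w))).
have Hexc n i : (1 <= i)%N -> H (fun w => excess delta (b n i * Xn i w)).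
  by move=> i1; apply: (rv_excess rvsH); exact: HXn.
have zE n i : (1 <= i)%N -> E (fun w => excess delta (b n i * Xn i w)) = (z n i)%:E.
  by move=> i1; rewrite fineK// excess_fin.
have z0 n i : (1 <= i)%N -> 0 <= z n i.
  move=> i1; rewrite -lee_fin -zE//; apply: (E_ge rvsH subE); first exact: Hexc.
  by move=> w; exact: excess_ge0.
have HS n : H (S n).
  by apply: (rv_sum rvsH) => i; rewrite mem_index_iota => /andP[i1 _]; exact: Hexc.
have S0 n w : 0 <= S n w by apply: sumr_ge0 => i _; exact: excess_ge0.
have ES n : (E (S n) <= (\sum_(1 <= i < n.+1) z n i)%:E)%E.
  apply: le_trans (E_sum_le rvsH subE _ _) _.
  - by move=> i; rewrite mem_index_iota => /andP[i1 _]; exact: Hexc.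
  - by move=> i w; exact: excess_ge0.
  rewrite -sumEFin big_nat [leRHS]big_nat; apply: lee_sum => i /andP[i1 _].
  by rewrite zE.
pose v n := fine (capacity E (A (b n) n)) + fine (capacity E (A (fun i => - b n i) n)).
have EZ n : (E (Z n) <= (n%:R * delta * v n + \sum_(1 <= i < n.+1) z n i)%:E)%E.
  have nd : 0 <= n%:R * delta by rewrite mulr_ge0.
  have H1 c : H \1_(A c n) by exact: (rvs_indic rvsH).
  have i0 c w : 0 <= \1_(A c n) w :> R by rewrite indicE; case: (_ \in _).
  pose U w := n%:R * delta * (\1_(A (b n) n) w + \1_(A (fun i => - b n i) n) w).
  have HU : H U by apply: (rvZ rvsH); exact: (rvD rvsH).
  apply: (@le_trans _ _ (E (fun w => U w + S n w))).
    apply: (subexp_mono subE) => //; first exact: (rvD rvsH).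
    move=> w; rewrite /U -!asb; apply: max_partial_sum_excess_le => //.
    - exact: ltW.
    - exact: nAT.
    - exact: nAT.
  apply: le_trans (E_subadd_ge0 subE HU (HS n) _ _) _.
  - by apply: (E_ge rvsH subE) => // w; rewrite mulr_ge0// addr_ge0.
  - exact: (E_ge rvsH subE).
  rewrite EFinD; apply: leeD => //.
  rewrite (subexp_scale subE)//; last exact: (rvD rvsH).
  rewrite [in leRHS]EFinM; apply: lee_wpmul2l => //.
  rewrite /v EFinD !fineK ?(capacity_fin rvsH subE)//.
  by apply: (E_subadd_ge0 subE) => //; exact: (capacity_ge0 rvsH subE).
have EZ0 n : (0 <= E (Z n))%E.
  by apply: (E_ge rvsH subE) => // w; rewrite le_max lexx orbT.
have EZfin n : E (Z n) \is a fin_num.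
  by rewrite ge0_fin_numE//; exact: le_lt_trans (EZ n) (ltry _).
pose e n := fine (E (Z n)).
have eE n : E (Z n) = (e n)%:E by rewrite fineK.
have e0 n : 0 <= e n by rewrite -lee_fin -eE.
(* For the clipped part, n^(r-2) times n delta times a capacity of order n^(-(r+1)) is of order
   n^(-2), once for each sign. *)
have eub n : (1 <= n)%N -> (N0 <= n)%N ->
    n%:R `^ (r - 2) * e n <= 2 * delta * K1 * n%:R `^ (- 2) +
      n%:R `^ (r - 2) * \sum_(1 <= i < n.+1) z n i.
  move=> n1 Nn; have n0 : 0 < n%:R :> R by rewrite ltr0n.
  have := EZ n; rewrite eE lee_fin => h.
  apply: le_trans (ler_wpM2l (powR_ge0 _ _) h) _; rewrite mulrDr lerD2r.
  have vle : v n <= 2 * (K1 * n%:R `^ (- (r + 1))).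
    rewrite mulr_natl mulr2n; apply: lerD.
      rewrite -lee_fin fineK ?(capacity_fin rvsH subE)//.
      apply: (expb _ (b n) _ n1 Nn _ (mA _ _) (AT _ _)) => i iN.
      by rewrite gtr0_norm// b_pos.
    rewrite -lee_fin fineK ?(capacity_fin rvsH subE)//.
    apply: (expb _ (fun i => - b n i) _ n1 Nn _ (mA _ _) (AT _ _)) => i iN.
    by rewrite normrN gtr0_norm// b_pos.
  have nd : 0 <= n%:R * delta by rewrite mulr_ge0.
  apply: le_trans (ler_wpM2l (powR_ge0 _ _) (ler_wpM2l nd vle)) _.
  have -> : n%:R `^ (- 2) = n%:R `^ (r - 2) * n%:R * n%:R `^ (- (r + 1)) :> R.
    rewrite -[X in _ * X * _]powRr1// -!powRD ?(gt_eqF n0) ?implybT//.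
    by congr (_ `^ _); ring.
  by rewrite le_eqVlt; apply/orP; left; apply/eqP; ring.
pose t n i k := delta * 2 ^+ k * tail E X (delta * 2 ^+ k / `|b n i|).
have t0 n i k : 0 <= t n i k.
  by rewrite mulr_ge0 ?(tail_ge0 rvsH subE)// mulr_ge0// exprn_ge0.
have [Ct HCt] : exists C : R, forall K M,
    \sum_(1 <= n < M | (N0 <= n)%N) n%:R `^ (r - 2) *
      \sum_(1 <= i < n.+1) \sum_(k < K) t n i k <= C.
  (* This scale absorbs the constants in the upper bound on b_ni, so that delta 2^k / b_ni is at
     least s times a power of 2. *)
  pose s := delta / (C0 * 2 `^ (1 + beta)).
  have s0 : 0 < s by rewrite divr_gt0// mulr_gt0// pow2_gt0.
  have [B HB] := moment_condition_dyadic rvsH subE HX beta_gt r_gt s0 M.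
  apply: (@sum_cesaro_blocks _ _ _ beta_gt r_gt t (fun j => tail E X (s * 2 `^ j%:R))
    delta B N0) => //.
    by move=> j; exact: (tail_ge0 rvsH subE).
  move=> n i k a c Nn iN ca an ci.
  have i1 : (0 < i)%N by case/andP: ci => /block_gt0.
  have iN' : (1 <= i <= n)%N by rewrite i1.
  have bp := b_pos n i Nn iN'.
  rewrite /t -mulrA ler_wpM2l// ler_wpM2l ?exprn_ge0//.
  apply: (tail_anti rvsH subE HX); rewrite (gtr0_norm bp) ler_pdivlMr//.
  have bb := le_trans (b_le n i Nn iN') (ler_wpM2l (ltW C00) (cesaro_weight_le beta_gt ci an ca)).
  apply: le_trans (ler_wpM2l _ bb) _; first by rewrite mulr_ge0 ?pow2_ge0// ltW.
  rewrite /s [leLHS](_ : _ = delta * (2 `^ (k + (c + level beta (a - c)))%:R *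
    2 `^ (- (c%:R + (a - c)%:R * (1 + beta))))); last first.
    by field; rewrite !gt_eqF ?pow2_gt0.
  rewrite ler_wpM2l// -pow2D -pow2n ler_pow2// !natrD.
  by have := level_le (a - c) beta_gt; lra.
rewrite (@eq_eseriesr _ _ (fun n => (n%:R `^ (r - 2) * e n)%:E)); last first.
  by move=> n _; rewrite EFinM -eE.
pose u n := n%:R `^ (r - 2) * e n.
have u0 n : 0 <= u n by rewrite mulr_ge0 ?powR_ge0.
(* The three summands bound the finitely many rows below [N0], the clipped part, with the sum of
   n^(-2) at most 2, and the excess part. *)
apply: (@nneseries_lt_bounded _ _ (\sum_(n < N0) u n + (2 * delta * K1 * 2 + Ct))) => //.
move=> N; rewrite (bigID (fun n => (n < N0)%N))/=; apply: lerD.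
  apply: le_trans (@ler_sum_cond _ u (fun n => (n < N0)%N) N N0 u0 (fun _ => id)).
  rewrite -(big_mkord (fun n => (n < N0)%N)) big_mkcond [leRHS]big_mkcond.
  case: N => [|N]; first by rewrite !big_geq.
  rewrite [leRHS]big_ltn//= lerDr; case: ifP => // _; exact: u0.
under eq_bigl do rewrite -leqNgt.
apply: (@le_trans _ _ (\sum_(1 <= n < N | (N0 <= n)%N)
    (2 * delta * K1 * n%:R `^ (- 2) + n%:R `^ (r - 2) * \sum_(1 <= i < n.+1) z n i))).
  rewrite big_nat_cond [leRHS]big_nat_cond; apply: ler_sum => n /andP[/andP[n1 _] Nn].
  exact: eub.
rewrite big_split/=; apply: lerD.
  have k0 : 0 <= 2 * delta * K1 by rewrite mulr_ge0// mulr_ge0.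
  rewrite -mulr_sumr ler_wpM2l//; apply: le_trans (sum_inv_sqr_le N).
  rewrite big_mkcond/=; apply: (@le_trans _ _ (\sum_(1 <= n < N) n%:R `^ (- 2))).
    by apply: ler_sum => n _; case: ifP => // _; exact: powR_ge0.
  case: N => [|[|N]]; first by rewrite !big_geq.
    by rewrite [leLHS]big_geq// sumr_ge0// => n _; exact: powR_ge0.
  by rewrite [leRHS]big_nat_recr//= lerDl powR_ge0.
apply: (@sum_le_nneseries _ _ (fun n => (N0 <= n)%N) (fun n => n%:R `^ (r - 2))
  (fun n => \sum_(1 <= i < n.+1) z n i) (fun n k => \sum_(1 <= i < n.+1) t n i k)).
- by move=> n; exact: powR_ge0.
- by move=> n k; exact: sumr_ge0.
- move=> n Nn _; rewrite -sumEFin.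
  under eq_eseriesr do rewrite -sumEFin.
  rewrite nneseries_sum; last by move=> i k _; rewrite lee_fin.
  rewrite big_nat [leRHS]big_nat; apply: lee_sum => i /andP[i1 iN].
  have bp : 0 < b n i by apply: b_pos => //; rewrite i1.
  rewrite -zE//; apply: le_trans (E_excess_le rvsH subE csubE (HXn i1) _ d0) _.
    by rewrite gt_eqF.
  by under eq_eseriesr do rewrite tail_Xn//.
move=> K'; apply: le_trans (HCt K' N); apply: ler_sum => n _.
by rewrite ler_wpM2l ?powR_ge0// exchange_big.
Qed.

End forward.

(** * The converse *)

Section converse.
Context {d : measure_display} {Omega : measurableType d} {R : realType}.
Variables (H : set (Omega -> R)) (E : (Omega -> R) -> \bar R).
Variables (X : Omega -> R) (Xn : nat -> Omega -> R) (beta r : R).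
Variable b : nat -> nat -> R.
Hypothesis rvsH : random_variable_space H.
Hypothesis subE : sublinear_expectation H E.
Hypothesis HX : H X.
Hypothesis HXn : forall n, (1 <= n)%N -> H (Xn n).
Hypothesis indepXn : independent_seq H E Xn.
Hypothesis idXn : forall n, (1 <= n)%N -> identically_distributed H E (Xn n) X.
Hypothesis beta_gt : -1 < beta.
Hypothesis r_gt : 1 < r.

Lemma measurable_max_partial_sum_gt n (eps : R) :
  measurable [set w | eps < max_partial_sum b Xn n w].
Proof.
by apply: (rv_measurable_gt rvsH); exact: rv_max_partial_sum.
Qed.

(** Markov's inequality at half the level: where the maximum exceeds eps, its excess over eps/2 is
    more than eps/2. *)
Lemma capacity_max_le_excess n (eps : R) : 0 < eps ->
  (capacity E [set w | (eps < max_partial_sum b Xn n w)%R] <=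
   (2 / eps)%:E *
   E (fun w => Num.max (max_partial_sum b Xn n w - eps / 2)%R 0%R))%E.
Proof.
move=> e0; have k0 : 0 <= 2 / eps by rewrite divr_ge0// ltW.
have HZ : H (fun w => Num.max (max_partial_sum b Xn n w - eps / 2) 0).
  apply: (rv_max rvsH); last exact: (rv_cst rvsH).
  by apply: (rvB rvsH); [exact: rv_max_partial_sum|exact: (rv_cst rvsH)].
rewrite -(subexp_scale subE)//; apply: (subexp_mono subE).
- exact: (rvZ rvsH).
- exact: (rvs_indic rvsH (measurable_max_partial_sum_gt n eps)).
move=> w; rewrite indicE; have [/set_mem/= h|_] := boolP (w \in _); last first.
  by rewrite mulr_ge0// le_max lexx orbT.
rewrite mulrAC ler_pdivlMr// mul1r.
have : max_partial_sum b Xn n w - eps / 2 <=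
  Num.max (max_partial_sum b Xn n w - eps / 2) 0 by rewrite le_max lexx.
lra.
Qed.

Lemma capacity_series (eps : R) : 0 < eps ->
  (\sum_(1 <= n <oo) ((n%:R `^ (r - 2))%R%:E *
     E (fun w => Num.max (max_partial_sum b Xn n w - eps / 2)%R 0%R)) < +oo)%E ->
  (\sum_(1 <= n <oo) ((n%:R `^ (r - 2))%R%:E *
     capacity E [set w | (eps < max_partial_sum b Xn n w)%R]) < +oo)%E.
Proof.
move=> e0 h; have k0 : 0 <= 2 / eps by rewrite divr_ge0// ltW.
pose V n := capacity E [set w | eps < max_partial_sum b Xn n w].
have V0 n : (0 <= V n)%E.
  exact: (capacity_ge0 rvsH subE (measurable_max_partial_sum_gt n eps)).
apply: (@le_lt_trans _ _ ((2 / eps)%:E *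
  \sum_(1 <= n <oo) ((n%:R `^ (r - 2))%R%:E *
     E (fun w => Num.max (max_partial_sum b Xn n w - eps / 2)%R 0%R)))%E); last first.
  by rewrite lte_mul_pinfty.
have Z0 n : (0 <= E (fun w => Num.max (max_partial_sum b Xn n w - eps / 2)%R 0%R))%E.
  apply: (E_ge rvsH subE) => [|w]; last by rewrite le_max lexx orbT.
  apply: (rv_max rvsH); last exact: (rv_cst rvsH).
  by apply: (rvB rvsH); [exact: rv_max_partial_sum|exact: (rv_cst rvsH)].
have w0 n : (0 <= (n%:R `^ (r - 2))%R%:E :> \bar R)%E by rewrite lee_fin powR_ge0.
rewrite -nneseriesZl; last by move=> n _; exact: mule_ge0.
apply: lee_nneseries => [n _ _|n _]; first exact: mule_ge0 (V0 n).
rewrite muleCA; apply: lee_wpmul2l; first by rewrite lee_fin powR_ge0.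
exact: capacity_max_le_excess.
Qed.

Let Phi x := tail E X (2 `^ x).

Let Phi_ge0 x : 0 <= Phi x. Proof. exact: (tail_ge0 rvsH subE). Qed.

Let Phi_anti x y : x <= y -> Phi y <= Phi x.
Proof. by move=> xy; apply: (tail_anti rvsH subE) => //; exact: ler_pow2. Qed.

(** For a suitable eps, a lower bound for the sum of the tails of the b_ni X_i at 2 eps over i <
    2^a. The incomplete block c = a is left out, so that one value serves every n of block a. *)
Let q a := \sum_(c < a) 2 ^+ c * Phi (c%:R + (a - c)%N%:R * (1 + beta)).

Let q_ge0 a : 0 <= q a.
Proof. by apply: sumr_ge0 => c _; rewrite mulr_ge0// exprn_ge0. Qed.

Lemma capacity_series_blocks :
  array_approx b (fun n i => (i%:R / n%:R) `^ beta * n%:R^-1) ->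
  (forall eps : R, 0 < eps ->
     (\sum_(1 <= n <oo) ((n%:R `^ (r - 2))%R%:E *
       capacity E [set w | (eps < max_partial_sum b Xn n w)%R]) < +oo)%E) ->
  exists C : R, forall A, \sum_(a < A) 2 `^ (a%:R * (r - 1)) * q a <= C.
Proof.
move=> [C0 C00 [N0 _ HN0]] hser; have r1 := r_gt.
(* Chosen so that 2 eps cancels the constants in the lower bound on b_ni, whence 2 eps / b_ni <=
   2^(c + (a - c)(1 + beta)). *)
pose eps := (2 * C0 * 2 `^ (2 + beta))^-1.
have p0 : 0 < 2 * C0 * 2 `^ (2 + beta) by rewrite !mulr_gt0 ?pow2_gt0.
have eps0 : 0 < eps by rewrite invr_gt0.
have mV n := measurable_max_partial_sum_gt n eps.
pose V n := fine (capacity E [set w | eps < max_partial_sum b Xn n w]).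
have VE n : capacity E [set w | eps < max_partial_sum b Xn n w] = (V n)%:E.
  by rewrite fineK// (capacity_fin rvsH subE).
have V0 n : 0 <= V n by rewrite -lee_fin -VE (capacity_ge0 rvsH subE).
pose u n := n%:R `^ (r - 2) * V n.
have u0 n : 0 <= u n by rewrite mulr_ge0 ?powR_ge0.
have := hser eps eps0.
rewrite (@eq_eseriesr _ _ (fun n => (u n)%:E)); last first.
  by move=> n _; rewrite EFinM -VE.
move=> /(bounded_nneseries_lt u0)[B HB].
have b_pos n i : (N0 <= n)%N -> (1 <= i <= n)%N -> 0 < b n i.
  move=> Nn iN; have [_ +] := HN0 n Nn i iN.
  case/andP: iN => i1 iN; have w0 := cesaro_weight_gt0 beta i1 (leq_trans i1 iN).
  by move=> /(lt_le_trans w0); rewrite pmulr_rgt0.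
have qV a n : (N0 <= n)%N -> (2 ^ a <= n < 2 ^ a.+1)%N -> q a / (1 + q a) <= V n.
  move=> Nn an; rewrite -lee_fin -VE.
  apply: (@capacity_hit_ge _ _ _ _ _ rvsH subE Xn HXn indepXn
    (fun i => [set y | 2 * eps < `|b n i * y|]) _ n) => //.
  - move=> i; have mf : measurable_fun [set: R] (fun y : R => `|b n i * y|).
      by apply: measurableT_comp => //; apply: measurable_funM => //; exact: measurable_cst.
    have := mf measurableT `]2 * eps, +oo[%classic (measurable_itv _); rewrite setTI.
    by congr (measurable _); apply/seteqP; split=> y /=; rewrite in_itv/= andbT.
  (* A summand is the difference of two consecutive partial sums; if both are within eps, it is
     within 2 eps. *)
  - move=> i w /andP[i1 iN] /=; apply: contraPP => /negP; rewrite -leNgt => le.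
    have S j : (j <= n)%N -> `|\sum_(1 <= i < j.+1) b n i * Xn i w| <= eps.
      case: j => [_|j jn]; first by rewrite big_geq// normr0 ltW.
      apply: le_trans le.
      exact: (le_bigmax_nat_term (fun j => `|\sum_(1 <= i < j.+1) b n i * Xn i w|)).
    apply/negP; rewrite -leNgt.
    case: i i1 iN => // i _ iN.
    have -> : b n i.+1 * Xn i.+1 w = \sum_(1 <= k < i.+2) b n k * Xn k w -
        \sum_(1 <= k < i.+1) b n k * Xn k w.
      by rewrite big_nat_recr//= addrC addrK.
    have := ler_normB (\sum_(1 <= k < i.+2) b n k * Xn k w)
      (\sum_(1 <= k < i.+1) b n k * Xn k w).
    have := S i.+1 iN; have := S i (ltnW iN); lra.
  apply: (@le_trans _ _ (\sum_(1 <= i < 2 ^ a)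
      fine (capacity E [set w | 2 * eps < `|b n i * Xn i w|]))); last first.
    case/andP: an => an _.
    rewrite [leRHS](@big_cat_nat _ _ _ (2 ^ a))//= ?expn_gt0//; last exact: leqW.
    rewrite lerDl big_nat; apply: sumr_ge0 => i /andP[i1 _]; apply: fine_ge0.
    apply: (capacity_ge0 rvsH subE); apply: (rv_measurable_gt rvsH).
    apply: (rv_norm rvsH); apply: (rvZ rvsH); apply: HXn; apply: leq_trans i1.
    by rewrite expn_gt0.
  rewrite sum_blocks; apply: ler_sum => c _.
  apply: (@le_trans _ _ (\sum_(2 ^ c <= i < 2 ^ c.+1)
      Phi (c%:R + (a - c)%N%:R * (1 + beta)))).
    by rewrite sumr_const_nat expnS mul2n -addnn addnK -[leRHS]mulr_natl natrX.
  rewrite big_nat [leRHS]big_nat; apply: ler_sum => i ci.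
  have i1 : (0 < i)%N by case/andP: ci => /block_gt0.
  have iN : (1 <= i <= n)%N.
    rewrite i1/=; case/andP: ci => _ ic; case/andP: an => an _.
    rewrite (leq_trans (ltnW ic))// (leq_trans _ an)// leq_exp2l//.
  have bp := b_pos n i Nn iN.
  rewrite tail_scaled ?gt_eqF// (gtr0_norm bp).
  rewrite -/(tail E (Xn i) _) (tail_identically_distributed rvsH subE _ (HXn i1) HX (idXn i1)).
  apply: (tail_anti rvsH subE HX); rewrite ler_pdivrMr//.
  have [_ h] := HN0 n Nn i iN.
  have h' := le_trans (cesaro_weight_ge beta_gt ci an (ltnW (ltn_ord c))) h.
  set t := c%:R + _ in h' *.
  have : 2 `^ t * (2 `^ (- (2 + beta)) * 2 `^ (- t)) <= 2 `^ t * (C0 * b n i).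
    by rewrite ler_wpM2l ?pow2_ge0.
  rewrite mulrCA -[2 `^ t * 2 `^ (- t)]pow2D subrr powRr0 mulr1 => h2.
  have h3 : 2 * eps = C0^-1 * 2 `^ (- (2 + beta)).
    rewrite /eps powRN; field; rewrite !gt_eqF ?pow2_gt0//.
  by rewrite h3 ler_pdivrMl// mulrCA.
(* The factor 2 arises because the 2^a indices n of a block have weights bounded below only by
   2^(a(r-2) - 1). *)
apply: (@bounded_sum_ratio _ (r - 1) q (2 * B) N0); first by rewrite subr_gt0.
  exact: q_ge0.
move=> A.
apply: (@le_trans _ _ (2 * \sum_(1 <= n < 2 ^ A) u n)); last by rewrite ler_wpM2l.
rewrite sum_blocks mulr_sumr big_mkcond; apply: ler_sum => a _.
case: ifPn => Na; last by rewrite mulr_ge0// sumr_ge0.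
apply: (@le_trans _ _ (2 * \sum_(2 ^ a <= n < 2 ^ a.+1)
    2 `^ (a%:R * (r - 2) - 1) * (q a / (1 + q a)))).
  rewrite sumr_const_nat expnS mul2n -addnn addnK -[(_ * _) *+ _]mulr_natr natr_exp2.
  have -> : 2 `^ (a%:R * (r - 1)) = 2 `^ (a%:R * (r - 2) - 1) * 2 `^ a%:R * 2 `^ 1 :> R.
    by rewrite -!pow2D; congr (_ `^ _); ring.
  by rewrite powRr1// le_eqVlt; apply/orP; left; apply/eqP; ring.
rewrite ler_wpM2l// big_nat [leRHS]big_nat; apply: ler_sum => n an.
have Nn : (N0 <= n)%N.
  by case/andP: an => an _; rewrite (leq_trans _ an)// (leq_trans Na)// ltnW// ltn_expl.
apply: ler_pM; rewrite ?pow2_ge0 ?divr_ge0 ?addr_ge0//.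
  exact: block_powR_ge.
exact: qV.
Qed.

(** Away from beta = -1/r a single term of [q] is enough: c = 0 below this value and c = a - 1 above
    it. At the critical value the logarithm comes from adding many terms, through
    [dyadic_lower_critical]. *)
Lemma moment_condition_of_blocks (C : R) :
  (forall A, \sum_(a < A) 2 `^ (a%:R * (r - 1)) * q a <= C) ->
  moment_condition E X beta r.
Proof.
move=> HC; have r1 := r_gt; have b1 := beta_gt.
have qC J : \sum_(j < J) 2 `^ (j.+1%:R * (r - 1)) * q j.+1 <= C.
  apply: le_trans (HC J.+1); rewrite [leRHS]big_ord_recl/= lerDr.
  by rewrite mulr_ge0 ?pow2_ge0.
have q_term j c : (c < j)%N -> 2 ^+ c * Phi (c%:R + (j - c)%N%:R * (1 + beta)) <= q j.
  move=> cj; rewrite /q (bigD1 (Ordinal cj))//= lerDl sumr_ge0// => i _.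
  by rewrite mulr_ge0// exprn_ge0.
have powR_lim (p s t : R) : 0 < p -> 0 < s -> forall x, exists n, x < (2 `^ (n%:R * s + t)) `^ p.
  move=> p0 s0 x; have [n Hn] := pow2_unbounded (x * 2 `^ (- (t * p))) (mulr_gt0 s0 p0).
  exists n; rewrite -powRrM mulrDl pow2D -mulrA.
  have := Hn n (leqnn _); rewrite -(ltr_pM2r (pow2_gt0 (t * p))) -mulrA pow2Vl mulr1.
  by [].
split => br.
- pose p := (r - 1) / (1 + beta).
  have p0 : 0 < p by rewrite divr_gt0//; lra.
  have pE : (1 + beta) * p = r - 1 by rewrite /p; field; lra.
  (* The level met by the term c = 0 of [q j.+1]; passing to [tau j.+1] in the weight costs the
     factor 2^(r-1). *)
  pose tau j := 2 `^ (j%:R * (1 + beta) + (1 + beta)).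
  have tauE j : tau j = 2 `^ (j.+1%:R * (1 + beta)).
    by rewrite /tau -natr1; congr (_ `^ _); ring.
  apply: (@dyadic_choquet_lt _ _ _ _ _ rvsH subE X (fun y => y `^ p) HX
    (measurable_powR p) (fun y _ => powR_ge0 y p) (powR_incr p0) tau
    (2 `^ (r - 1) * C)).
  + exact: pow2_ge0.
  + by move=> n; rewrite !tauE ler_pow2// ler_wpM2r ?ler_nat//; lra.
  + by apply: powR_lim => //; lra.
  move=> J; apply: le_trans (ler_wpM2l (pow2_ge0 (r - 1)) (qC J)).
  rewrite mulr_sumr; apply: ler_sum => j _; rewrite [leRHS]mulrA -pow2D.
  rewrite !tauE -powRrM -mulrA pE.
  apply: ler_pM; [exact: pow2_ge0|exact: Phi_ge0| |].
    by rewrite ler_pow2// -[j.+2%:R]natr1; lra.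
  by have := q_term j.+1 0%N isT; rewrite expr0 mul1r add0r subn0.
- have r0 : 0 < r by lra.
  have [C' HC'] := dyadic_lower_critical r1 br Phi_ge0 Phi_anti HC.
  apply: (@dyadic_choquet_lt _ _ _ _ _ rvsH subE X (powR_mul_ln r) HX
    (measurable_powR_mul_ln r) (powR_mul_ln_ge0 r) (powR_mul_ln_incr r1)
    (fun j => 2 `^ j%:R) (2 `^ r * 2 * C')).
  + exact: pow2_ge0.
  + by move=> n; rewrite ler_pow2// ler_nat.
  + have ln20 : 0 < ln 2 :> R by rewrite ln_gt0// ltr1n.
    move=> x; have [n Hn] := pow2_unbounded (x / ln 2) r0; exists n.
    have := Hn n (leqnn _); rewrite ltr_pdivrMr// => /lt_le_trans; apply.
    rewrite /powR_mul_ln -powRrM ler_wpM2l ?pow2_ge0// ler_ln ?posrE//.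
    by rewrite lerD2l -[leLHS](powRr0 2) ler_pow2.
  have k0 : 0 <= 2 `^ r * 2 :> R by rewrite mulr_ge0 ?pow2_ge0.
  move=> J; apply: le_trans (ler_wpM2l k0 (HC' J)).
  rewrite mulr_sumr; apply: ler_sum => j _; rewrite [leRHS]mulrA ler_wpM2r ?(tail_ge0 rvsH subE)//.
  rewrite /powR_mul_ln -powRrM.
  have lnj : ln (1 + 2 `^ j.+1%:R) <= 2 * j.+1%:R :> R.
    apply: (@le_trans _ _ (j.+2%:R * ln 2)).
      rewrite -ln_powR ler_ln ?posrE ?pow2_gt0//.
      rewrite -[j.+2%:R]natr1 pow2D powRr1//.
      have : 1 <= 2 `^ j.+1%:R :> R by rewrite -[leLHS](powRr0 2) ler_pow2.
      lra.
    have ln21 : ln 2 <= 1 :> R.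
      rewrite -[leRHS]expRK ler_ln ?posrE ?expR_gt0//.
      by have := expR_ge1Dx (1 : R); lra.
    apply: (@le_trans _ _ (j.+2%:R)); first by rewrite ler_piMr.
    by rewrite -natrM ler_nat; lia.
  apply: le_trans (ler_wpM2l (pow2_ge0 _) lnj) _.
  rewrite -[j.+1%:R in leLHS]natr1 mulrDl mul1r pow2D.
  by rewrite le_eqVlt; apply/orP; left; apply/eqP; ring.
- have r0 : 0 < r by lra.
  (* The level met by the term c = j of [q j.+1], where a - c = 1; the constant is the ratio of
     tau_(j+1)^r to 2^((j+1)(r-1)) 2^j. *)
  pose tau j := 2 `^ (j%:R * 1 + (1 + beta)).
  have tauE j : tau j = 2 `^ (j%:R + (1 + beta)) by rewrite /tau mulr1.
  apply: (@dyadic_choquet_lt _ _ _ _ _ rvsH subE X (fun y => y `^ r) HX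
    (measurable_powR r) (fun y _ => powR_ge0 y r) (powR_incr r0) tau
    (2 `^ ((2 + beta) * r - (r - 1)) * C)).
  + exact: pow2_ge0.
  + by move=> n; rewrite !tauE ler_pow2// lerD2r ler_nat.
  + exact: powR_lim.
  move=> J; apply: le_trans (ler_wpM2l (pow2_ge0 _) (qC J)).
  rewrite mulr_sumr; apply: ler_sum => j _; rewrite [leRHS]mulrA -pow2D.
  have := q_term j.+1 j (ltnSn j); rewrite subSnn mul1r -/(Phi _) => h.
  apply: le_trans (ler_wpM2l (pow2_ge0 _) h).
  rewrite [leRHS]mulrA -pow2n -pow2D !tauE -powRrM.
  apply: ler_pM; [exact: pow2_ge0|exact: Phi_ge0| |by rewrite mulr1].
  by rewrite ler_pow2// -natr1; lra.
Qed.

End converse.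

Theorem theorem3p1 (d : measure_display) (Omega : measurableType d)
    (R : realType) (H : set (Omega -> R)) (E : (Omega -> R) -> \bar R)
    (X : Omega -> R) (Xn : nat -> Omega -> R) (beta r : R)
    (b : nat -> nat -> R)
    (rvsH : random_variable_space H)
    (subE : sublinear_expectation H E)
    (csubE : countably_subadditive H E)
    (HX : H X)
    (HXn : forall n, (1 <= n)%N -> H (Xn n))
    (indepXn : independent_seq H E Xn)
    (idXn : forall n, (1 <= n)%N -> identically_distributed H E (Xn n) X)
    (EXn : forall n, (1 <= n)%N ->
       E (Xn n) = 0%E /\ (- E (fun w => (- Xn n w)%R))%E = 0%E)
    (beta_gt : -1 < beta) (r_gt : 1 < r)
    (b_approx : array_approx b
       (fun n i => (i%:R / n%:R) `^ beta * n%:R^-1))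
    (b_sum : forall n, (1 <= n)%N -> \sum_(1 <= i < n.+1) b n i = 1) :
  (moment_condition E X beta r ->
     forall eps : R, 0 < eps ->
       (\sum_(1 <= n <oo) ((n%:R `^ (r - 2))%R%:E *
          E (fun w => Num.max (max_partial_sum b Xn n w - eps)%R 0%R))
        < +oo)%E /\
       (\sum_(1 <= n <oo) ((n%:R `^ (r - 2))%R%:E *
          capacity E [set w | (eps < max_partial_sum b Xn n w)%R])
        < +oo)%E) /\
  ((forall eps : R, 0 < eps ->
       (\sum_(1 <= n <oo) ((n%:R `^ (r - 2))%R%:E *
          E (fun w => Num.max (max_partial_sum b Xn n w - eps)%R 0%R))
        < +oo)%E) ->
     moment_condition E X beta r).
Proof.
split => [M eps eps0|hser].
  have ser e : 0 < e -> _ := fun e0 => forward_series rvsH subE csubE HX HXn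
    indepXn idXn EXn beta_gt r_gt b_sum e0 b_approx M.
  split; first exact: ser.
  by apply: (capacity_series rvsH subE HXn) => //; apply: ser; rewrite divr_gt0.
have capser e : 0 < e -> _ := fun e0 =>
  capacity_series rvsH subE HXn e0 (hser _ (divr_gt0 e0 (ltr0Sn R 1))).
have [C HC] := capacity_series_blocks rvsH subE HX HXn indepXn idXn beta_gt r_gt
  b_approx capser.
exact: (moment_condition_of_blocks rvsH subE HX beta_gt r_gt HC).
Qed.
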